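(* Let $K$ be an algebraically closed field and let $A = \Lambda_3'(\lambda)$ for some $\lambda\in K\setminus\{0,1\}$. Then: (i) $\dim_K HH^0(A)=6$. (ii) $\dim_K HH^1(A)=4$ if $\mathrm{char}(K)\neq 2$, and $\dim_K HH^1(A)=6$ if $\mathrm{char}(K)=2$. (iii) $\dim_K HH^2(A)=4$ if $\mathrm{char}(K)\neq 2$, and $\dim_K HH^2(A)=6$ if $\mathrm{char}(K)=2$.
   Context: For a finite-dimensional $K$-algebra $A$, $HH^n(A)=\mathrm{Ext}^n_{A^e}(A,A)$ with $A^e=A^{\mathrm{op}}\otimes_K A$ is the $n$-th Hochschild cohomology space. Paths are composed from left to right ($\alpha\beta$ means first $\alpha$, then $\beta$). For $\lambda\in K\setminus\{0,1\}$, $\Lambda_3'(\lambda)$ is the bound quiver algebra $KQ/I$, where $Q$ has vertices $1,2$ and arrows $\alpha:1\to1$, $\sigma:1\to2$, $\gamma:2\to1$, $\beta:2\to2$, and $I$ is given by the relations $\alpha^2=\sigma\gamma$, $\lambda\beta^2=\gamma\sigma$, $\gamma\alpha=\beta\gamma$, $\alpha\sigma=\sigma\beta$. *)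

(* Defs.v *)
From HB Require Import structures.
From mathcomp Require Import all_boot all_order all_algebra.
From mathcomp Require Import finmap monalg boolp.

Set Implicit Arguments.
Unset Strict Implicit.
Unset Printing Implicit Defensive.

Import GRing.Theory.

Local Open Scope ring_scope.
Local Open Scope quotient_scope.

(* Linear extension of [phi] to the free module on [X]. *)
Section LinearExtension.
Variables (R : nzRingType) (X : choiceType) (V : lmodType R).
Implicit Types (phi : X -> V) (f g : {malg R[X]}).

Definition mlin phi f : V := \sum_(p <- msupp f) f@_p *: phi p.

Lemma mlinEw phi f (d : {fset X}) :
  (msupp f `<=` d)%fset -> mlin phi f = \sum_(p <- d) f@_p *: phi p.
Proof.
move=> fd; rewrite /mlin (big_fset_incl _ fd) //= => p _ /mcoeff_outdom ->.
by rewrite scale0r.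
Qed.

Lemma mlin_is_linear phi : linear (mlin phi).
Proof.
move=> c f g; set d := (msupp f `|` msupp g)%fset.
have fd : (msupp f `<=` d)%fset by apply: fsubsetUl.
have gd : (msupp g `<=` d)%fset by apply: fsubsetUr.
have cd : (msupp (c *: f + g) `<=` d)%fset.
  apply: fsubset_trans (msuppD_le _ _) _.
  by apply: fsetUSS => //; apply: msuppZ_le.
rewrite (mlinEw phi fd) (mlinEw phi gd) (mlinEw phi cd).
rewrite scaler_sumr -big_split /=; apply: eq_bigr => p _.
by rewrite mcoeffD mcoeffZ scalerDl scalerA.
Qed.

HB.instance Definition _ phi :=
  GRing.isLinear.Build R {malg R[X]} V *:%R (mlin phi) (mlin_is_linear phi).

Lemma mlinU phi p : mlin phi << p >> = phi p.
Proof.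
rewrite (mlinEw phi (msuppU_le (k := p) (x := 1))) big_seq_fset1.
by rewrite mcoeffUU scale1r.
Qed.

Lemma malgUZ (c : R) (p : X) : << c *g p >> = c *: << p >> :> {malg R[X]}.
Proof. by apply/malgP => q; rewrite mcoeffZ !mcoeffU mulrnAr mulr1. Qed.

Lemma malg_ind (P : {malg R[X]} -> Prop) :
    P 0 -> (forall c p f, P f -> P (c *: << p >> + f)) -> forall f, P f.
Proof.
move=> P0 PD f; rewrite [f]monalgE; elim: (X in \sum_(p <- X) _) => [|p s IHs].
  by rewrite big_nil.
by rewrite big_cons malgUZ; apply: PD.
Qed.

Lemma eq_mlin phi psi : phi =1 psi -> mlin phi =1 mlin psi.
Proof. by move=> e f; apply: eq_bigr => p _; rewrite e. Qed.

End LinearExtension.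

(* The category algebra of a small category with finitely many objects, given  *)
(* by its morphisms: composition is partial, and [ids] lists the identities.   *)
(* The last three axioms say that each morphism has exactly one left and one   *)
(* right identity, and that there is at least one object.                      *)
Record fincat := Fincat {
  mor :> choiceType;
  comp : mor -> mor -> option mor;
  ids : seq mor;
  compA : forall p q r,
    obind (comp p) (comp q r) = obind (comp^~ r) (comp p q);
  comp_idl : forall p, pmap (fun e => comp e p) ids = [:: p];
  comp_idr : forall p, pmap (fun e => comp p e) ids = [:: p];
  ids_neq0 : (0 < size ids)%N
}.

Section CategoryAlgebra.
Variables (K : fieldType) (C : fincat).

Definition catalg := {malg K[C]}.
HB.instance Definition _ := GRing.Lmodule.on catalg.

Fact catalg_key : unit. Proof. by []. Qed.

Definition cbase : C -> catalg := locked_with catalg_key (fun p => << p >>).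
Definition obase (o : option C) : catalg := oapp cbase 0 o.

Definition catalg_mul : catalg -> catalg -> catalg := locked_with catalg_key
  (fun f g => mlin (fun p => mlin (fun q => obase (comp p q)) g : catalg) f).

Definition catalg_one : catalg := \sum_(e <- ids C) cbase e.

Lemma cbaseE p : cbase p = << p >>.
Proof. by rewrite /cbase unlock. Qed.

Lemma catalg_mull h c f g :
  catalg_mul (c *: f + g) h = c *: catalg_mul f h + catalg_mul g h.
Proof. by rewrite /catalg_mul unlock linearP. Qed.

Lemma catalg_mulr h c f g :
  catalg_mul h (c *: f + g) = c *: catalg_mul h f + catalg_mul h g.
Proof.
rewrite /catalg_mul unlock /mlin scaler_sumr -big_split /=; apply: eq_bigr => p _.
by rewrite -!/(mlin _ _) linearP scalerDr !scalerA mulrC.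
Qed.

Lemma catalg_mulU p q : catalg_mul (cbase p) (cbase q) = obase (comp p q).
Proof. by rewrite /catalg_mul unlock !cbaseE !mlinU. Qed.

Let catalg_eqD (c : K) (u v w : catalg) : u = v -> c *: u + w = c *: v + w.
Proof. by move->. Qed.

Lemma catalg_ind (P : catalg -> Prop) :
    P 0 -> (forall c p f, P f -> P (c *: cbase p + f)) -> forall f, P f.
Proof.
move=> P0 PD; apply: malg_ind => // c p f; rewrite -cbaseE; exact: PD.
Qed.

Lemma catalg_mul0l h : catalg_mul 0 h = 0.
Proof. by rewrite /catalg_mul unlock linear0. Qed.

Lemma catalg_mul0r h : catalg_mul h 0 = 0.
Proof.
have := catalg_mulr h 1 0 0; rewrite !scale1r addr0 => e.
by apply: (addrI (catalg_mul h 0)); rewrite -e addr0.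
Qed.


Lemma catalg_mulDl : left_distributive catalg_mul +%R.
Proof. by move=> f g h; have:= catalg_mull h 1 f g; rewrite !scale1r. Qed.

Lemma catalg_mulDr : right_distributive catalg_mul +%R.
Proof. by move=> f g h; have:= catalg_mulr f 1 g h; rewrite !scale1r. Qed.

Lemma catalg_mulA : associative catalg_mul.
Proof.
move=> f g h; elim/catalg_ind: f => [|c p f IHf].
  by rewrite !catalg_mul0l.
rewrite 2!(catalg_mull _ c (cbase p)) (catalg_mull _ c (catalg_mul _ _)) IHf.
apply: catalg_eqD.
elim/catalg_ind: g {IHf} => [|d q g IHg].
  by rewrite catalg_mul0l catalg_mul0r catalg_mul0l.
rewrite (catalg_mull _ d (cbase q)) (catalg_mulr _ d (cbase q)).
rewrite (catalg_mulr _ d (catalg_mul _ _)) (catalg_mull _ d (catalg_mul _ _)).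
rewrite IHg; apply: catalg_eqD; elim/catalg_ind: h {IHg} => [|e r h IHh].
  by rewrite !catalg_mul0r.
rewrite 2!(catalg_mulr _ e (cbase r)) (catalg_mulr _ e (catalg_mul _ _)) IHh.
apply: catalg_eqD.
rewrite !catalg_mulU; have := compA p q r.
case: (comp q r) => [s|]; case: (comp p q) => [t|] /= E.
- by rewrite !catalg_mulU E.
- by rewrite catalg_mul0l catalg_mulU E.
- by rewrite catalg_mul0r catalg_mulU -E.
- by rewrite catalg_mul0l catalg_mul0r.
Qed.

Lemma sum_obase (h : C -> option C) s :
  \sum_(e <- s) obase (h e) = \sum_(x <- pmap h s) cbase x.
Proof.
elim: s => [|e s IHs]; first by rewrite !big_nil.
rewrite big_cons IHs /=; case: (h e) => [x|] /=; last by rewrite add0r.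
by rewrite big_cons.
Qed.

Lemma catalg_mul1l : left_id catalg_one catalg_mul.
Proof.
elim/catalg_ind => [|c p f IHf]; first exact: catalg_mul0r.
rewrite (catalg_mulr _ c (cbase p)) IHf; apply: catalg_eqD.
rewrite /catalg_one (big_morph (catalg_mul^~ _) (fun u v => catalg_mulDl u v _)
  (catalg_mul0l _)).
under eq_bigr do rewrite catalg_mulU.
by rewrite sum_obase comp_idl big_seq1.
Qed.

Lemma catalg_mul1r : right_id catalg_one catalg_mul.
Proof.
elim/catalg_ind => [|c p f IHf]; first exact: catalg_mul0l.
rewrite (catalg_mull _ c (cbase p)) IHf; apply: catalg_eqD.
rewrite /catalg_one (big_morph (catalg_mul _) (catalg_mulDr _) (catalg_mul0r _)).
under eq_bigr do rewrite catalg_mulU.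
by rewrite sum_obase comp_idr big_seq1.
Qed.

Lemma catalg_one_neq0 : catalg_one != 0.
Proof.
apply/eqP => e; have := ids_neq0 C; case: (ids C) => // p _ _.
have := catalg_mul1l (cbase p); rewrite e catalg_mul0l => /malgP/(_ p)/eqP.
by rewrite cbaseE mcoeffUU mcoeff0 eq_sym oner_eq0.
Qed.

HB.instance Definition _ := GRing.Zmodule_isNzRing.Build catalg
  catalg_mulA catalg_mul1l catalg_mul1r catalg_mulDl catalg_mulDr
  catalg_one_neq0.

Lemma catalg_scalerAl (c : K) (f g : catalg) : c *: (f * g) = (c *: f) * g.
Proof. by rewrite -[c *: f]addr0 [RHS]catalg_mull catalg_mul0l addr0. Qed.

HB.instance Definition _ :=
  GRing.Lmodule_isLalgebra.Build K catalg catalg_scalerAl.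

Lemma catalg_scalerAr (c : K) (f g : catalg) : c *: (f * g) = f * (c *: g).
Proof. by rewrite -[c *: g]addr0 [RHS]catalg_mulr catalg_mul0r addr0. Qed.

HB.instance Definition _ :=
  GRing.Lalgebra_isAlgebra.Build K catalg catalg_scalerAr.

Lemma catalg_oneE : 1 = \sum_(e <- ids C) cbase e :> catalg.
Proof. by []. Qed.

Lemma cbaseM p q : cbase p * cbase q = obase (comp p q).
Proof. exact: catalg_mulU. Qed.

End CategoryAlgebra.

(* Two-sided ideal generated by [S]: the finite sums of elements a * s * b     *)
(* with [S s].                                                                 *)
Inductive ideal_gen (B : nzRingType) (S : B -> Prop) : B -> Prop :=
| ideal_gen0 : ideal_gen S 0
| ideal_genD a s b x : S s -> ideal_gen S x -> ideal_gen S (a * s * b + x).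

Section IdealGen.
Variables (B : nzRingType) (S : B -> Prop).

Lemma ideal_gen_add x y :
  ideal_gen S x -> ideal_gen S y -> ideal_gen S (x + y).
Proof.
move=> Ix Iy; elim: Ix => [|a s b z Ss _ Iz]; first by rewrite add0r.
by rewrite -addrA; apply: ideal_genD.
Qed.

Lemma ideal_gen_mul c d x : ideal_gen S x -> ideal_gen S (c * x * d).
Proof.
elim=> [|a s b z Ss _ Iz]; first by rewrite mulr0 mul0r; apply: ideal_gen0.
have -> : c * (a * s * b + z) * d = (c * a) * s * (b * d) + c * z * d.
  by rewrite mulrDr mulrDl !mulrA.
exact: ideal_genD.
Qed.

Definition ideal_pred : {pred B} := fun x => `[< ideal_gen S x >].

Lemma ideal_predP x : reflect (ideal_gen S x) (x \in ideal_pred).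
Proof. exact: asboolP. Qed.

Lemma ideal_pred_zmod : zmod_closed ideal_pred.
Proof.
split=> [|x y /ideal_predP Ix /ideal_predP Iy]; apply/ideal_predP.
  exact: ideal_gen0.
apply: ideal_gen_add => //; rewrite -[y]mulr1 -mulN1r mulrA.
exact: ideal_gen_mul.
Qed.

HB.instance Definition _ := GRing.isZmodClosed.Build B ideal_pred ideal_pred_zmod.

End IdealGen.

Section QuotientAlgebra.
Variables (K : fieldType) (B : algType K) (S : B -> Prop).

Local Notation quotS := (Quotient.quot (ideal_pred S)).

(* The properness of the ideal makes the quotient a nonzero ring, as required  *)
(* by [algType].                                                               *)
Definition quotalg (proper : ~ ideal_gen S 1) : Type := quotS.

Variable proper : ~ ideal_gen S 1.
Local Notation Q := (quotalg proper).

HB.instance Definition _ := GRing.Zmodule.copy Q quotS.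

Definition qpi (x : B) : Q := \pi_quotS x.
Definition qrepr (u : Q) : B := repr (u : quotS).

Lemma qreprK : cancel qrepr qpi.
Proof. exact: reprK. Qed.

Lemma qpiP x y : qpi x = qpi y <-> ideal_gen S (x - y).
Proof.
have e := Quotient.idealrBE (ideal_pred S) x y.
split=> [exy | /ideal_predP Ixy].
  by apply/ideal_predP; rewrite e; apply/eqP.
by apply/eqP; rewrite -[_ == _]e.
Qed.

Lemma qreprP x : ideal_gen S (qrepr (qpi x) - x).
Proof. by apply/qpiP; rewrite qreprK. Qed.

Lemma qpi_is_zmod_morphism : zmod_morphism qpi.
Proof.
move=> x y; rewrite /qpi; transitivity (\pi_quotS x - \pi_quotS y) => //.
exact: (raddfB (\pi_quotS)).
Qed.

HB.instance Definition _ := GRing.isZmodMorphism.Build B Q qpi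
  qpi_is_zmod_morphism.

Definition quot_mul (u v : Q) : Q := qpi (qrepr u * qrepr v).
Definition quot_scale (c : K) (u : Q) : Q := qpi (c *: qrepr u).

Lemma qpi_mul x y : qpi (x * y) = quot_mul (qpi x) (qpi y).
Proof.
apply/esym/qpiP; set x' := qrepr _; set y' := qrepr _.
have -> : x' * y' - x * y = 1 * (x' - x) * y' + x * (y' - y) * 1.
  by rewrite mul1r mulr1 mulrBl mulrBr addrA subrK.
by apply: ideal_gen_add; apply: ideal_gen_mul; apply: qreprP.
Qed.

Lemma qpi_scale c x : qpi (c *: x) = quot_scale c (qpi x).
Proof.
apply/esym/qpiP; rewrite -scalerBr -mulr_algl -[_ * _]mulr1.
exact/ideal_gen_mul/qreprP.
Qed.

Lemma qpi_ind (P : Q -> Prop) : (forall x, P (qpi x)) -> forall u, P u.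
Proof. by move=> Ppi u; rewrite -[u]qreprK. Qed.

Lemma quot_mulA : associative quot_mul.
Proof.
elim/qpi_ind=> x; elim/qpi_ind=> y; elim/qpi_ind=> z.
by rewrite -!qpi_mul mulrA.
Qed.

Lemma quot_mul1l : left_id (qpi 1) quot_mul.
Proof. by elim/qpi_ind=> x; rewrite -qpi_mul mul1r. Qed.

Lemma quot_mul1r : right_id (qpi 1) quot_mul.
Proof. by elim/qpi_ind=> x; rewrite -qpi_mul mulr1. Qed.

Lemma quot_mulDl : left_distributive quot_mul +%R.
Proof.
elim/qpi_ind=> x; elim/qpi_ind=> y; elim/qpi_ind=> z.
by rewrite -raddfD -!qpi_mul mulrDl raddfD.
Qed.

Lemma quot_mulDr : right_distributive quot_mul +%R.
Proof.
elim/qpi_ind=> x; elim/qpi_ind=> y; elim/qpi_ind=> z.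
by rewrite -raddfD -!qpi_mul mulrDr raddfD.
Qed.

Lemma quot_1neq0 : qpi 1 != 0.
Proof.
by apply/eqP; rewrite -(raddf0 qpi) => /qpiP; rewrite subr0; apply: proper.
Qed.

HB.instance Definition _ := GRing.Zmodule_isNzRing.Build Q
  quot_mulA quot_mul1l quot_mul1r quot_mulDl quot_mulDr quot_1neq0.

Lemma quot_scaleA a b u : quot_scale a (quot_scale b u) = quot_scale (a * b) u.
Proof. by elim/qpi_ind: u => x; rewrite -!qpi_scale scalerA. Qed.

Lemma quot_scale1 : left_id 1 quot_scale.
Proof. by elim/qpi_ind=> x; rewrite -qpi_scale scale1r. Qed.

Lemma quot_scaleDr : right_distributive quot_scale +%R.
Proof.
move=> c; elim/qpi_ind=> x; elim/qpi_ind=> y.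
by rewrite -raddfD -!qpi_scale scalerDr raddfD.
Qed.

Lemma quot_scaleDl u : {morph quot_scale^~ u : a b / a + b}.
Proof.
move=> a b; elim/qpi_ind: u => x.
by rewrite -!qpi_scale scalerDl raddfD.
Qed.

HB.instance Definition _ := GRing.Zmodule_isLmodule.Build K Q
  quot_scaleA quot_scale1 quot_scaleDr quot_scaleDl.

Lemma quot_scalerAl (c : K) (u v : Q) : c *: (u * v) = (c *: u) * v.
Proof.
elim/qpi_ind: u => x; elim/qpi_ind: v => y.
rewrite [LHS](_ : _ = quot_scale c (quot_mul (qpi x) (qpi y))) //.
rewrite [RHS](_ : _ = quot_mul (quot_scale c (qpi x)) (qpi y)) //.
by rewrite -qpi_mul -!qpi_scale -qpi_mul scalerAl.
Qed.

HB.instance Definition _ := GRing.Lmodule_isLalgebra.Build K Q quot_scalerAl.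

Lemma quot_scalerAr (c : K) (u v : Q) : c *: (u * v) = u * (c *: v).
Proof.
elim/qpi_ind: u => x; elim/qpi_ind: v => y.
rewrite [LHS](_ : _ = quot_scale c (quot_mul (qpi x) (qpi y))) //.
rewrite [RHS](_ : _ = quot_mul (qpi x) (quot_scale c (qpi y))) //.
by rewrite -qpi_mul -!qpi_scale -qpi_mul scalerAr.
Qed.

HB.instance Definition _ := GRing.Lalgebra_isAlgebra.Build K Q quot_scalerAr.

Lemma qpi_is_linear : linear qpi.
Proof. by move=> c x y; rewrite (raddfD qpi) /= qpi_scale. Qed.

HB.instance Definition _ := GRing.isLinear.Build K B Q *:%R qpi qpi_is_linear.

Lemma qpi_is_monoid_morphism : monoid_morphism qpi.
Proof. by split=> // x y; apply: qpi_mul. Qed.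

HB.instance Definition _ := GRing.isMonoidMorphism.Build B Q qpi
  qpi_is_monoid_morphism.

End QuotientAlgebra.

Record quiver := Quiver {
  vertex : finType;
  arrow : finType;
  source : arrow -> vertex;
  target : arrow -> vertex;
  vertex_nonempty : (0 < #|vertex|)%N
}.

Section PathAlgebra.
Variables (K : fieldType) (Q : quiver).

Fixpoint walk (x : vertex Q) (s : seq (arrow Q)) : bool :=
  if s is a :: s' then (source a == x) && walk (target a) s' else true.

(* A path is its starting vertex together with its sequence of arrows, read    *)
(* from left to right.                                                         *)
Record qpath := QPath {
  qpath_val : vertex Q * seq (arrow Q);
  _ : walk qpath_val.1 qpath_val.2
}.
HB.instance Definition _ := [isSub for qpath_val].
HB.instance Definition _ := [Choice of qpath by <:].

Definition psource (p : qpath) : vertex Q := (qpath_val p).1.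
Definition parrows (p : qpath) : seq (arrow Q) := (qpath_val p).2.
Definition ptarget (p : qpath) : vertex Q :=
  last (psource p) (map (@target Q) (parrows p)).

Definition trivial_path (x : vertex Q) : qpath := @QPath (x, [::]) isT.

Fact arrow_walk (a : arrow Q) : walk (source a) [:: a].
Proof. by rewrite /= eqxx. Qed.
Definition arrow_path (a : arrow Q) : qpath :=
  @QPath (source a, [:: a]) (arrow_walk a).

(* First [p], then [q]. *)
Definition concat (p q : qpath) : option qpath :=
  if ptarget p == psource q then insub (psource p, parrows p ++ parrows q)
  else None.

Lemma walk_cat x s t :
  walk x (s ++ t) = walk x s && walk (last x (map (@target Q) s)) t.
Proof. by elim: s x => //= a s IHs x; rewrite IHs andbA. Qed.

Lemma concatP p q : ptarget p = psource q ->
  {r | concat p q = Some r & qpath_val r = (psource p, parrows p ++ parrows q)}.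
Proof.
move=> e; rewrite /concat e eqxx; case: insubP => [r _ er|]; first by exists r.
case: p q e => -[x s] /= ws [[y t] /= wt]; rewrite /ptarget /psource /parrows /=.
by move=> e; rewrite walk_cat ws e wt.
Qed.

Lemma concatA p q r :
  obind (concat p) (concat q r) = obind (concat^~ r) (concat p q).
Proof.
have tgt u v w : ptarget u = psource v ->
  qpath_val w = (psource u, parrows u ++ parrows v) -> ptarget w = ptarget v.
  by rewrite /ptarget /psource /parrows => e ->; rewrite map_cat last_cat e.
have [eqr|nqr] := eqVneq (ptarget q) (psource r); last first.
  rewrite [concat q r]/concat (negPf nqr) /=.
  have [epq|npq] := eqVneq (ptarget p) (psource q); last first.
    by rewrite /concat (negPf npq).
  have [w -> ew] := concatP epq; rewrite /= /concat (tgt _ _ _ epq ew).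
  by rewrite (negPf nqr).
have [v -> ev] := concatP eqr; have sv : psource v = psource q.
  by rewrite /psource ev.
have [epq|npq] := eqVneq (ptarget p) (psource q); last first.
  by rewrite /= /concat sv (negPf npq).
have [w -> ew] := concatP epq; have sw : psource w = psource p.
  by rewrite /psource ew.
rewrite /=; have [|v' -> ev'] := @concatP p v; first by rewrite sv.
have [|w' -> ew'] := @concatP w r; first by rewrite (tgt _ _ _ epq ew).
congr Some; apply: val_inj; rewrite /= ev' ew' sw; congr pair.
by rewrite /parrows ev ew /= catA.
Qed.

Lemma concat_trivl x p :
  concat (trivial_path x) p = if x == psource p then Some p else None.
Proof.
rewrite /concat /ptarget /=; have [->|//] := eqVneq x; rewrite -/(psource p).
by rewrite -[RHS](valK p); congr insub; rewrite [val p]surjective_pairing.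
Qed.

Lemma concat_trivr x p :
  concat p (trivial_path x) = if x == ptarget p then Some p else None.
Proof.
rewrite /concat eq_sym; case: eqP => // _.
by rewrite -[RHS](valK p) cats0; congr insub; rewrite [val p]surjective_pairing.
Qed.

Let pmap_triv y (p : qpath) :
  pmap (fun x => if x == y then Some p else None) (enum (vertex Q)) = [:: p].
Proof.
have: count_mem y (enum (vertex Q)) = 1%N.
  by rewrite count_uniq_mem ?enum_uniq // mem_enum.
elim: (enum _) => //= x s IHs; case: eqP => _ /=; last by rewrite add0n.
rewrite add1n => -[/eqP]; rewrite -leqn0 leqNgt -has_count => /hasPn ys.
congr cons; elim: s ys {IHs} => //= z s IHs ys.
rewrite (negPf (ys z _)) ?inE ?eqxx //=; apply: IHs => t ts.
by apply: ys; rewrite inE ts orbT.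
Qed.

Fact path_idl p :
  pmap (fun e => concat e p) (map trivial_path (enum (vertex Q))) = [:: p].
Proof.
rewrite -[RHS](pmap_triv (psource p)); elim: (enum _) => //= x s ->.
by rewrite concat_trivl.
Qed.

Fact path_idr p :
  pmap (fun e => concat p e) (map trivial_path (enum (vertex Q))) = [:: p].
Proof.
rewrite -[RHS](pmap_triv (ptarget p)); elim: (enum _) => //= x s ->.
by rewrite concat_trivr.
Qed.

Fact path_ids_neq0 : (0 < size (map trivial_path (enum (vertex Q))))%N.
Proof. by rewrite size_map -cardE vertex_nonempty. Qed.

Definition path_category : fincat :=
  Fincat concatA path_idl path_idr path_ids_neq0.

Definition path_algebra : algType K := catalg K path_category.

Definition arr (a : arrow Q) : path_algebra :=
  cbase K (arrow_path a : path_category).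

End PathAlgebra.

(* The monoid algebra of the multiplicative monoid of [X] is a category        *)
(* algebra with one object.                                                    *)
Section MultiplicativeMonoid.
Variable X : nzRingType.

Fact mul_compA (p q r : X) :
  obind (fun s => Some (p * s)) (Some (q * r)) =
  obind (fun s => Some (s * r)) (Some (p * q)).
Proof. by rewrite /= mulrA. Qed.

Fact mul_idl (p : X) : pmap (fun e => Some (e * p)) [:: 1] = [:: p].
Proof. by rewrite /= mul1r. Qed.

Fact mul_idr (p : X) : pmap (fun e => Some (p * e)) [:: 1] = [:: p].
Proof. by rewrite /= mulr1. Qed.

Definition mul_category : fincat :=
  @Fincat X (fun p q => Some (p * q)) [:: 1] mul_compA mul_idl mul_idr isT.

End MultiplicativeMonoid.

Section EnvelopingAlgebra.
Variables (K : fieldType) (A : algType K).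

Definition preenv : algType K := catalg K (mul_category (A^c * A)%type).

Definition pretensor (a b : A) : preenv :=
  cbase K ((a, b) : mul_category (A^c * A)%type).

(* K-bilinearity relations. *)
Inductive env_rel : preenv -> Prop :=
| env_relDl a a' b :
    env_rel (pretensor (a + a') b - (pretensor a b + pretensor a' b))
| env_relDr a b b' :
    env_rel (pretensor a (b + b') - (pretensor a b + pretensor a b'))
| env_relZl c a b : env_rel (pretensor (c *: a) b - c *: pretensor a b)
| env_relZr c a b : env_rel (pretensor a (c *: b) - c *: pretensor a b).

Definition env_act (f : preenv) (x : A) : A :=
  mlin (fun p : A^c * A => p.2 * x * p.1) f.

Lemma env_actDl f g x : env_act (f + g) x = env_act f x + env_act g x.
Proof. exact: (raddfD (mlin _)). Qed.

Lemma env_actZl c f x : env_act (c *: f) x = c *: env_act f x.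
Proof. exact: (linearZZ (mlin _)). Qed.

Lemma env_actBl f g x : env_act (f - g) x = env_act f x - env_act g x.
Proof. exact: (raddfB (mlin _)). Qed.

Lemma env_act0l x : env_act 0 x = 0.
Proof. exact: (raddf0 (mlin _)). Qed.

Lemma env_actU a b x : env_act (pretensor a b) x = b * x * a.
Proof. rewrite /pretensor cbaseE; exact: mlinU. Qed.

Lemma env_actP c a b f x :
  env_act (c *: pretensor a b + f) x = c *: (b * x * a) + env_act f x.
Proof. by rewrite env_actDl env_actZl env_actU. Qed.

Lemma env_act_ind (P : preenv -> Prop) :
    P 0 -> (forall c a b f, P f -> P (c *: pretensor a b + f)) ->
  forall f, P f.
Proof.
move=> P0 PD; apply: catalg_ind => // c [a b] f; exact: PD.
Qed.

Lemma env_actDr f x y : env_act f (x + y) = env_act f x + env_act f y.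
Proof.
elim/env_act_ind: f => [|c a b f IHf]; first by rewrite !env_act0l addr0.
by rewrite !(env_actP c a b f) IHf mulrDr mulrDl scalerDr addrACA.
Qed.

Lemma env_act0r f : env_act f 0 = 0.
Proof. by apply: (addrI (env_act f 0)); rewrite -env_actDr !addr0. Qed.

Lemma env_actZr c f x : env_act f (c *: x) = c *: env_act f x.
Proof.
elim/env_act_ind: f => [|d a b f IHf]; first by rewrite !env_act0l scaler0.
rewrite !(env_actP d a b f) IHf scalerDr -scalerAr -scalerAl !scalerA.
by rewrite [d * c]mulrC.
Qed.

Lemma pretensorM a b a' b' :
  pretensor a b * pretensor a' b' = pretensor (a' * a) (b * b').
Proof. exact: cbaseM. Qed.

Lemma env_actM f g x : env_act (f * g) x = env_act f (env_act g x).
Proof.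
elim/env_act_ind: f => [|c a b f IHf]; first by rewrite mul0r !env_act0l.
rewrite env_actP (mulrDl (c *: pretensor a b)) env_actDl IHf.
rewrite -(scalerAl c (pretensor a b)) env_actZl.
suff -> : env_act (pretensor a b * g) x = b * env_act g x * a by [].
elim/env_act_ind: g {IHf} => [|d a' b' g IHg].
  by rewrite mulr0 !env_act0l mulr0 mul0r.
rewrite env_actP (mulrDr (pretensor a b)) env_actDl IHg.
rewrite -(scalerAr d (pretensor a b)) env_actZl pretensorM env_actU.
by rewrite mulrDr mulrDl -scalerAr -scalerAl !mulrA.
Qed.

Lemma env_act1 x : env_act 1 x = x.
Proof.
have -> : 1 = pretensor 1 1 by rewrite catalg_oneE big_seq1.
by rewrite env_actU mul1r mulr1.
Qed.

Lemma env_act_ideal f x : ideal_gen env_rel f -> env_act f x = 0.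
Proof.
elim=> [|u s v g rs _ IHg]; first exact: env_act0l.
rewrite env_actDl IHg addr0 !env_actM.
suff -> y : env_act s y = 0 by rewrite env_act0r.
case: rs => [a a' b|a b b'|c a b|c a b]; rewrite env_actBl.
- by rewrite env_actU env_actDl !env_actU mulrDr subrr.
- by rewrite env_actU env_actDl !env_actU !mulrDl subrr.
- by rewrite env_actU env_actZl env_actU -scalerAr subrr.
- by rewrite env_actU env_actZl env_actU -!scalerAl subrr.
Qed.

Lemma env_proper : ~ ideal_gen env_rel 1.
Proof.
move=> /(env_act_ideal 1)/eqP; rewrite env_act1 oner_eq0.
by [].
Qed.

(* A^op (x)_K A, as the quotient of the monoid algebra of A^op x A by the      *)
(* bilinearity relations.                                                      *)
Definition env : algType K := quotalg env_proper.

Definition tensor (a b : A) : env := qpi env_proper (pretensor a b).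

(* A as a left module over A^op (x)_K A, with (a (x) b) . x = b * x * a.       *)
Definition regbimod : Type := A.
HB.instance Definition _ := GRing.Zmodule.on regbimod.

Definition env_scale (t : env) (x : regbimod) : regbimod :=
  env_act (qrepr t) x.

Lemma env_scaleE f x : env_scale (qpi env_proper f) x = env_act f x.
Proof.
apply/eqP; rewrite -subr_eq0 /env_scale -env_actBl.
by rewrite env_act_ideal //; apply: qreprP.
Qed.

Lemma env_scaleA s t x : env_scale s (env_scale t x) = env_scale (s * t) x.
Proof.
by elim/qpi_ind: s => f; elim/qpi_ind: t => g; rewrite -rmorphM !env_scaleE env_actM.
Qed.

Lemma env_scale1 : left_id 1 env_scale.
Proof. by move=> x; rewrite -(rmorph1 (qpi env_proper)) env_scaleE env_act1. Qed.

Lemma env_scaleDr : right_distributive env_scale +%R.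
Proof. by move=> t x y; apply: env_actDr. Qed.

Lemma env_scaleDl x : {morph env_scale^~ x : s t / s + t}.
Proof.
move=> s t; elim/qpi_ind: s => f; elim/qpi_ind: t => g.
by rewrite -raddfD !env_scaleE env_actDl.
Qed.

HB.instance Definition _ := GRing.Zmodule_isLmodule.Build env regbimod
  env_scaleA env_scale1 env_scaleDr env_scaleDl.

Lemma tensor_scale a b (x : regbimod) :
  tensor a b *: x = (b : A) * (x : A) * (a : A).
Proof. by rewrite -[LHS]/(env_scale _ _) env_scaleE env_actU. Qed.

End EnvelopingAlgebra.

Section ProjectiveResolution.
Variable R : nzRingType.

Definition projective (P : lmodType R) : Prop :=
  forall (X Y : lmodType R) (g : {linear X -> Y}) (f : {linear P -> Y}),
    (forall y, exists x, g x = y) ->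
    exists h : {linear P -> X}, forall p, g (h p) = f p.

(* ... -> P 2 -> P 1 -> P 0 -> M -> 0 *)
Record projective_resolution (M : lmodType R) := ProjectiveResolution {
  res_mod :> nat -> lmodType R;
  res_diff : forall n, {linear res_mod n.+1 -> res_mod n};
  res_aug : {linear res_mod 0 -> M};
  res_projective : forall n, projective (res_mod n);
  res_surj : forall m, exists x, res_aug x = m;
  res_exact0 : forall x, res_aug x = 0 <-> exists y, res_diff 0 y = x;
  res_exactS : forall n x,
    res_diff n x = 0 <-> exists y, res_diff n.+1 y = x
}.

Section Kernel.
Variables (U V : lmodType R) (h : {linear U -> V}).

Definition ker_pred : {pred U} := fun x => h x == 0.

Fact ker_pred_submod : submod_closed ker_pred.
Proof.
split=> [|a x y]; rewrite !unfold_in ?raddf0 // => /eqP hx /eqP hy.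
by rewrite linearP hx hy scaler0 addr0.
Qed.
HB.instance Definition _ := GRing.isSubmodClosed.Build R U ker_pred
  ker_pred_submod.

Record ker := Ker { ker_val : U; _ : ker_val \in ker_pred }.
HB.instance Definition _ := [isSub for ker_val].
HB.instance Definition _ := [Choice of ker by <:].
HB.instance Definition _ := [SubChoice_isSubLmodule of ker by <:].

End Kernel.

Lemma free_projective (X : choiceType) : projective {malg R[X]}.
Proof.
move=> Y Z g f g_surj.
have [s gs] := choice (fun x : X => g_surj (f << x >>)).
exists (mlin s) => p; elim/malg_ind: p => [|c x p IHp]; first by rewrite !raddf0.
rewrite !linearP /= -IHp; congr (_ *: _ + _).
by rewrite mlinU gs.
Qed.

Definition free_cover (M : lmodType R) : {linear {malg R[M]} -> M} := mlin id.

Fixpoint syzygy (M : lmodType R) n : lmodType R :=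
  if n is n'.+1 then ker (free_cover (syzygy M n')) else M.

Lemma projective_resolution_exists (M : lmodType R) :
  inhabited (projective_resolution M).
Proof.
pose S := syzygy M; pose P n : lmodType R := {malg R[S n]}.
pose d n : {linear P n.+1 -> P n} :=
  (val : S n.+1 -> P n) \o free_cover (S n.+1).
have surj n (m : S n) : exists x, free_cover (S n) x = m.
  by exists << m >>; apply: mlinU.
have ex n x : free_cover (S n) x = 0 <-> exists y, d n y = x.
  split=> [x0|[y <-]]; last by apply/eqP; apply: (valP (free_cover _ y)).
  have kx : x \in ker_pred (free_cover (S n)) by apply/eqP.
  have [y ey] := surj n.+1 (Ker kx).
  by exists y; rewrite /d /= ey.
constructor; exists P d (free_cover (S 0)) => //.
- by move=> n; apply: free_projective.
- exact: surj.
move=> n x; rewrite -ex; split=> [dx|fx]; last by rewrite /d /= fx.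
by apply: val_inj.
Qed.

End ProjectiveResolution.

Section Ext.
Variables (K : fieldType) (R : algType K) (M N : lmodType R).

Definition cocycle (P : projective_resolution M) n (f : {linear P n -> N}) :
    Prop :=
  forall x, f (res_diff P n x) = 0.

Definition coboundary (P : projective_resolution M) n : (P n -> N) -> Prop :=
  match n with
  | 0 => fun f => forall x, f x = 0
  | n'.+1 => fun f =>
      exists g : {linear P n' -> N}, forall x, f x = g (res_diff P n' x)
  end.

(* The K-space Ext^n_R(M, N), computed as the n-th cohomology of Hom_R(P, N)   *)
(* for a projective resolution P of M, has dimension [m]: there are cocycles   *)
(* b_0, ..., b_(m-1) whose classes form a K-basis of cocycles modulo           *)
(* coboundaries. Here K acts on Hom_R(P n, N) through the central elements     *)
(* c%:A of R. Resolutions exist by [projective_resolution_exists].             *)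
Definition Ext_dim (n m : nat) : Prop :=
  forall P : projective_resolution M,
  exists b : 'I_m -> {linear P n -> N}, (forall i, cocycle (b i)) /\
    forall f : {linear P n -> N}, cocycle f ->
      exists! c : {ffun 'I_m -> K},
        coboundary (P := P) (n := n) (fun x => f x - \sum_i (c i)%:A *: b i x).

End Ext.

(* HH^n(A) = Ext^n(A, A) over A^op (x)_K A has dimension [m]. *)
Definition HH_dim (K : fieldType) (A : algType K) (n m : nat) : Prop :=
  @Ext_dim K (env A) (regbimod A) (regbimod A) n m.

Section BoundQuiver.

Inductive L3_arrow := Alpha | Sigma | Gamma | Beta.

Definition L3_arrow_code (a : L3_arrow) : 'I_4 :=
  match a with
  | Alpha => inord 0 | Sigma => inord 1 | Gamma => inord 2 | Beta => inord 3
  end.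
Definition L3_arrow_decode (i : 'I_4) : L3_arrow :=
  match val i with 0 => Alpha | 1 => Sigma | 2 => Gamma | _ => Beta end.
Fact L3_arrow_codeK : cancel L3_arrow_code L3_arrow_decode.
Proof. by case; rewrite /L3_arrow_decode /= inordK. Qed.
HB.instance Definition _ := Finite.copy L3_arrow (can_type L3_arrow_codeK).

(* Vertices 1 and 2 are [ord0] and [ord_max]. *)
Definition L3_source (a : L3_arrow) : 'I_2 :=
  match a with Alpha | Sigma => ord0 | Gamma | Beta => ord_max end.
Definition L3_target (a : L3_arrow) : 'I_2 :=
  match a with Alpha | Gamma => ord0 | Sigma | Beta => ord_max end.

Fact L3_vertex_nonempty : (0 < #|'I_2|)%N.
Proof. by rewrite card_ord. Qed.

Definition L3_quiver : quiver := Quiver L3_source L3_target L3_vertex_nonempty.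

Variables (K : fieldType) (lambda : K).

Local Notation KQ := (path_algebra K L3_quiver).
Local Notation α := (arr K (Alpha : arrow L3_quiver)).
Local Notation σ := (arr K (Sigma : arrow L3_quiver)).
Local Notation γ := (arr K (Gamma : arrow L3_quiver)).
Local Notation β := (arr K (Beta : arrow L3_quiver)).

Inductive L3_rel : KQ -> Prop :=
| L3_rel_alpha2 : L3_rel (α * α - σ * γ)
| L3_rel_beta2 : L3_rel (lambda *: (β * β) - γ * σ)
| L3_rel_gamma : L3_rel (γ * α - β * γ)
| L3_rel_sigma : L3_rel (α * σ - σ * β).

(* The coefficient of the trivial path at 1 is multiplicative.                 *)
Let e1 : path_category L3_quiver := trivial_path (ord0 : vertex L3_quiver).

Let aug1 : (1 : KQ)@_e1 = 1.
Proof.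
have h (x : 'I_2) : (cbase K (trivial_path (x : vertex L3_quiver) :
    path_category L3_quiver))@_e1 = (x == ord0)%:R.
  have -> : (x == ord0) = (trivial_path (x : vertex L3_quiver) == e1).
    by rewrite -[RHS]val_eqE /= xpair_eqE andbT.
  by rewrite cbaseE mcoeffU.
have -> : (1 : KQ) = \sum_(x <- enum 'I_2)
  cbase K (trivial_path (x : vertex L3_quiver) : path_category L3_quiver).
  by rewrite (catalg_oneE K (path_category L3_quiver)) big_map.
rewrite raddf_sum /=; under eq_bigr do rewrite h.
by rewrite big_enum big_ord_recl big_ord1 /= addr0.
Qed.

Let augM (f g : KQ) : (f * g)@_e1 = f@_e1 * g@_e1.
Proof.
have pE (p : qpath L3_quiver) : (cbase K (p : path_category L3_quiver))@_e1 =
    (p == e1)%:R by rewrite cbaseE mcoeffU.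
have UU (p q : qpath L3_quiver) : (cbase K (p : path_category L3_quiver) *
    cbase K (q : path_category L3_quiver))@_e1 = (p == e1)%:R * (q == e1)%:R :> K.
  rewrite cbaseM -natrM mulnb /= /obase.
  have [e|ne] := eqVneq (ptarget p) (psource q); last first.
    rewrite /concat (negPf ne) /= mcoeff0.
    case: eqP => //= pe; case: eqP => // qe.
    by rewrite pe qe eqxx in ne.
  have [r -> er] := concatP e; rewrite /= pE; congr (nat_of_bool _)%:R.
  rewrite -!val_eqE /= er; case: p q e {er} => [[x s] /= ws] [[y t] /= wt] /=.
  rewrite /ptarget /psource /parrows /= !xpair_eqE /=.
  case: s ws => [|a s] ws /= e; last by rewrite !andbF.
  by rewrite e; case: eqP; rewrite ?andbT.
have DZ c (u v : KQ) : (c *: u + v)@_e1 = c * u@_e1 + v@_e1.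
  by rewrite mcoeffD mcoeffZ.
pose mult (u v : KQ) := (u * v)@_e1 = u@_e1 * v@_e1.
have Dl c u v w : mult u w -> mult v w -> mult (c *: u + v) w.
  by move=> uw vw; rewrite /mult mulrDl -scalerAl !DZ uw vw mulrDl mulrA.
have Dr c u v w : mult w u -> mult w v -> mult w (c *: u + v).
  by move=> wu wv; rewrite /mult mulrDr -scalerAr !DZ wu wv mulrDr mulrCA.
have m0 u : mult 0 u /\ mult u 0.
  by rewrite /mult mul0r mulr0 mcoeff0 mul0r mulr0.
suff : mult f g by [].
have mU p : mult (cbase K p) g.
  elim/catalg_ind: g => [|d q h]; first exact: (m0 _).2.
  by apply: Dr; rewrite /mult UU !pE.
by elim/catalg_ind: f => [|c p h]; [exact: (m0 g).1 | apply: Dl].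
Qed.

Let aug_arr (a : arrow L3_quiver) : (arr K a)@_e1 = 0.
Proof.
by rewrite /arr cbaseE mcoeffU; case: eqP => // /(congr1 (@qpath_val _)).
Qed.

Lemma L3_rel_proper : ~ ideal_gen L3_rel 1.
Proof.
have aug0 f : ideal_gen L3_rel f -> f@_e1 = 0.
  elim=> [|u s v g rs _ IHg]; first exact: mcoeff0.
  rewrite mcoeffD IHg addr0 !augM; suff -> : s@_e1 = 0 by rewrite mulr0 mul0r.
  by case: rs; rewrite mcoeffB ?mcoeffZ !augM !aug_arr !mulr0 subr0.
by move=> /aug0/eqP; rewrite aug1 oner_eq0.
Qed.

Definition Lambda3' : algType K := quotalg L3_rel_proper.

End BoundQuiver.

(* Main.v *)
(* The algebra A has the basis e_1, a, s, aa, as, aaa, e_2, b, g, bb, bg, bbb    *)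
(* (writing a, s, g, b for alpha, sigma, gamma, beta): the relations reduce       *)
(* every path to these, the decisive point being that aas and bbg are equal to    *)
(* lambda times themselves and hence vanish. Its relations are the cyclic         *)
(* derivatives of a cubic potential, so the minimal bimodule resolution begins    *)
(*   P_3 -> P_2 -> P_1 -> P_0 -> A                                                *)
(* with generators the vertices, relations, arrows and vertices respectively.     *)
(* Exactness is witnessed by an explicit contracting homotopy of right modules    *)
(* with coefficients in Z[lambda, 1 / (lambda (1 - lambda))], checked by          *)
(* computation on basis elements. Applying Hom(-, A) gives a complex of           *)
(* dimensions 8, 12, 12, 8 whose maps have ranks 2, 6, 2, except that the middle  *)
(* rank drops to 4 in characteristic 2.                                           *)

From HB Require Import structures.
From mathcomp Require Import all_boot all_order all_algebra.
From mathcomp Require Import finmap monalg boolp ring.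
Require Import Defs.

Set Implicit Arguments.
Unset Strict Implicit.
Unset Printing Implicit Defensive.

Import GRing.Theory.
Local Open Scope ring_scope.

(** * Comparison of projective resolutions *)

(** [Ext_dim] speaks of all projective resolutions. By the comparison theorem, the cohomology
    computed from one of them determines that of every other ([Ext_dim_atP]), so one explicit
    bimodule resolution is enough.

    Two facts about it need proof. That the twelve words form a basis of A is [L3_based]: they span
    because the relations allow any basis word times a letter to be rewritten, and they are
    independent because the claimed multiplication table is a genuine right module over the path
    algebra. That the complex is exact is shown by K-linear maps s with d s + s d = lambda (1 -
    lambda) id. This identity survives K-linear combinations, so it is tested only on the finitely
    many elements b_p g_i b_q, by computation in Z[lambda] ([homotopy_exact]); on a cycle one then
    divides by lambda (1 - lambda).

    A bimodule map from A e_s (x) e_t A to A is an element of e_s A e_t. The Hom complex thus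
    becomes K^8 -> K^12 -> K^12 -> K^8 with maps [delta1], [delta2], [delta3]. The characteristic
    enters only through the factor 2 in [delta2], produced by the squares of alpha and beta in the
    relations. The dimensions are 8 - 2 = 6, then 12 - 6 - 2 = 4 and 12 - 2 - 6 = 4, the last two
    becoming 12 - 4 - 2 = 6 and 12 - 2 - 4 = 6 in characteristic 2. Each is proved by exhibiting
    cocycles together with linear forms that read off the coefficients of a class. *)

Lemma dependent_choice_from (T : nat -> Type) (I : forall n, T n -> Prop)
    (S : forall n, T n -> T n.+1 -> Prop) (x0 : T 0%N) :
    I 0%N x0 -> (forall n x, I n x -> exists y, I n.+1 y /\ S n x y) ->
  exists s : forall n, T n, s 0%N = x0 /\ forall n, S n (s n) (s n.+1).
Proof.
move=> I0 step.
pose next n (x : {x : T n | I n x}) : {y : T n.+1 | I n.+1 y} :=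
  let: exist y w := cid (step n (sval x) (svalP x)) in exist _ y w.1.
pose s := nat_rect (fun n => {x : T n | I n x}) (exist _ x0 I0) next.
exists (fun n => sval (s n)); split=> // n.
rewrite [s n.+1]/(next n (s n)) /next.
by case: (cid _) => y [].
Qed.

Section Lifting.
Variable R : nzRingType.

Section Corestriction.
Variables (U V W : lmodType R) (h : {linear V -> W}) (f : {linear U -> V}).
Hypothesis hf0 : forall u, h (f u) = 0.

Fact corestr_subproof u : f u \in ker_pred h.
Proof. by apply/eqP/hf0. Qed.

Definition corestr u : ker h := Ker (corestr_subproof u).

Fact corestr_is_linear : linear corestr.
Proof. by move=> a x y; apply: val_inj; rewrite /= linearP. Qed.

HB.instance Definition _ :=
  GRing.isLinear.Build R U (ker h) *:%R corestr corestr_is_linear.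

End Corestriction.

(** By exactness [g] maps onto the kernel of [h], and [f] takes values there; projectivity is
    applied to both maps corestricted to that kernel. *)
Lemma projective_lift (P X Y Z : lmodType R) (g : {linear X -> Y})
    (h : {linear Y -> Z}) (f : {linear P -> Y}) :
    projective P -> (forall y, h y = 0 <-> exists x, g x = y) ->
    (forall p, h (f p) = 0) ->
  exists k : {linear P -> X}, forall p, g (k p) = f p.
Proof.
move=> Pproj ex hf0; have hg0 x : h (g x) = 0 by apply/ex; exists x.
have [|k kP] := Pproj _ _ (corestr hg0) (corestr hf0).
  case=> y yK; have /ex[x gx] : h y = 0 by apply/eqP.
  by exists x; apply: val_inj.
by exists k => p; have /(congr1 val) := kP p.
Qed.

Variable M : lmodType R.
Implicit Types P Q : projective_resolution M.

Lemma res_diffK P n x : res_diff P n (res_diff P n.+1 x) = 0.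
Proof. by apply/res_exactS; exists x. Qed.

Lemma chain_lift P Q : exists phi : forall n, {linear P n -> Q n},
  (forall x, res_aug Q (phi 0%N x) = res_aug P x) /\
  (forall n x, res_diff Q n (phi n.+1 x) = phi n (res_diff P n x)).
Proof.
have [phi0 phi0P] :=
  @res_projective _ _ P 0 _ _ (res_aug Q) (res_aug P) (res_surj Q).
(* In positive degree the invariant says only that cycles go to cycles. It involves a single
   component, and it is what the next lift requires. *)
pose I n : {linear P n -> Q n} -> Prop := match n with
  | 0 => fun f => forall x, res_aug Q (f x) = res_aug P x
  | n'.+1 => fun f => forall x, res_diff P n' x = 0 -> res_diff Q n' (f x) = 0
  end.
pose S n (f : {linear P n -> Q n}) (g : {linear P n.+1 -> Q n.+1}) :=
  forall x, res_diff Q n (g x) = f (res_diff P n x).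
have [|n f If|phi [phiE phiS]] := @dependent_choice_from _ I S phi0.
- exact: phi0P.
- suff [g gP] : exists g, S n f g.
    by exists g; split=> // x dx; rewrite gP dx raddf0.
  case: n f If => [|n] f If.
    have [x|g gP] := projective_lift (f := f \o res_diff P 0)
      (@res_projective _ _ P 1) (@res_exact0 _ _ Q); last by exists g.
    by rewrite /= If; apply/res_exact0; exists x.
  have [x|g gP] := projective_lift (f := f \o res_diff P n.+1)
    (@res_projective _ _ P _) (@res_exactS _ _ Q n); last by exists g.
  by rewrite /= If // res_diffK.
by exists phi; rewrite phiE.
Qed.

Lemma chain_homotopy P Q (theta : forall n, {linear P n -> Q n}) :
    (forall x, res_aug Q (theta 0%N x) = 0) ->
    (forall n x, res_diff Q n (theta n.+1 x) = theta n (res_diff P n x)) ->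
  exists h : forall n, {linear P n -> Q n.+1},
    (forall x, theta 0%N x = res_diff Q 0 (h 0%N x)) /\
    (forall n x, theta n.+1 x =
       res_diff Q n.+1 (h n.+1 x) + h n (res_diff P n x)).
Proof.
move=> th0 thS.
have [h0 h0P] := projective_lift (@res_projective _ _ P 0%N) (@res_exact0 _ _ Q) th0.
(* Since [theta] is a chain map, this makes [theta n.+1 \- (h \o res_diff P n)] take values in
   cycles, so that it lifts through the next differential. *)
pose I n (h : {linear P n -> Q n.+1}) := forall y,
  res_diff Q n (h (res_diff P n y)) = theta n (res_diff P n y).
pose S n (h : {linear P n -> Q n.+1}) (h' : {linear P n.+1 -> Q n.+2}) :=
  forall x, theta n.+1 x = res_diff Q n.+1 (h' x) + h (res_diff P n x).
have [|n h Ih|h [hE hS]] := @dependent_choice_from _ I S h0.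
- by move=> y; apply: h0P.
- have [|h' h'P] := projective_lift (f := theta n.+1 \- (h \o res_diff P n))
    (@res_projective _ _ P n.+1) (@res_exactS _ _ Q n).
    by move=> x; rewrite /= raddfB /= thS Ih subrr.
  exists h'; split=> x; last by rewrite h'P /= subrK.
  by rewrite h'P /= res_diffK raddf0 subr0.
by exists h; split=> [x|n x]; [rewrite hE h0P | apply: hS].
Qed.

End Lifting.

(** * Independence of Ext from the resolution *)

Section ExtResolution.
Variables (K : fieldType) (R : algType K) (M N : lmodType R).
Implicit Types P Q : projective_resolution M.

Definition Ext_dim_at P n m := exists b : 'I_m -> {linear P n -> N},
  (forall i, cocycle (b i)) /\
    forall f : {linear P n -> N}, cocycle f -> exists! c : {ffun 'I_m -> K},
      coboundary (P := P) (n := n) (fun x => f x - \sum_i (c i)%:A *: b i x).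

Lemma coboundary_ext P n (f g : P n -> N) :
  f =1 g -> coboundary (P := P) (n := n) f -> coboundary (P := P) (n := n) g.
Proof.
case: n f g => [|n] f g fg /=; first by move=> f0 x; rewrite -fg.
by case=> k fk; exists k => x; rewrite -fg.
Qed.

Lemma coboundaryD P n (f g : P n -> N) :
    coboundary (P := P) (n := n) f -> coboundary (P := P) (n := n) g ->
  coboundary (P := P) (n := n) (fun x => f x + g x).
Proof.
case: n f g => [|n] f g /=; first by move=> f0 g0 x; rewrite f0 g0 addr0.
by case=> h fh [k gk]; exists (h \+ k) => x /=; rewrite fh gk.
Qed.

Lemma coboundaryZ P n (c : K) (f : P n -> N) :
    coboundary (P := P) (n := n) f ->
  coboundary (P := P) (n := n) (fun x => c%:A *: f x).
Proof.
case: n f => [|n] f /=; first by move=> f0 x; rewrite f0 scaler0.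
case=> h fh.
(* The scalar [c%:A] is central in [R], so multiplying by it preserves [R]-linearity. *)
have lin : linear (fun x => c%:A *: h x).
  move=> a x y; rewrite linearP scalerDr !scalerA.
  by rewrite -!scalerAl -scalerAr mul1r mulr1.
pose k := GRing.isLinear.Build R (P n) N *:%R (fun x => c%:A *: h x) lin.
pose kL : {linear P n -> N} := HB.pack (fun x => c%:A *: h x) k.
by exists kL => x; rewrite /kL /= fh.
Qed.

Lemma coboundary_sum P n (I : finType) (F : I -> P n -> N) :
    (forall i, coboundary (P := P) (n := n) (F i)) ->
  coboundary (P := P) (n := n) (fun x => \sum_i F i x).
Proof.
move=> cF; elim: (index_enum I) => [|i s IHs].
  apply: (@coboundary_ext _ _ (fun=> 0)) => [x|]; first by rewrite big_nil.
  by case: n {F cF} => [//|n]; exists \0 => x.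
apply: coboundary_ext (coboundaryD (cF i) IHs) => x.
by rewrite big_cons.
Qed.

Lemma coboundary_comp P Q (phi : forall n, {linear P n -> Q n}) n
    (f : Q n -> N) :
    (forall n x, res_diff Q n (phi n.+1 x) = phi n (res_diff P n x)) ->
  coboundary (P := Q) (n := n) f -> coboundary (P := P) (n := n) (f \o phi n).
Proof.
move=> phiS; case: n f => [|n] f /=; first by move=> f0 x.
by case=> g fg; exists (g \o phi n) => x /=; rewrite fg phiS.
Qed.

(** A chain endomorphism over the identity of [M] is homotopic to the identity. In the homotopy
    formula the cocycle [f] kills the summand that ends in a differential; the other summand is a
    coboundary. *)
Lemma coboundary_homotopic P (phi : forall n, {linear P n -> P n}) n
    (f : {linear P n -> N}) :
    (forall x, res_aug P (phi 0%N x) = res_aug P x) ->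
    (forall n x, res_diff P n (phi n.+1 x) = phi n (res_diff P n x)) ->
    cocycle f ->
  coboundary (P := P) (n := n) (fun x => f x - f (phi n x)).
Proof.
move=> phi0 phiS cf.
pose theta n : {linear P n -> P n} := idfun \- phi n.
have [x|k x|h [h0 hS]] := @chain_homotopy _ _ P P theta.
- by rewrite /= raddfB /= phi0 subrr.
- by rewrite /= (raddfB (res_diff P k)) /= phiS.
case: n f cf => [|n] f cf /=.
  by move=> x; rewrite -raddfB -[_ - _]/(theta 0%N x) h0; apply: cf.
exists (f \o h n) => x /=.
by rewrite -raddfB -[_ - _]/(theta n.+1 x) hS raddfD [X in X + _]cf add0r.
Qed.

(** The basis is pulled back along [phi], and a cocycle [f] on [P] receives the coefficients of
    [f \o psi n]. Both round trips are homotopic to the identity: the one on [P] gives existence,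
    the one on [Q] uniqueness. *)
Lemma Ext_dim_atP Q n m : Ext_dim_at Q n m -> Ext_dim M N n m.
Proof.
case=> b [bc bP] P.
have [phi [phi0 phiS]] := chain_lift P Q.
have [psi [psi0 psiS]] := chain_lift Q P.
pose phipsi n : {linear Q n -> Q n} := phi n \o psi n.
pose psiphi n : {linear P n -> P n} := psi n \o phi n.
exists (fun i => b i \o phi n); split=> [i x|f cf].
  by rewrite /= -phiS bc.
have [|c [cP cU]] := bP (f \o psi n); first by move=> x; rewrite /= -psiS cf.
have hP : coboundary (P := P) (n := n) (fun x => f x - f (psiphi n x)).
  apply: coboundary_homotopic => // [x|k x]; rewrite /psiphi /=.
    by rewrite psi0 phi0.
  by rewrite psiS phiS.
exists c; split=> [|c' c'P].
  apply: coboundary_ext (coboundaryD hP (coboundary_comp phiS cP)) => x.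
  by rewrite /= addrA subrK.
apply: cU.
have hQ i : coboundary (P := Q) (n := n) (fun x => b i x - b i (phipsi n x)).
  apply: coboundary_homotopic => // [x|k x]; rewrite /phipsi /=.
    by rewrite phi0 psi0.
  by rewrite phiS psiS.
(* Composition with [psi] turns [b i] into [b i \o phipsi n]; the coboundaries that are added turn
   it back into [b i]. *)
have := coboundaryD (coboundary_comp psiS c'P)
  (coboundaryZ (-1) (coboundary_sum (fun i => coboundaryZ (c' i) (hQ i)))).
apply: coboundary_ext => x /=; rewrite scaleN1r scaleNr scale1r.
under [X in _ - X]eq_bigr do rewrite scalerBr.
by rewrite sumrB opprB addrA subrK.
Qed.

End ExtResolution.

(** * Completing a partial projective resolution *)

Section PartialResolution.
Variables (R : nzRingType) (M Q0 Q1 Q2 : lmodType R).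
Variables (d1 : {linear Q2 -> Q1}) (d0 : {linear Q1 -> Q0}).
Variable aug : {linear Q0 -> M}.
Hypotheses (Q0_proj : projective Q0) (Q1_proj : projective Q1).
Hypothesis Q2_proj : projective Q2.
Hypothesis aug_surj : forall m, exists x, aug x = m.
Hypothesis exact_aug : forall x, aug x = 0 <-> exists y, d0 y = x.
Hypothesis exact_d0 : forall x, d0 x = 0 <-> exists y, d1 y = x.

(** A resolution has infinitely many terms. Beyond the three given ones, free modules on the
    iterated syzygies of [ker d1] are used; their exactness is automatic. *)
Definition extend_mod n : lmodType R := match n with
  | 0 => Q0 | 1 => Q1 | 2 => Q2
  | n'.+3 => {malg R[syzygy (ker d1) n']}
  end.

Definition syzygy_cover (M' : lmodType R) n :
    {linear {malg R[syzygy M' n.+1]} -> {malg R[syzygy M' n]}} :=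
  (val : ker (free_cover (syzygy M' n)) -> _) \o free_cover (syzygy M' n.+1).

Definition extend_diff n : {linear extend_mod n.+1 -> extend_mod n} :=
  match n with
  | 0 => d0 | 1 => d1
  | 2 => (val : ker d1 -> Q2) \o free_cover (ker d1)
  | n'.+3 => syzygy_cover (ker d1) n'
  end.

Lemma free_cover_surj (M' : lmodType R) (m : M') :
  exists x, free_cover M' x = m.
Proof. by exists << m >>; apply: mlinU. Qed.

Lemma exact_ker_cover (U V : lmodType R) (h : {linear U -> V}) x :
  h x = 0 <-> exists y, val (free_cover (ker h) y) = x.
Proof.
split=> [hx|[y <-]]; last by apply/eqP/(valP (free_cover (ker h) y)).
have kx : x \in ker_pred h by apply/eqP.
by have [y yP] := free_cover_surj (Ker kx); exists y; rewrite yP.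
Qed.

Lemma val_eq0_ker (U V : lmodType R) (h : {linear U -> V}) (u : ker h) :
  val u = 0 <-> u = 0.
Proof. by split=> [u0|->] //; apply: val_inj. Qed.

Fact extend_projective n : projective (extend_mod n).
Proof. by case: n => [|[|[|n]]] //; apply: free_projective. Qed.

Fact extend_exact n x :
  extend_diff n x = 0 <-> exists y, extend_diff n.+1 y = x.
Proof.
case: n x => [|[|[|n]]] x; first exact: exact_d0.
- exact: exact_ker_cover.
- by apply: (iff_trans (val_eq0_ker _)); apply: exact_ker_cover.
- by apply: (iff_trans (val_eq0_ker _)); apply: exact_ker_cover.
Qed.

Definition extend_resolution : projective_resolution M :=
  @ProjectiveResolution R M extend_mod extend_diff aug
    extend_projective aug_surj exact_aug extend_exact.

End PartialResolution.

(** * Formal linear combinations *)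

(* A coefficient is an integer polynomial in lambda, constant term first. *)
Definition coef := seq int.

Fixpoint coef_add (c d : coef) : coef := match c, d with
  | [::], _ => d
  | _, [::] => c
  | x :: c', y :: d' => x + y :: coef_add c' d'
  end.

Fixpoint coef_mul (c d : coef) : coef :=
  if c is x :: c' then coef_add (map ( *%R x) d) (0 :: coef_mul c' d) else [::].

Definition fsum (T : Type) := seq (coef * T).

Definition fscale T (c : coef) (l : fsum T) : fsum T :=
  [seq (coef_mul c x.1, x.2) | x <- l].

Definition fbind T U (l : fsum T) (g : T -> fsum U) : fsum U :=
  flatten [seq fscale x.1 (g x.2) | x <- l].

(** The terms sharing the key of the head are collected, and their total coefficient must vanish as
    an integer polynomial, hence for every [lambda] in every field. The number [n] is fuel; each
    round removes at least the head, so the length of the list suffices. *)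
Fixpoint fzero_rec (T : eqType) n (l : fsum T) : bool := match n, l with
  | _, [::] => true
  | 0, _ => false
  | n'.+1, (c, t) :: l' =>
      all (eq_op^~ 0)
        (foldr (fun x => coef_add x.1) c [seq x <- l' | x.2 == t]) &&
      fzero_rec n' [seq x <- l' | x.2 != t]
  end.

Definition fzero (T : eqType) (l : fsum T) := fzero_rec (size l) l.

Definition feq (T : eqType) (l l' : fsum T) := fzero (l ++ fscale [:: -1] l').

Section Evaluation.
Variables (K : fieldType) (lambda : K).

Fixpoint ceval (c : coef) : K :=
  if c is x :: c' then x%:~R + lambda * ceval c' else 0.

Lemma cevalD c d : ceval (coef_add c d) = ceval c + ceval d.
Proof.
elim: c d => [|x c IHc] [|y d] /=; rewrite ?add0r ?addr0 // IHc intrD.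
by ring.
Qed.

Lemma cevalM c d : ceval (coef_mul c d) = ceval c * ceval d.
Proof.
elim: c => [|x c IHc] /=; first by rewrite mul0r.
have xd e : ceval (map ( *%R x) e) = x%:~R * ceval e.
  by elim: e => [|y e IHe] /=; rewrite ?mulr0 // IHe intrM; ring.
by rewrite cevalD xd /= IHc; ring.
Qed.

Lemma ceval0 c : all (eq_op^~ 0) c -> ceval c = 0.
Proof. by elim: c => //= x c IHc /andP[/eqP-> /IHc->]; rewrite mulr0 addr0. Qed.

Variables (S : nzRingType) (iota : {rmorphism K -> S}).

(** For sums in the algebra [iota] is the identity of [K]; for sums in a bimodule it is [in_alg] of
    the enveloping algebra. One formal computation serves both. *)
Definition feval (V : lmodType S) T (f : T -> V) (l : fsum T) : V :=
  \sum_(x <- l) iota (ceval x.1) *: f x.2.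

Section FevalTheory.
Variables (V : lmodType S).

Lemma feval_nil T (f : T -> V) : feval f [::] = 0.
Proof. exact: big_nil. Qed.

Lemma feval_cons T (f : T -> V) c t l :
  feval f ((c, t) :: l) = iota (ceval c) *: f t + feval f l.
Proof. by rewrite /feval big_cons. Qed.

Lemma feval_cat T (f : T -> V) l l' :
  feval f (l ++ l') = feval f l + feval f l'.
Proof. exact: big_cat. Qed.

Lemma feval1 T (f : T -> V) t : feval f [:: ([:: 1], t)] = f t.
Proof.
by rewrite feval_cons feval_nil /= mulr0 !addr0 rmorph1 scale1r.
Qed.

Lemma feval_scale T (f : T -> V) c l :
  feval f (fscale c l) = iota (ceval c) *: feval f l.
Proof.
rewrite /feval big_map scaler_sumr; apply: eq_bigr => x _ /=.
by rewrite cevalM rmorphM scalerA.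
Qed.

Lemma feval_bind T U (f : U -> V) (g : T -> fsum U) l :
  feval f (fbind l g) = feval (fun t => feval f (g t)) l.
Proof.
elim: l => [|[c t] l IHl]; first by rewrite !feval_nil.
by rewrite /fbind /= feval_cat feval_scale IHl feval_cons.
Qed.

Lemma eq_in_feval (T : eqType) (f g : T -> V) l :
  (forall x, x \in l -> f x.2 = g x.2) -> feval f l = feval g l.
Proof.
by move=> fg; apply: eq_big_seq => x /fg->.
Qed.

Lemma feval_filter (T : eqType) (f : T -> V) (a : pred T) l :
  feval f l = feval f [seq x <- l | a x.2] + feval f [seq x <- l | ~~ a x.2].
Proof.
elim: l => [|[c t] l IHl]; first by rewrite !feval_nil addr0.
rewrite feval_cons IHl /=; case: (a t); rewrite /= feval_cons ?addrA //.
by congr (_ + _); rewrite addrC.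
Qed.

Lemma feval_zero (T : eqType) (f : T -> V) l : fzero l -> feval f l = 0.
Proof.
rewrite /fzero; move: (size l) => n; elim: n l => [|n IHn] [|[c t] l] //=; rewrite ?feval_nil //.
case/andP=> /ceval0 ct /IHn lt.
rewrite feval_cons (feval_filter _ (pred1 t)) lt addr0 -[RHS](scale0r (f t)).
rewrite -(rmorph0 iota) -ct; elim: l {ct lt} => [|[d u] l IHl] /=.
  by rewrite feval_nil addr0.
case: (eqVneq u t) => //= ->; rewrite feval_cons cevalD rmorphD scalerDl -IHl.
by rewrite addrCA.
Qed.

Lemma feval_eq (T : eqType) (f : T -> V) l l' :
  feq l l' -> feval f l = feval f l'.
Proof.
move=> /(feval_zero f)/eqP; rewrite feval_cat feval_scale /= mulr0 addr0.
by rewrite rmorphN1 scaleN1r subr_eq0 => /eqP.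
Qed.

End FevalTheory.

Lemma feval_linear (V W : lmodType S) (F : {linear V -> W}) T (f : T -> V) l :
  F (feval f l) = feval (fun t => F (f t)) l.
Proof.
elim: l => [|[c t] l IHl]; first by rewrite !feval_nil raddf0.
by rewrite !feval_cons linearP IHl.
Qed.

End Evaluation.

(** * The algebra *)

(* Letters 0, 1 are the trivial paths at the two vertices and letters 2, 3, 4, *)
(* 5 are the arrows alpha, sigma, gamma, beta. The basis of the algebra is     *)
(* indexed by 0, ..., 11, in the order of [basis_words].                       *)
Definition vertex_letter (x : vertex L3_quiver) : nat := nat_of_ord (x : 'I_2).

Definition arrow_letter (a : L3_arrow) : nat :=
  match a with Alpha => 2 | Sigma => 3 | Gamma => 4 | Beta => 5 end.

Definition basis_words : seq (seq nat) :=
  [:: [:: 0; 0]; [:: 0; 2]; [:: 0; 3]; [:: 2; 2]; [:: 2; 3]; [:: 2; 2; 2];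
      [:: 1; 1]; [:: 1; 5]; [:: 1; 4]; [:: 5; 5]; [:: 5; 4]; [:: 5; 5; 5]]%N.

Definition one_coef : coef := [:: 1].
Definition lambda_coef : coef := [:: 0; 1].

(** Basis word [p] times letter [l], after rewriting sigma gamma to alpha^2, gamma sigma to lambda
    beta^2, gamma alpha to beta gamma and sigma beta to alpha sigma. Absent products are zero. *)
Definition mul_letter (p l : nat) : fsum nat := match p, l with
  | 0, 0 => [:: (one_coef, 0)] | 0, 2 => [:: (one_coef, 1)]
  | 0, 3 => [:: (one_coef, 2)]
  | 1, 0 => [:: (one_coef, 1)] | 1, 2 => [:: (one_coef, 3)]
  | 1, 3 => [:: (one_coef, 4)]
  | 2, 1 => [:: (one_coef, 2)] | 2, 4 => [:: (one_coef, 3)]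
  | 2, 5 => [:: (one_coef, 4)]
  | 3, 0 => [:: (one_coef, 3)] | 3, 2 => [:: (one_coef, 5)]
  | 4, 1 => [:: (one_coef, 4)] | 4, 4 => [:: (one_coef, 5)]
  | 5, 0 => [:: (one_coef, 5)]
  | 6, 1 => [:: (one_coef, 6)] | 6, 5 => [:: (one_coef, 7)]
  | 6, 4 => [:: (one_coef, 8)]
  | 7, 1 => [:: (one_coef, 7)] | 7, 5 => [:: (one_coef, 9)]
  | 7, 4 => [:: (one_coef, 10)]
  | 8, 0 => [:: (one_coef, 8)] | 8, 2 => [:: (one_coef, 10)]
  | 8, 3 => [:: (lambda_coef, 9)]
  | 9, 1 => [:: (one_coef, 9)] | 9, 5 => [:: (one_coef, 11)]
  | 10, 0 => [:: (one_coef, 10)] | 10, 3 => [:: (lambda_coef, 11)]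
  | 11, 1 => [:: (one_coef, 11)]
  | _, _ => [::]
  end%N.

Definition mul_word (l : fsum nat) (w : seq nat) : fsum nat :=
  foldl (fun m a => fbind m (mul_letter^~ a)) l w.

Definition mul_basis (p q : nat) : fsum nat :=
  mul_word [:: (one_coef, p)] (nth [::] basis_words q).

Lemma linear_sub_eq0 (R : pzRingType) (U V : lmodType R) (h : {linear U -> V}) x y :
  h x = h y -> h (x - y) = 0.
Proof. by move=> hxy; rewrite linearB hxy subrr. Qed.

(* Linear independence of the basis: the claimed multiplication table makes    *)
(* the free module E on basis indices a right module over the path algebra, on *)
(* which the relations act as zero.                                            *)
Section RightAction.
Variables (K : fieldType) (lambda : K).

Local Notation E := {malg K[nat]}.
Local Notation KQ := (path_algebra K L3_quiver).
Local Notation fevE := (feval lambda (idfun : {rmorphism K -> K})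
  (fun p : nat => << p >> : E)).

Definition letter_op (l : nat) : {linear E -> E} :=
  mlin (fun p => fevE (mul_letter p l)).

Lemma malg_linear_ext (V : lmodType K) (f g : {linear E -> V}) :
  (forall p, f << p >> = g << p >>) -> f =1 g.
Proof.
move=> fg v; elim/malg_ind: v => [|c p v IHv]; first by rewrite !raddf0.
by rewrite !linearP fg IHv.
Qed.

Lemma letter_op_feval l m : letter_op l (fevE m) = fevE (fbind m (mul_letter^~ l)).
Proof.
rewrite feval_linear feval_bind; apply: eq_bigr => x _ /=.
by rewrite mlinU.
Qed.

Definition word_op (w : seq nat) (v : E) : E :=
  foldl (fun v l => letter_op l v) v w.

Fact word_op_is_linear w : linear (word_op w).
Proof.
elim: w => [//|l w IHw] a x y; rewrite -[LHS]/(word_op w (letter_op l _)).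
by rewrite linearP IHw.
Qed.

HB.instance Definition _ w :=
  GRing.isLinear.Build K E E *:%R (word_op w) (word_op_is_linear w).

Lemma word_op_cat w w' v : word_op (w ++ w') v = word_op w' (word_op w v).
Proof. exact: foldl_cat. Qed.

Lemma word_op_cons l w v : word_op (l :: w) v = word_op w (word_op [:: l] v).
Proof. by []. Qed.

Lemma word_op_feval m w : word_op w (fevE m) = fevE (mul_word m w).
Proof.
by elim: w m => //= l w IHw m; rewrite -IHw -letter_op_feval.
Qed.

Lemma word_op_eq (w w' : seq nat) (c d : coef) v :
    (forall p, feq (fscale c (mul_word [:: (one_coef, p)] w))
                   (fscale d (mul_word [:: (one_coef, p)] w'))) ->
  ceval lambda c *: word_op w v = ceval lambda d *: word_op w' v.
Proof.
move=> ww; apply: (malg_linear_ext (f := ceval lambda c \*: word_op w)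
  (g := ceval lambda d \*: word_op w')) => p /=.
rewrite -(feval1 lambda (idfun : {rmorphism K -> K})
  (fun p : nat => << p >> : E) p) !word_op_feval.
by have := feval_eq lambda (idfun : {rmorphism K -> K})
  (fun p : nat => << p >> : E) (ww p); rewrite !feval_scale.
Qed.

Lemma word_op_eq1 (w w' : seq nat) v :
    (forall p, feq (mul_word [:: (one_coef, p)] w)
                   (mul_word [:: (one_coef, p)] w')) ->
  word_op w v = word_op w' v.
Proof.
move=> ww; apply: (malg_linear_ext (f := word_op w) (g := word_op w')) => p /=.
rewrite -(feval1 lambda (idfun : {rmorphism K -> K})
  (fun p : nat => << p >> : E) p) !word_op_feval.
exact: feval_eq (ww p).
Qed.

Lemma word_op_eq0 w v :
  (forall p, fzero (mul_word [:: (one_coef, p)] w)) -> word_op w v = 0.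
Proof.
move=> ww; apply: (malg_linear_ext (f := word_op w) (g := \0)) => p /=.
rewrite -(feval1 lambda (idfun : {rmorphism K -> K})
  (fun p : nat => << p >> : E) p) word_op_feval.
exact: feval_zero (ww p).
Qed.

Definition path_word (p : qpath L3_quiver) : seq nat :=
  vertex_letter (psource p) :: map arrow_letter (parrows p).

(** Only indices below 12 name basis elements. From 12 on, the default branch of [mul_letter] yields
    the empty sum, and this computes while the index is still a variable. *)
Ltac check_table := let p := fresh in
  move=> p; do 12 (destruct p as [|p]; first by vm_compute); by vm_compute.

Lemma word_op_vertex2 (x y : vertex L3_quiver) v :
  word_op [:: vertex_letter x; vertex_letter y] v =
  if x == y then word_op [:: vertex_letter x] v else 0.
Proof.
case: eqP => [<-|].
  by case: x => -[|[|//]] i; apply: word_op_eq1; check_table.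
case: x y => -[|[|//]] i [[|[|//]] j] // ne; try by case: ne; apply: val_inj.
all: by apply: word_op_eq0; check_table.
Qed.

Lemma word_op_arrow_vertex (a : arrow L3_quiver) (y : vertex L3_quiver) v :
  word_op [:: arrow_letter a; vertex_letter y] v =
  if target a == y then word_op [:: arrow_letter a] v else 0.
Proof.
case: eqP => [<-|].
  by case: a; apply: word_op_eq1; check_table.
case: a y => -[[|[|//]] j] // ne; try by case: ne; apply: val_inj.
all: by apply: word_op_eq0; check_table.
Qed.

Lemma word_op_vertex_arrow (a : arrow L3_quiver) v :
  word_op [:: vertex_letter (source a); arrow_letter a] v =
  word_op [:: arrow_letter a] v.
Proof. by case: a; apply: word_op_eq1; check_table. Qed.

Lemma word_op_path_vertex p (y : vertex L3_quiver) v :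
  word_op [:: vertex_letter y] (word_op (path_word p) v) =
  if ptarget p == y then word_op (path_word p) v else 0.
Proof.
rewrite /path_word /ptarget -word_op_cat.
case/lastP: (parrows p) => [|s a].
  exact: word_op_vertex2.
rewrite !map_rcons last_rcons -cats1 -cat_cons -catA word_op_cat.
by rewrite [word_op (_ ++ _) _ in LHS]word_op_arrow_vertex word_op_cat.
Qed.

Lemma path_algebra_ind (P : KQ -> Prop) :
    P 0 -> (forall c (p : path_category L3_quiver) (f : KQ), P f ->
      P (c *: (cbase K p : KQ) + f)) -> forall f, P f.
Proof. exact: catalg_ind. Qed.

Definition path_act (v : E) : {linear KQ -> E} :=
  mlin (fun p : path_category L3_quiver => word_op (path_word p) v).

Lemma path_actU v (p : path_category L3_quiver) :
  path_act v (cbase K p : KQ) = word_op (path_word p) v.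
Proof. by rewrite cbaseE; apply: mlinU. Qed.

Lemma path_actP c v w f : path_act (c *: v + w) f = c *: path_act v f + path_act w f.
Proof.
elim/path_algebra_ind: f => [|d p f IHf]; first by rewrite !raddf0 addr0.
rewrite !linearP IHf /= !path_actU linearP !scalerDr !scalerA mulrC.
by rewrite addrACA.
Qed.

Lemma path_act0l f : path_act 0 f = 0.
Proof.
have := path_actP (-1) 0 0 f; rewrite scaler0 addr0 => ->.
by rewrite scaleN1r addNr.
Qed.

Let mulPl c (u f g : KQ) : (c *: u + f) * g = c *: (u * g) + f * g.
Proof. exact: catalg_mull. Qed.

Let mulPr c (u f g : KQ) : g * (c *: u + f) = c *: (g * u) + g * f.
Proof. exact: catalg_mulr. Qed.

Let actP v c (f g : KQ) :
  path_act v (c *: f + g) = c *: path_act v f + path_act v g.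
Proof. exact: linearP. Qed.

Let act0 v : path_act v 0 = 0.
Proof. exact: raddf0. Qed.

Let scale_addE c (u u' w w' : E) :
  u = u' -> w = w' -> c *: u + w = c *: u' + w'.
Proof. by move=> -> ->. Qed.

Lemma path_actM v f g : path_act v (f * g) = path_act (path_act v f) g.
Proof.
elim/path_algebra_ind: f => [|c p f IHf].
  by rewrite mul0r act0 path_act0l.
apply: etrans (congr1 (path_act v) (mulPl c (cbase K p) f g)) _.
apply: etrans (actP v c (cbase K p * g) (f * g)) _.
apply: etrans _ (esym (congr1 (path_act^~ g) (actP v c (cbase K p) f))).
apply: etrans _ (esym (path_actP c _ _ g)).
apply: scale_addE; last exact: IHf.
apply: etrans _ (esym (congr1 (path_act^~ g) (path_actU v p))).
elim/path_algebra_ind: g {IHf f} => [|d q g IHg]; first by rewrite mulr0 !act0.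
apply: etrans (congr1 (path_act v) (mulPr d (cbase K q) g (cbase K p))) _.
apply: etrans (actP v d (cbase K p * cbase K q) (cbase K p * g)) _.
apply: etrans _ (esym (actP _ d (cbase K q) g)).
apply: scale_addE; last exact: IHg.
apply: etrans (congr1 _ (cbaseM K p q)) (etrans _ (esym (path_actU _ _))).
(* The leading vertex letter of [path_word q] acts as the identity or as zero according to whether
   the endpoints match, which mirrors the partiality of [concat]. *)
have vq : word_op (path_word q) (word_op (path_word p) v) =
    word_op (map arrow_letter (parrows q))
      (if ptarget p == psource q then word_op (path_word p) v else 0).
  apply: etrans (word_op_cons _ _ _) _.
  exact (congr1 (word_op (map arrow_letter (parrows q)))
    (word_op_path_vertex p (psource q) v)).
rewrite vq; case: eqP => [e|ne]; last first.
  by rewrite /= /concat (introF eqP ne) /= act0 raddf0.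
have [r er1 er2] := concatP e; rewrite [comp _ _]er1 path_actU /path_word.
rewrite {1}/psource {1}/parrows er2 map_cat.
exact (word_op_cat (path_word p) _ v).
Qed.

Lemma path_act_arr v (a : arrow L3_quiver) :
  path_act v (arr K a) = word_op [:: arrow_letter a] v.
Proof. by rewrite path_actU -word_op_vertex_arrow. Qed.

Let act2 v (a b : arrow L3_quiver) :
  path_act v (arr K a * arr K b) = word_op [:: arrow_letter a; arrow_letter b] v.
Proof.
apply: etrans (path_actM v (arr K a) (arr K b)) _.
apply: etrans (path_act_arr _ b) _.
exact (congr1 (word_op [:: arrow_letter b]) (path_act_arr v a)).
Qed.

Lemma path_act_rel v f : L3_rel lambda f -> path_act v f = 0.
Proof.
case; apply: linear_sub_eq0.
- apply: etrans (act2 _ _ _) (etrans _ (esym (act2 _ _ _))).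
  by apply: word_op_eq1; check_table.
- apply: etrans (linearZ_LR (path_act v) lambda _) _.
  apply: etrans (congr1 ( *:%R lambda) (act2 _ _ _)) (etrans _ (esym (act2 _ _ _))).
  have := @word_op_eq [:: 5; 5]%N [:: 4; 3]%N [:: 0; 1] [:: 1] v.
  by rewrite /= !mulr0 !addr0 mulr1 add0r scale1r; apply; check_table.
- apply: etrans (act2 _ _ _) (etrans _ (esym (act2 _ _ _))).
  by apply: word_op_eq1; check_table.
- apply: etrans (act2 _ _ _) (etrans _ (esym (act2 _ _ _))).
  by apply: word_op_eq1; check_table.
Qed.

Lemma path_act_ideal v f : ideal_gen (L3_rel lambda) f -> path_act v f = 0.
Proof.
elim=> [|a s b x rs _ IHx]; first exact: act0.
apply: etrans (raddfD (path_act v) (a * s * b) x) _.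
apply: etrans (congr1 (fun y : E => _ + y) IHx) (etrans (addr0 _) _).
apply: etrans (path_actM v (a * s) b) _.
apply: etrans (congr1 (path_act^~ b) (etrans (path_actM v a s) _)) _.
  exact: path_act_rel rs.
exact: path_act0l.
Qed.

End RightAction.

Definition letter_source (l : nat) : nat := nth 0%N [:: 0; 1; 0; 0; 1; 1]%N l.
Definition letter_target (l : nat) : nat := nth 0%N [:: 0; 1; 0; 1; 0; 1]%N l.
Definition basis_source (p : nat) : nat := (if p < 6 then 0 else 1)%N.
Definition basis_target (p : nat) : nat :=
  nth 0%N [:: 0; 0; 1; 0; 1; 0; 1; 1; 0; 1; 0; 1]%N p.

Lemma basis_target_lt2 p : (basis_target p < 2)%N.
Proof. by do 12 (case: p => [//|p]); case: p. Qed.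

Lemma letter_source_lt2 l : (letter_source l < 2)%N.
Proof. by do 6 (case: l => [//|l]); case: l. Qed.

Lemma mul_letter_lt p l : all (fun y => y.2 < 12)%N (mul_letter p l).
Proof.
do 12 (case: p => [|p]; first by do 6 (case: l => [//|l])).
by [].
Qed.

(** * The multiplication table as a consequence of the relations *)

Section MultiplicationTable.
Variables (K : fieldType) (lambda : K) (B : algType K) (x : nat -> B).
Local Notation e1 := (x 0%N).
Local Notation e2 := (x 1%N).
Local Notation al := (x 2%N).
Local Notation si := (x 3%N).
Local Notation ga := (x 4%N).
Local Notation be := (x 5%N).
Hypotheses (lambda_neq0 : lambda != 0) (lambda_neq1 : lambda != 1).
Hypothesis x_idem : forall u v, (u < 2)%N -> (v < 2)%N ->
  x u * x v = if u == v then x u else 0.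
Hypothesis x_source : forall l, (l < 6)%N -> x (letter_source l) * x l = x l.
Hypothesis x_target : forall l, (l < 6)%N -> x l * x (letter_target l) = x l.
Hypotheses (rel_alpha : al * al = si * ga)
  (rel_beta : lambda *: (be * be) = ga * si)
  (rel_gamma : ga * al = be * ga) (rel_sigma : al * si = si * be).

Definition word_prod (w : seq nat) : B := \prod_(l <- w) x l.
Definition basis_elt (p : nat) : B := word_prod (nth [::] basis_words p).

Local Notation fevB :=
  (feval lambda (idfun : {rmorphism K -> K}) basis_elt).

Let lambda_fix (y : B) : y = lambda *: y -> y = 0.
Proof.
move=> ey; apply/eqP; have : (1 - lambda) *: y == 0.
  by rewrite scalerBl scale1r -ey subrr.
by rewrite scaler_eq0 subr_eq0 eq_sym (negPf lambda_neq1).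
Qed.

Let scaled_rel_beta (y z : B) : y * ga * si * z = lambda *: (y * be * be * z).
Proof.
by rewrite -[y * ga * si]mulrA -rel_beta -scalerAr -scalerAl mulrA.
Qed.

(* The two ways of rewriting the overlaps alpha alpha sigma and beta beta      *)
(* gamma differ by the factor lambda, so these paths vanish.                   *)
Lemma alpha2_sigma : al * al * si = 0.
Proof.
apply: lambda_fix; rewrite {1}rel_alpha; have := scaled_rel_beta (si) 1.
by rewrite !mulr1 => ->; rewrite -rel_sigma -!mulrA -rel_sigma.
Qed.

Lemma beta2_gamma : be * be * ga = 0.
Proof.
apply: lambda_fix; have := scaled_rel_beta 1 (ga); rewrite !mul1r => <-.
by rewrite -[RHS]mulrA -rel_alpha mulrA rel_gamma -!mulrA rel_gamma.
Qed.

Lemma basis_eltE : (basis_elt 0%N = e1) * (basis_elt 1%N = al) *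
  (basis_elt 2%N = si) * (basis_elt 3%N = al * al) *
  (basis_elt 4%N = al * si) * (basis_elt 5%N = al * al * al) *
  (basis_elt 6%N = e2) * (basis_elt 7%N = be) * (basis_elt 8%N = ga) *
  (basis_elt 9%N = be * be) * (basis_elt 10%N = be * ga) *
  (basis_elt 11%N = be * be * be).
Proof.
have s0 l : (l < 6)%N -> letter_source l = 0%N -> e1 * x l = x l.
  by move=> l6 e; rewrite -[in e1]e x_source.
have s1 l : (l < 6)%N -> letter_source l = 1%N -> e2 * x l = x l.
  by move=> l6 e; rewrite -[in e2]e x_source.
rewrite /basis_elt /word_prod /= !big_cons !big_nil !mulr1.
by do !split; rewrite ?s0 ?s1 ?mulrA.
Qed.

Lemma basis_elt_target p : (p < 12)%N ->
  basis_elt p * x (basis_target p) = basis_elt p.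
Proof.
have t l : (l < 6)%N -> x l * x (letter_target l) = x l by exact: x_target.
do 12 (case: p => [_|p] //; first by
  rewrite basis_eltE -?mulrA; first [exact: (t 0%N) | exact: (t 1%N) | congr (_ * _)
  | idtac]; rewrite ?(t 2%N) ?(t 3%N) ?(t 4%N) ?(t 5%N)).
Qed.

Let lambdaE : ceval lambda lambda_coef = lambda.
Proof. by rewrite /= mulr0 addr0 add0r mulr1. Qed.

Lemma letter_mismatch p l : (p < 12)%N -> (l < 6)%N ->
  basis_target p != letter_source l -> basis_elt p * x l = 0.
Proof.
move=> p12 l6 ne; rewrite -(basis_elt_target p12) -(x_source l6) mulrA.
rewrite -[_ * x (letter_source l)]mulrA x_idem ?(negPf ne) ?mulr0 ?mul0r //.
  exact: basis_target_lt2.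
exact: letter_source_lt2.
Qed.

Lemma mul_letterP p l : (p < 12)%N -> (l < 6)%N ->
  basis_elt p * x l = fevB (mul_letter p l).
Proof.
move=> p12 l6; have [e|ne] := eqVneq (basis_target p) (letter_source l); last first.
  rewrite letter_mismatch //; move: p12 l6 ne.
  do 12 (case: p => [_|p]; first by do 6 (case: l => [_|l] //=; rewrite ?feval_nil //)).
  by [].
have [v|nv] := boolP (l < 2)%N.
  have -> : l = basis_target p by rewrite e; case: l v {l6 e} => [|[|]].
  rewrite basis_elt_target //; move: p12.
  by clear e; do 12 (case: p => [_|p]; first by rewrite feval1).
case: l l6 nv e => [|[|[|[|[|[|//]]]]]] // _ _.
all: move: p12; do 12 try (case: p => [_ //= _|p]); rewrite //.
all: rewrite ?feval1 ?feval_cons ?feval_nil ?basis_eltE ?lambdaE ?addr0 //.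
- exact: (x_source (l := 2%N)).
- by rewrite -mulrA [X in _ * X]rel_alpha mulrA alpha2_sigma mul0r.
- by rewrite -mulrA rel_gamma mulrA beta2_gamma.
- exact: (x_source (l := 3%N)).
- exact: alpha2_sigma.
- by rewrite -!mulrA [X in al * X]mulrA alpha2_sigma mulr0.
- by rewrite /= -mulrA -rel_beta -scalerAr mulrA.
- by rewrite -mulrA -rel_alpha mulrA.
- exact: (x_source (l := 4%N)).
- exact: beta2_gamma.
- by rewrite -!mulrA [X in be * X]mulrA beta2_gamma mulr0.
- by rewrite -mulrA -rel_sigma mulrA alpha2_sigma.
- exact: (x_source (l := 5%N)).
(* The case beta^4 = 0: lambda beta^4 = beta^2 gamma sigma and beta^2 gamma = 0, so lambda has to be
   cancelled. *)
apply/(scalerI lambda_neq0); rewrite scaler0 -mulrA scalerAr rel_beta mulrA.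
by rewrite beta2_gamma mul0r.
Qed.

End MultiplicationTable.

Section BasisProducts.
Variables (K : fieldType) (lambda : K) (B : algType K) (x : nat -> B).
Local Notation basis_elt := (basis_elt x).
Local Notation word_prod := (word_prod x).
Local Notation fevB :=
  (feval lambda (idfun : {rmorphism K -> K}) basis_elt).
Hypothesis mul_letter_elt : forall p l, (p < 12)%N -> (l < 6)%N ->
  basis_elt p * x l = fevB (mul_letter p l).

Lemma word_prod_lt w : all (gtn 6) w -> forall m, all (fun y => y.2 < 12)%N m ->
  fevB m * word_prod w = fevB (mul_word m w).
Proof.
elim: w => [_ m _|l w IHw /andP[l6 w6] m m12].
  by rewrite /word_prod big_nil mulr1.
rewrite /word_prod big_cons mulrA -/(word_prod w) /=.
have -> : fevB m * x l = fevB (fbind m (mul_letter^~ l)).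
  rewrite feval_bind /feval mulr_suml; apply: eq_big_seq => y ym /=.
  by rewrite -scalerAl mul_letter_elt // (allP m12).
apply: IHw => //; apply/allP => _ /flattenP[_ /mapP[y _ ->]] /mapP[z zy ->] /=.
exact: (allP (mul_letter_lt y.2 l)).
Qed.

Lemma mul_basisP p q : (p < 12)%N -> (q < 12)%N ->
  basis_elt p * basis_elt q = fevB (mul_basis p q).
Proof.
move=> p12 q12.
have q6 : all (gtn 6) (nth [::] basis_words q).
  by apply: (allP (_ : all (all (gtn 6)) basis_words)) (mem_nth _ _).
have := word_prod_lt q6 (m := [:: (one_coef, p)]).
by rewrite feval1; apply; rewrite /= p12.
Qed.

End BasisProducts.

(** All that the resolution and its cohomology use of the algebra. The coordinate forms [c] express
    independence and keep the quotient construction out of later computations. *)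
Record based_algebra (K : fieldType) (lambda : K) (A : algType K)
    (b : nat -> A) (c : nat -> {linear A -> K^o}) : Prop := BasedAlgebra {
  basis_mul : forall p q, (p < 12)%N -> (q < 12)%N ->
    b p * b q = feval lambda (idfun : {rmorphism K -> K}) b (mul_basis p q);
  basis_one : 1 = b 0%N + b 6%N;
  basis_coord : forall p q, (p < 12)%N -> (q < 12)%N -> c p (b q) = (p == q)%:R;
  basis_span : forall a, a = \sum_(p < 12) c p a *: b p
}.

(** * The twelve words are a basis of the bound quiver algebra *)

Section Lambda3Basis.
Variables (K : fieldType) (lambda : K).
Hypotheses (lambda_neq0 : lambda != 0) (lambda_neq1 : lambda != 1).

Local Notation KQ := (path_algebra K L3_quiver).
Local Notation A := (Lambda3' lambda).
Local Notation E := {malg K[nat]}.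

Definition L3_pi : {lrmorphism KQ -> A} := qpi (@L3_rel_proper K lambda).

Definition L3_letter_path (l : nat) : KQ := match l with
  | 0 => cbase K (trivial_path (ord0 : vertex L3_quiver) : path_category L3_quiver)
  | 1 => cbase K (trivial_path (ord_max : vertex L3_quiver) : path_category L3_quiver)
  | 2 => arr K (Alpha : arrow L3_quiver)
  | 3 => arr K (Sigma : arrow L3_quiver)
  | 4 => arr K (Gamma : arrow L3_quiver)
  | _ => arr K (Beta : arrow L3_quiver)
  end.

Definition L3_letter (l : nat) : A := L3_pi (L3_letter_path l).

Lemma L3_piM f g : L3_pi f * L3_pi g = L3_pi (f * g).
Proof. by rewrite rmorphM. Qed.

Lemma L3_rel_eq f g : L3_rel lambda (f - g) -> L3_pi f = L3_pi g.
Proof.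
move=> fg; apply/qpiP.
rewrite -[f - g]mulr1 -[f - g]mul1r -[_ * 1]addr0.
exact: ideal_genD fg (ideal_gen0 _).
Qed.

Lemma trivial_pathM (x y : vertex L3_quiver) :
  (cbase K (trivial_path x : path_category L3_quiver) : KQ) *
    cbase K (trivial_path y : path_category L3_quiver) =
  if x == y then cbase K (trivial_path x : path_category L3_quiver) else 0.
Proof.
rewrite cbaseM [comp _ _]concat_trivl /=.
by have [->|] := eqVneq x y.
Qed.

Lemma trivial_path_arr (a : arrow L3_quiver) :
  (cbase K (trivial_path (source a) : path_category L3_quiver) : KQ) * arr K a =
  arr K a.
Proof. by rewrite cbaseM [comp _ _]concat_trivl /= eqxx. Qed.

Lemma arr_trivial_path (a : arrow L3_quiver) :
  arr K a * (cbase K (trivial_path (target a) : path_category L3_quiver) : KQ) =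
  arr K a.
Proof. by rewrite cbaseM [comp _ _]concat_trivr /= eqxx. Qed.

Local Notation b := (basis_elt L3_letter).

Lemma L3_idem u v : (u < 2)%N -> (v < 2)%N ->
  L3_letter u * L3_letter v = if u == v then L3_letter u else 0.
Proof.
rewrite L3_piM; case: u v => [|[|//]] [|[|//]] _ _; rewrite trivial_pathM //.
all: exact: raddf0.
Qed.

Lemma L3_source l : (l < 6)%N ->
  L3_letter (letter_source l) * L3_letter l = L3_letter l.
Proof.
rewrite L3_piM /L3_letter; do 2 (case: l => [|l]; first by rewrite trivial_pathM).
case: l => [|[|[|[|//]]]] _.
- exact: (congr1 L3_pi (trivial_path_arr Alpha)).
- exact: (congr1 L3_pi (trivial_path_arr Sigma)).
- exact: (congr1 L3_pi (trivial_path_arr Gamma)).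
- exact: (congr1 L3_pi (trivial_path_arr Beta)).
Qed.

Lemma L3_target l : (l < 6)%N ->
  L3_letter l * L3_letter (letter_target l) = L3_letter l.
Proof.
rewrite L3_piM /L3_letter; do 2 (case: l => [|l]; first by rewrite trivial_pathM).
case: l => [|[|[|[|//]]]] _.
- exact: (congr1 L3_pi (arr_trivial_path Alpha)).
- exact: (congr1 L3_pi (arr_trivial_path Sigma)).
- exact: (congr1 L3_pi (arr_trivial_path Gamma)).
- exact: (congr1 L3_pi (arr_trivial_path Beta)).
Qed.

Lemma L3_mul_letter p l : (p < 12)%N -> (l < 6)%N ->
  b p * L3_letter l =
  feval lambda (idfun : {rmorphism K -> K}) b (mul_letter p l).
Proof.
apply: mul_letterP => //.
- exact: L3_idem.
- exact: L3_source.
- exact: L3_target.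
- by rewrite !L3_piM; apply: L3_rel_eq; constructor.
- by rewrite !L3_piM -linearZ_LR; apply: L3_rel_eq; constructor.
- by rewrite !L3_piM; apply: L3_rel_eq; constructor.
- by rewrite !L3_piM; apply: L3_rel_eq; constructor.
Qed.

Lemma L3_mul_basis p q : (p < 12)%N -> (q < 12)%N ->
  b p * b q = feval lambda (idfun : {rmorphism K -> K}) b (mul_basis p q).
Proof. exact: (mul_basisP L3_mul_letter). Qed.

Lemma path_act_letter v l : (l < 6)%N ->
  path_act lambda v (L3_letter_path l) = word_op lambda [:: l] v.
Proof.
case: l => [|[|[|[|[|[|//]]]]]] _; first exact: path_actU.
- exact: path_actU.
- exact: (path_act_arr lambda v (Alpha : arrow L3_quiver)).
- exact: (path_act_arr lambda v (Sigma : arrow L3_quiver)).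
- exact: (path_act_arr lambda v (Gamma : arrow L3_quiver)).
- exact: (path_act_arr lambda v (Beta : arrow L3_quiver)).
Qed.

Lemma path_act_word v l w : all (gtn 6) (l :: w) -> exists f : KQ,
  L3_pi f = word_prod L3_letter (l :: w) /\ path_act lambda v f = word_op lambda (l :: w) v.
Proof.
elim/last_ind: w => [/andP[l6 _]|w m IHw].
  by exists (L3_letter_path l); rewrite /word_prod big_seq1 path_act_letter.
rewrite -rcons_cons all_rcons => /andP[m6 /IHw[f [ef vf]]].
exists (f * L3_letter_path m); split.
  by rewrite -L3_piM ef /word_prod -cats1 big_cat big_seq1.
apply: etrans (path_actM lambda v f (L3_letter_path m)) _.
apply: etrans (path_act_letter _ m6) _.
by rewrite vf -cats1 word_op_cat.
Qed.

(* Acting on the sum of the basis vectors that stand for the two trivial paths *)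
(* recovers an element from its action.                                        *)
Definition unit_vector : E := << 0%N >> + << 6%N >>.

Definition L3_act (u : A) : E := path_act lambda unit_vector (qrepr u).

Lemma L3_act_pi f : L3_act (L3_pi f) = path_act lambda unit_vector f.
Proof.
apply/eqP; rewrite -subr_eq0; apply/eqP.
apply: etrans (esym (linearB (path_act lambda unit_vector) _ _)) _.
by apply: path_act_ideal; apply: qreprP.
Qed.

Lemma L3_act_is_linear : linear L3_act.
Proof.
move=> k; elim/qpi_ind=> f; elim/qpi_ind=> g.
have -> : k *: qpi (@L3_rel_proper K lambda) f + qpi (@L3_rel_proper K lambda) g =
  L3_pi (k *: f + g) by rewrite linearP.
apply: etrans (L3_act_pi _) (etrans (linearP _ _ _ _) _).
by rewrite !L3_act_pi.
Qed.

Lemma L3_act_basis q : (q < 12)%N -> L3_act (b q) = << q >>.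
Proof.
move=> q12.
have : all (fun w => if w is l :: w' then all (gtn 6) w else false) basis_words by [].
have qm : nth [::] basis_words q \in basis_words by apply: mem_nth.
move=> /allP/(_ _ qm); rewrite /basis_elt.
case e: (nth _ _ _) => [//|l w] /(path_act_word unit_vector)[f [<- vf]].
rewrite L3_act_pi vf -e {f vf e l w qm}.
have -> : unit_vector = feval lambda (idfun : {rmorphism K -> K})
    (fun p : nat => << p >> : E) [:: (one_coef, 0%N); (one_coef, 6%N)].
  by rewrite feval_cons feval1 /= mulr0 addr0 scale1r.
rewrite word_op_feval.
rewrite -[RHS](feval1 lambda (idfun : {rmorphism K -> K}) (fun p : nat => << p >> : E)).
by apply: feval_eq; do 12 (case: q q12 => [_|q q12]; first by vm_compute).
Qed.

Definition L3_coord (p : nat) (u : A) : K^o := (L3_act u)@_p.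

Lemma L3_coord_is_linear p : linear (L3_coord p).
Proof.
by move=> k u w; rewrite /L3_coord L3_act_is_linear mcoeffD mcoeffZ.
Qed.

HB.instance Definition _ p :=
  GRing.isLinear.Build K A K^o *:%R (L3_coord p) (L3_coord_is_linear p).

Lemma L3_coord_basis p q : (q < 12)%N -> L3_coord p (b q) = (p == q)%:R.
Proof. by move=> q12; rewrite /L3_coord L3_act_basis // mcoeffU eq_sym. Qed.

Definition L3_expand (u : A) : A := \sum_(p < 12) L3_coord p u *: b p.

Lemma L3_expand_is_linear : linear L3_expand.
Proof.
move=> k u w; rewrite /L3_expand scaler_sumr -big_split; apply: eq_bigr => p _ /=.
by rewrite linearP scalerDl scalerA.
Qed.

HB.instance Definition _ :=
  GRing.isLinear.Build K A A *:%R L3_expand L3_expand_is_linear.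

Lemma L3_expand_basis q : (q < 12)%N -> L3_expand (b q) = b q.
Proof.
move=> q12; rewrite /L3_expand (bigD1 (Ordinal q12)) //= L3_coord_basis //.
rewrite eqxx scale1r big1 ?addr0 // => p pq; rewrite L3_coord_basis //.
by have := pq; rewrite -val_eqE /= => /negPf->; rewrite scale0r.
Qed.

Lemma L3_expand_letter u l : (l < 6)%N ->
  L3_expand u = u -> L3_expand (u * L3_letter l) = u * L3_letter l.
Proof.
move=> l6 <-; rewrite mulr_suml raddf_sum; apply: eq_bigr => p _ /=.
rewrite -scalerAl linearZ_LR; congr (_ *: _).
rewrite L3_mul_letter // feval_linear; apply: eq_in_feval => y yl.
by rewrite /= L3_expand_basis // (allP (mul_letter_lt p l)).
Qed.

(** Spanning, by appending one arrow at a time: the trivial paths are basis elements, and the fixed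
    points of [L3_expand] are stable under right multiplication by letters. *)
Lemma L3_expand_path (p : path_category L3_quiver) :
  L3_expand (L3_pi (cbase K p)) = L3_pi (cbase K p).
Proof.
case: p => -[x s] w.
elim/last_ind: s w => [|s a IHs] w.
  have -> : QPath w = trivial_path x by apply: val_inj.
  case: x {w} => -[|[|//]] i.
  - have -> : Ordinal i = ord0 by apply: val_inj.
    have := L3_expand_basis (q := 0) isT.
    by rewrite /basis_elt /word_prod /= !big_cons big_nil mulr1 L3_idem.
  - have -> : Ordinal i = ord_max by apply: val_inj.
    have := L3_expand_basis (q := 6) isT.
    by rewrite /basis_elt /word_prod /= !big_cons big_nil mulr1 L3_idem.
have /andP[ws /andP[/eqP wa _]] : walk x s &&
    walk (last x (map (@target L3_quiver) s)) [:: a] by rewrite -walk_cat cats1.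
have -> : L3_pi (cbase K (QPath w : path_category L3_quiver)) =
    L3_pi (cbase K (@QPath L3_quiver (x, s) ws : path_category L3_quiver)) *
    L3_letter (arrow_letter a).
  have -> : L3_letter (arrow_letter a) = L3_pi (arr K a) by case: (a).
  rewrite L3_piM cbaseM; congr (L3_pi _).
  have [|r er1 er2] := @concatP _ (@QPath L3_quiver (x, s) ws) (arrow_path a).
    exact: esym wa.
  rewrite [comp _ _]er1 /=; congr cbase; apply: val_inj.
  by apply: etrans _ (esym er2); rewrite /= -cats1.
by apply: L3_expand_letter; [case: (a) | apply: IHs].
Qed.

Lemma L3_based : based_algebra lambda b L3_coord.
Proof.
split.
- exact: L3_mul_basis.
- rewrite -(rmorph1 L3_pi) (catalg_oneE K (path_category L3_quiver)) big_map big_enum.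
  rewrite big_ord_recl big_ord1 raddfD.
  rewrite /basis_elt /word_prod /= !big_cons !big_nil !mulr1 !L3_idem //.
  congr (_ + L3_pi (cbase K (trivial_path (_ : vertex L3_quiver)
    : path_category L3_quiver))).
  exact: val_inj.
- by move=> p q _; apply: L3_coord_basis.
elim/qpi_ind=> f; elim/path_algebra_ind: f => [|k p f IHf].
  by rewrite raddf0 -/(L3_expand _) raddf0.
have -> : qpi (@L3_rel_proper K lambda) (k *: (cbase K p : KQ) + f) =
  k *: L3_pi (cbase K p) + L3_pi f by exact: linearP.
apply: esym; apply: etrans (linearP L3_expand k _ _) _.
exact: (congr2 (fun y z : A => k *: y + z) (L3_expand_path p) (esym IHf)).
Qed.

End Lambda3Basis.

(** * Bimodules *)

Section AlgebraLinearity.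
Variables (K : fieldType) (B : algType K) (V : lmodType K) (h : {linear B -> V}).

Lemma linear_mul_lin k (u x s v : B) :
  h ((k *: u + x) * s * v) = k *: h (u * s * v) + h (x * s * v).
Proof. by rewrite !mulrDl -!scalerAl linearP. Qed.

Lemma linear_mul_rin k (u x s v : B) :
  h (v * s * (k *: u + x)) = k *: h (v * s * u) + h (v * s * x).
Proof. by rewrite !mulrDr -!scalerAr linearP. Qed.

Lemma linear_mul_midB (u s s' v : B) :
  h (u * s * v) = h (u * s' * v) -> h (u * (s - s') * v) = 0.
Proof. by move=> e; rewrite mulrBr mulrBl linearB e subrr. Qed.

Lemma linear_mul_midD (u s s' v : B) :
  h (u * (s + s') * v) = h (u * s * v) + h (u * s' * v).
Proof. by rewrite mulrDr mulrDl linearD. Qed.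

Lemma linear_mul_midZ k (u s v : B) : h (u * (k *: s) * v) = k *: h (u * s * v).
Proof. by rewrite -scalerAr -scalerAl linearZ_LR. Qed.

End AlgebraLinearity.

Section EnvelopingTheory.
Variables (K : fieldType) (A : algType K).
Local Notation R := (env A).
Local Notation pi := (qpi (env_proper (A := A))).

Lemma tensorM (a b a' b' : A) :
  tensor a b * tensor a' b' = tensor (a' * a) (b * b').
Proof. by rewrite /tensor -rmorphM pretensorM. Qed.

Lemma env_rel_eq (f g : preenv A) : env_rel (f - g) -> pi f = pi g.
Proof.
move=> fg; apply/qpiP.
rewrite -[f - g]mulr1 -[f - g]mul1r -[_ * 1]addr0.
exact: ideal_genD fg (ideal_gen0 _).
Qed.

Lemma tensorDl (a a' b : A) : tensor (a + a') b = tensor a b + tensor a' b.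
Proof. by apply: etrans (env_rel_eq (env_relDl a a' b)) (raddfD pi _ _). Qed.

Lemma tensorDr (a b b' : A) : tensor a (b + b') = tensor a b + tensor a b'.
Proof. by apply: etrans (env_rel_eq (env_relDr a b b')) (raddfD pi _ _). Qed.

Lemma tensorZl k (a b : A) : tensor (k *: a) b = k *: tensor a b.
Proof. by apply: etrans (env_rel_eq (env_relZl k a b)) (linearZ_LR pi _ _). Qed.

Lemma tensorZr k (a b : A) : tensor a (k *: b) = k *: tensor a b.
Proof. by apply: etrans (env_rel_eq (env_relZr k a b)) (linearZ_LR pi _ _). Qed.

Lemma tensor0l (b : A) : tensor 0 b = 0.
Proof. by rewrite -(scale0r 0) tensorZl scale0r. Qed.

Lemma tensor0r (a : A) : tensor a 0 = 0.
Proof. by rewrite -(scale0r 0) tensorZr scale0r. Qed.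

Lemma tensor11 : tensor 1 1 = 1 :> R.
Proof.
apply: etrans _ (rmorph1 pi); congr (pi _).
by apply: etrans _ (esym (catalg_oneE K (mul_category (A^c * A)%type)));
  rewrite big_seq1.
Qed.

Lemma env_ind (P : R -> Prop) :
    P 0 -> (forall k a b t, P t -> P (k *: tensor a b + t)) -> forall t, P t.
Proof.
move=> P0 PD; elim/qpi_ind=> f; elim/env_act_ind: f => [|k a b f Pf].
  by rewrite raddf0.
have -> : pi (k *: pretensor a b + f) = k *: tensor a b + pi f by exact: linearP.
exact: PD.
Qed.

Section TensorFunctional.
Variables (f g : {linear A -> K^o}).

(** This is f (x) g. It kills the bilinearity relations, so it descends to the enveloping algebra,
    where for coordinate forms f and g it reads off the coefficient of a tensor of basis
    elements. *)
Definition pretensor_form : {linear preenv A -> K^o} :=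
  mlin (fun ab : A^c * A => f ab.1 * g ab.2 : K^o).

Lemma pretensor_formU a b : pretensor_form (pretensor a b) = f a * g b.
Proof. by rewrite /pretensor cbaseE; apply: mlinU. Qed.

Lemma pretensor_formM a b x y a' b' :
  pretensor_form (pretensor a b * pretensor x y * pretensor a' b') =
  f (a' * (x * a)) * g (b * y * b').
Proof.
by apply: etrans (congr1 pretensor_form _) (pretensor_formU _ _); rewrite !pretensorM.
Qed.

Lemma pretensor_form_rel s u v : env_rel s -> pretensor_form (u * s * v) = 0.
Proof.
move=> rs; elim/env_act_ind: u => [|k a b u IHu]; first by rewrite !mul0r raddf0.
apply: etrans (linear_mul_lin _ _ _ _ _ _) _.
rewrite {}IHu addr0 -[RHS](scaler0 _ k); congr (_ *: _).
elim/env_act_ind: v => [|l a' b' v IHv]; first by rewrite !mulr0 raddf0.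
apply: etrans (linear_mul_rin _ _ _ _ _ _) _.
rewrite {}IHv addr0 -[RHS](scaler0 _ l); congr (_ *: _).
case: rs => [x x' y|x y y'|c x y|c x y]; apply: linear_mul_midB.
- apply: etrans _ (esym (linear_mul_midD _ _ _ _ _)).
  by rewrite !pretensor_formM mulrDl mulrDr linearD mulrDl.
- apply: etrans _ (esym (linear_mul_midD _ _ _ _ _)).
  by rewrite !pretensor_formM mulrDr mulrDl linearD mulrDr.
- apply: etrans _ (esym (linear_mul_midZ _ _ _ _ _)).
  by rewrite !pretensor_formM -scalerAl -scalerAr linearZ_LR /= -scalerAl.
- apply: etrans _ (esym (linear_mul_midZ _ _ _ _ _)).
  by rewrite !pretensor_formM -scalerAr -scalerAl linearZ_LR /= -scalerAr.
Qed.

Lemma pretensor_form_ideal x :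
  ideal_gen (@env_rel K A) x -> pretensor_form x = 0.
Proof.
elim=> [|u s v y rs _ IHy]; first exact: raddf0.
apply: etrans (linearD pretensor_form _ _) _.
by rewrite IHy addr0 pretensor_form_rel.
Qed.

Definition tensor_form (t : R) : K^o := pretensor_form (qrepr t).

Lemma tensor_form_pi x : tensor_form (pi x) = pretensor_form x.
Proof.
apply/eqP; rewrite -subr_eq0; apply/eqP.
apply: etrans (esym (linearB pretensor_form _ _)) _.
by apply: pretensor_form_ideal; apply: qreprP.
Qed.

Lemma tensor_formE a b : tensor_form (tensor a b) = f a * g b.
Proof. by rewrite tensor_form_pi pretensor_formU. Qed.

Lemma tensor_form_is_linear : linear tensor_form.
Proof.
move=> k; elim/qpi_ind=> x; elim/qpi_ind=> y.
have -> : k *: pi x + pi y = pi (k *: x + y) by rewrite linearP.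
by rewrite !tensor_form_pi linearP.
Qed.

HB.instance Definition _ :=
  GRing.isLinear.Build K R K^o *:%R tensor_form tensor_form_is_linear.

End TensorFunctional.
End EnvelopingTheory.

(* The key (p, i, q) stands for b_p g_i b_q, where g_i is the i-th generator of *)
(* a projective bimodule; generators are described by their source and target. *)
Definition key := (nat * nat * nat)%type.
Definition gens := seq (nat * nat).

Definition vertex_basis (v : nat) : nat := (if v == 0 then 0 else 6)%N.
Definition gen_source (gs : gens) i := (nth (0, 0) gs i).1%N.
Definition gen_target (gs : gens) i := (nth (0, 0) gs i).2%N.

Definition key_mul (p q : nat) (k : key) : fsum key :=
  fbind (mul_basis p k.1.1) (fun r =>
    fbind (mul_basis k.2 q) (fun s => [:: (one_coef, (r, k.1.2, s))])).

Definition matched (gs : gens) (k : key) : bool :=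
  [&& k.1.1 < 12, k.2 < 12, k.1.2 < size gs,
      basis_target k.1.1 == gen_source gs k.1.2 &
      basis_source k.2 == gen_target gs k.1.2]%N.

Definition gens_ok (gs : gens) := all (fun e => (e.1 < 2) && (e.2 < 2))%N gs.

Definition matched_keys (gs : gens) : seq key :=
  [seq k <- [seq (pi, q) | pi <- [seq (p, i) | p <- iota 0 12, i <- iota 0 (size gs)],
                           q <- iota 0 12] | matched gs k].

Lemma matched_keysP gs (P : pred key) :
  all P (matched_keys gs) -> forall k, matched gs k -> P k.
Proof.
move=> /allP Pk [[p i] q] mk; apply: Pk; rewrite mem_filter mk andTb.
case/and5P: mk => p12 q12 igs _ _.
apply/allpairsP; exists (p, i, q); rewrite mem_iota; split=> //.
by apply/allpairsP; exists (p, i); rewrite !mem_iota.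
Qed.

(** * Sums of left ideals generated by idempotents *)

Section PeirceModule.
Variables (R : nzRingType) (k : nat) (e : nat -> R).
Hypothesis eK : forall i, e i * e i = e i.

(** It vanishes exactly on the rows whose i-th entry lies in R e_i; as a kernel, the set of these
    rows inherits its module structure from [ker]. *)
Definition peirce_defect (x : 'rV[R]_k) : 'rV[R]_k :=
  \row_i (x 0 i * e i - x 0 i).

Fact peirce_defect_is_linear : linear peirce_defect.
Proof.
move=> a x y; apply/rowP=> i; rewrite !mxE mulrDl mulrBr mulrA.
by rewrite opprD addrACA.
Qed.

HB.instance Definition _ := GRing.isLinear.Build R 'rV[R]_k 'rV[R]_k *:%R
  peirce_defect peirce_defect_is_linear.

(* The direct sum of the left ideals R e_i. *)
Definition peirce : lmodType R := ker peirce_defect.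

Lemma peirceP (x : peirce) i : val x 0 i * e i = val x 0 i.
Proof.
have /eqP/rowP/(_ i) := valP x.
by rewrite !mxE => /eqP; rewrite subr_eq0 => /eqP.
Qed.

Fact peirce_gen_subproof (i : nat) :
  \row_j (if i == j :> nat then e j else 0) \in ker_pred peirce_defect.
Proof.
apply/eqP/rowP=> j; rewrite !mxE.
by case: ifP => _; rewrite ?eK ?mul0r subrr.
Qed.

Definition peirce_gen (i : nat) : peirce := Ker (peirce_gen_subproof i).

Lemma val_peirce_gen i (j : 'I_k) :
  val (peirce_gen i) 0 j = if i == j then e j else 0.
Proof. by rewrite mxE. Qed.

Lemma val_peirceD (x y : peirce) i : val (x + y) 0 i = val x 0 i + val y 0 i.
Proof. by rewrite mxE. Qed.

Lemma val_peirceZ a (x : peirce) i : val (a *: x) 0 i = a * val x 0 i.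
Proof. by rewrite mxE. Qed.

Lemma peirce_expand (x : peirce) : x = \sum_(i < k) val x 0 i *: peirce_gen i.
Proof.
apply: val_inj; rewrite raddf_sum; apply/rowP=> j; rewrite summxE.
rewrite (bigD1 j) //= big1 ?addr0 => [|i ij]; rewrite !mxE.
  by rewrite eqxx peirceP.
by rewrite (negPf (_ : i != j :> nat)) ?mulr0.
Qed.

Lemma peirce_genK i : e i *: peirce_gen i = peirce_gen i.
Proof.
apply: val_inj; apply/rowP=> j; rewrite !mxE.
by case: eqP => [->|_]; rewrite ?eK ?mulr0.
Qed.

Section Hom.
Variables (V : lmodType R) (n : nat -> V).

Definition peirce_hom (x : peirce) : V := \sum_(i < k) val x 0 i *: n i.

Fact peirce_hom_is_linear : linear peirce_hom.
Proof.
move=> a x y; rewrite /peirce_hom scaler_sumr -big_split /=.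
by apply: eq_bigr => i _; rewrite !mxE scalerDl scalerA.
Qed.

HB.instance Definition _ :=
  GRing.isLinear.Build R peirce V *:%R peirce_hom peirce_hom_is_linear.

Lemma peirce_hom_gen i : (i < k)%N -> peirce_hom (peirce_gen i) = e i *: n i.
Proof.
move=> ik; rewrite /peirce_hom (bigD1 (Ordinal ik)) //= big1 ?addr0 => [|j ij].
  by rewrite !mxE eqxx.
by rewrite !mxE eq_sym (negPf (_ : j != i :> nat)) ?scale0r.
Qed.

End Hom.

Lemma peirce_hom_eta (V : lmodType R) (f : {linear peirce -> V}) x :
  f x = peirce_hom (f \o peirce_gen) x.
Proof.
rewrite [in LHS](peirce_expand x) linear_sum /peirce_hom.
by apply: eq_bigr => i _ /=; rewrite linearZ_LR.
Qed.

(** Arbitrary preimages of the images of the generators can be used: the i-th coordinate already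
    absorbs e_i, so any choice of values defines a linear map. *)
Lemma peirce_projective : projective peirce.
Proof.
move=> X Y g f g_surj; have [s gs] := choice (fun i => g_surj (f (peirce_gen i))).
exists (peirce_hom s) => x; rewrite (peirce_hom_eta f) /= /peirce_hom linear_sum.
by apply: eq_bigr => i _; rewrite linearZ_LR /= gs.
Qed.

End PeirceModule.

Section AlgebraModules.
Variables (K : fieldType) (R : algType K) (V : lmodType R).

Lemma scale_algA k (t : R) (v : V) : (k *: t) *: v = k%:A *: (t *: v).
Proof. by rewrite scalerA mulr_algl. Qed.

Lemma scale_algC k (t : R) (v : V) : t *: (in_alg R k *: v) = in_alg R k *: (t *: v).
Proof. by rewrite /= scalerA -scalerAr mulr1 scale_algA. Qed.

Lemma scale_algM j k (v : V) : (j * k)%:A *: v = j%:A *: (k%:A *: v).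
Proof. by rewrite -scalerA scale_algA. Qed.

End AlgebraModules.

Lemma tensor_formZ (K : fieldType) (A : algType K) (f g : {linear A -> K^o}) k t :
  tensor_form f g (k%:A * t) = k * tensor_form f g t.
Proof.
exact: etrans (congr1 (tensor_form f g) (mulr_algl k t)) (linearZ_LR _ _ _).
Qed.

Section TensorScale.
Variables (K : fieldType) (A : algType K) (V : lmodType (env A)).

Lemma tensorZl_scale k (x y : A) (v : V) :
  tensor (k *: x) y *: v = k%:A *: (tensor x y *: v).
Proof.
exact: etrans (congr1 (fun t : env A => t *: v) (tensorZl k x y)) (scale_algA _ _ _).
Qed.

Lemma tensorZr_scale k (x y : A) (v : V) :
  tensor x (k *: y) *: v = k%:A *: (tensor x y *: v).
Proof.
exact: etrans (congr1 (fun t : env A => t *: v) (tensorZr k x y)) (scale_algA _ _ _).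
Qed.

Lemma tensorDl_scale (x x' y : A) (v : V) :
  tensor (x + x') y *: v = tensor x y *: v + tensor x' y *: v.
Proof.
exact: etrans (congr1 (fun t : env A => t *: v) (tensorDl x x' y)) (scalerDl _ _ _).
Qed.

Lemma tensorDr_scale (x y y' : A) (v : V) :
  tensor x (y + y') *: v = tensor x y *: v + tensor x y' *: v.
Proof.
exact: etrans (congr1 (fun t : env A => t *: v) (tensorDr x y y')) (scalerDl _ _ _).
Qed.

End TensorScale.

(** * Projective bimodules in coordinates *)

Section Bimodules.
Variables (K : fieldType) (lambda : K) (A : algType K).
Variables (b : nat -> A) (c : nat -> {linear A -> K^o}).
Hypothesis Ab : based_algebra lambda b c.

Local Notation R := (env A).
Local Notation fevA := (feval lambda (idfun : {rmorphism K -> K}) b).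
Local Notation fevR := (feval lambda (in_alg R)).

Lemma basisM_vertex p u : (p < 12)%N -> (u < 2)%N ->
  b p * b (vertex_basis u) = if basis_target p == u then b p else 0.
Proof.
move=> p12 u2; rewrite (basis_mul Ab) //; last by case: u u2 => [|[|]].
have -> : (if basis_target p == u then b p else 0) =
    fevA (if basis_target p == u then [:: (one_coef, p)] else [::]).
  by case: ifP => _; rewrite ?feval1 ?feval_nil.
apply: feval_eq.
by case: u u2 => [|[|//]] _; do 12 (case: p p12 => [_|p p12]; first by vm_compute).
Qed.

Lemma vertexM_basis p u : (p < 12)%N -> (u < 2)%N ->
  b (vertex_basis u) * b p = if basis_source p == u then b p else 0.
Proof.
move=> p12 u2; rewrite (basis_mul Ab) //; last by case: u u2 => [|[|]].
have -> : (if basis_source p == u then b p else 0) =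
    fevA (if basis_source p == u then [:: (one_coef, p)] else [::]).
  by case: ifP => _; rewrite ?feval1 ?feval_nil.
apply: feval_eq.
by case: u u2 => [|[|//]] _; do 12 (case: p p12 => [_|p p12]; first by vm_compute).
Qed.

Lemma feval_semilinear (V : lmodType R) (F : A -> V) T (f : T -> A) l :
    (forall x y, F (x + y) = F x + F y) ->
    (forall k x, F (k *: x) = k%:A *: F x) ->
  F (feval lambda (idfun : {rmorphism K -> K}) f l) = fevR (F \o f) l.
Proof.
move=> FD FZ; elim: l => [|[k t] l IHl].
  by rewrite !feval_nil -(scale0r (0 : A)) FZ scale0r scale0r.
by rewrite !feval_cons FD FZ IHl.
Qed.

Section Key.
Variables (V : lmodType R) (n : nat -> V).

(** The outer factors are swapped in [tensor] because [tensor a b] acts by [x |-> b * x * a]. *)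
Definition key_elt (k : key) : V := tensor (b k.2) (b k.1.1) *: n k.1.2.

Lemma key_eltM p q k : (p < 12)%N -> (q < 12)%N ->
    (k.1.1 < 12)%N -> (k.2 < 12)%N ->
  tensor (b q) (b p) *: key_elt k = fevR key_elt (key_mul p q k).
Proof.
case: k => -[p' i] q' /= p12 q12 p12' q12'.
rewrite /key_elt scalerA tensorM !(basis_mul Ab) //= feval_bind.
rewrite (feval_semilinear (F := fun x => tensor _ x *: n i)) => [|x y|k x].
- apply: eq_bigr => x _; congr (_ *: _); rewrite feval_bind /=.
  rewrite (feval_semilinear (F := fun y => tensor y _ *: n i)) => [|y z|k y].
  + by apply: eq_bigr => y _; rewrite feval1.
  + exact: tensorDl_scale.
  + exact: tensorZl_scale.
- exact: tensorDr_scale.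
- exact: tensorZr_scale.
Qed.

Lemma feval_key_eltM p q l : (p < 12)%N -> (q < 12)%N ->
    all (fun x => (x.2.1.1 < 12) && (x.2.2 < 12))%N l ->
  tensor (b q) (b p) *: fevR key_elt l = fevR key_elt (fbind l (key_mul p q)).
Proof.
move=> p12 q12; elim: l => [|[d k] l IHl] /=.
  by move=> _; rewrite !feval_nil scaler0.
case/andP=> /andP[k1 k2] /IHl{}IHl.
by rewrite feval_cons feval_cat feval_scale scalerDr scale_algC key_eltM // IHl.
Qed.

End Key.

Section ProjectiveBimodule.
Variable gs : gens.
Hypothesis gs_ok : gens_ok gs.

Lemma gen_source_lt2 i : (gen_source gs i < 2)%N.
Proof.
rewrite /gen_source; have [i_gs|] := ltnP i (size gs).
  by have /allP/(_ _ (mem_nth (0, 0)%N i_gs))/andP[] := gs_ok.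
by move=> gs_i; rewrite nth_default.
Qed.

Lemma gen_target_lt2 i : (gen_target gs i < 2)%N.
Proof.
rewrite /gen_target; have [i_gs|] := ltnP i (size gs).
  by have /allP/(_ _ (mem_nth (0, 0)%N i_gs))/andP[] := gs_ok.
by move=> gs_i; rewrite nth_default.
Qed.

Definition gen_idem (i : nat) : R :=
  tensor (b (vertex_basis (gen_target gs i))) (b (vertex_basis (gen_source gs i))).

Lemma tensor_gen_idem p q i : (p < 12)%N -> (q < 12)%N -> (i < size gs)%N ->
  tensor (b q) (b p) * gen_idem i =
  if matched gs (p, i, q) then tensor (b q) (b p) else 0.
Proof.
move=> p12 q12 igs; rewrite tensorM basisM_vertex ?gen_source_lt2 //.
rewrite vertexM_basis ?gen_target_lt2 // /matched p12 q12 igs /=.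
by case: eqP => _; case: eqP => _ //=; rewrite ?tensor0l ?tensor0r.
Qed.

Lemma gen_idemK i : gen_idem i * gen_idem i = gen_idem i.
Proof.
have v12 v : (vertex_basis v < 12)%N by rewrite /vertex_basis; case: ifP.
have tv u v : (u < 2)%N -> (v < 2)%N ->
    (basis_target (vertex_basis u) == v) = (u == v).
  by case: u v => [|[|//]] [|[|//]].
have sv u v : (u < 2)%N -> (v < 2)%N ->
    (basis_source (vertex_basis u) == v) = (u == v).
  by case: u v => [|[|//]] [|[|//]].
have s2 := gen_source_lt2 i; have t2 := gen_target_lt2 i.
by rewrite tensorM basisM_vertex ?tv // vertexM_basis ?sv // !eqxx.
Qed.

Definition bimod : lmodType R := peirce (size gs) gen_idem.

Definition gen (i : nat) : bimod := peirce_gen (size gs) gen_idemK i.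

Lemma gen_expand (x : bimod) : x = \sum_(i < size gs) val x 0 i *: gen i.
Proof. exact: peirce_expand. Qed.

Lemma gen_idem_gen i : gen_idem i *: gen i = gen i.
Proof. exact: peirce_genK. Qed.

Definition bimod_hom (V : lmodType R) (n : nat -> V) : {linear bimod -> V} :=
  peirce_hom n.

Lemma bimod_hom_gen (V : lmodType R) (n : nat -> V) i : (i < size gs)%N ->
  bimod_hom n (gen i) = gen_idem i *: n i.
Proof. exact: peirce_hom_gen. Qed.

Lemma bimod_hom_eta (V : lmodType R) (f : {linear bimod -> V}) x :
  f x = bimod_hom (f \o gen) x.
Proof. exact: peirce_hom_eta. Qed.

Lemma bimod_projective : projective bimod.
Proof. exact: peirce_projective gen_idemK. Qed.

Lemma bimod_hom_key (V : lmodType R) (n : nat -> V) k : matched gs k ->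
  bimod_hom n (key_elt gen k) = key_elt n k.
Proof.
move=> mk; apply: etrans (linearZ_LR (bimod_hom n) _ _) _.
case/and5P: (mk) => p12 q12 igs _ _.
apply: etrans (congr1 _ (bimod_hom_gen n igs)) _.
rewrite scalerA tensor_gen_idem //.
by rewrite -!surjective_pairing mk.
Qed.

(** Both tensor factors are expanded in the basis of A, so the keys span over K; a key whose
    endpoints do not match is killed by the idempotent of its generator. *)
Lemma bimod_ind (P : bimod -> Prop) :
    P 0 -> (forall x y, P x -> P y -> P (x + y)) ->
    (forall a x, P x -> P (a%:A *: x)) ->
    (forall k, matched gs k -> P (key_elt gen k)) ->
  forall x, P x.
Proof.
move=> P0 PD PZ Pk x; rewrite (gen_expand x); apply: big_ind => // i _.
elim/env_ind: (val x 0 i) => [|a y z t Pt]; first by rewrite scale0r.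
rewrite scalerDl; apply: (PD) => //.
have -> : (a *: tensor y z) *: gen i = a%:A *: (tensor y z *: gen i).
  exact: scale_algA.
apply: (PZ) => {Pt t a}.
pose F u v : bimod := tensor u v *: gen i.
have F01 w : F 0 w = 0 by rewrite /F tensor0l scale0r.
have F02 w : F w 0 = 0 by rewrite /F tensor0r scale0r.
have Fl w := big_morph (F^~ w) (fun u v => tensorDl_scale u v w (gen i)) (F01 w).
have Fr w := big_morph (F w) (fun u v => tensorDr_scale w u v (gen i)) (F02 w).
rewrite -/(F y z) (basis_span Ab y) Fl.
apply: (big_ind P); [exact: P0 | exact: PD | move=> q _].
rewrite (basis_span Ab z) Fr.
apply: (big_ind P); [exact: P0 | exact: PD | move=> p _].
have -> : F (c q y *: b q) (c p z *: b p) =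
    (c q y)%:A *: ((c p z)%:A *: key_elt gen (p : nat, i : nat, q : nat)).
  apply: etrans (tensorZl_scale _ _ _ _) _; congr (_ *: _).
  exact: tensorZr_scale.
apply: (PZ); apply: (PZ).
have [mk|nmk] := boolP (matched gs (nat_of_ord p, nat_of_ord i, nat_of_ord q)).
  exact: Pk.
rewrite /key_elt -gen_idem_gen scalerA tensor_gen_idem ?ltn_ord //.
by rewrite (negPf nmk) scale0r.
Qed.

Section LinearExtension.
Variables (V : lmodType R) (S : key -> V).

(** A contracting homotopy is not a bimodule map, so it is not determined by the generators. This
    extends values on all matched keys K-linearly, through the coordinates of each entry. *)
Definition key_extend (x : bimod) : V :=
  \sum_(i < size gs) \sum_(p < 12) \sum_(q < 12)
    (tensor_form (c q) (c p) (val x 0 i))%:A *: S (p : nat, i : nat, q : nat).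

Lemma key_extendD x y : key_extend (x + y) = key_extend x + key_extend y.
Proof.
rewrite /key_extend -big_split; apply: eq_bigr => i _ /=.
rewrite -big_split; apply: eq_bigr => p _ /=.
rewrite -big_split; apply: eq_bigr => q _ /=.
by rewrite val_peirceD linearD scalerDl scalerDl.
Qed.

Lemma key_extendZ a x : key_extend (a%:A *: x) = a%:A *: key_extend x.
Proof.
apply: etrans _ (esym (scaler_sumr _ _ _ _)); apply: eq_bigr => i _.
apply: etrans _ (esym (scaler_sumr _ _ _ _)); apply: eq_bigr => p _.
apply: etrans _ (esym (scaler_sumr _ _ _ _)); apply: eq_bigr => q _.
apply: etrans _ (scale_algM _ _ _).
by rewrite val_peirceZ tensor_formZ.
Qed.

Lemma key_extendE k : matched gs k -> key_extend (key_elt gen k) = S k.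
Proof.
case: k => -[p i] q mk; case/and5P: (mk) => /= p12 q12 igs _ _.
have valE (j : 'I_(size gs)) : val (key_elt gen (p, i, q)) 0 j =
    if i == j :> nat then tensor (b q) (b p) else 0.
  rewrite val_peirceZ val_peirce_gen /=; case: eqP => [e|_]; last by rewrite mulr0.
  by rewrite -e tensor_gen_idem // mk.
rewrite /key_extend (bigD1 (Ordinal igs)) //= [X in _ + X]big1 => [|j ij].
  rewrite (bigD1 (Ordinal p12)) //= [X in _ + X + _]big1 => [|r rp].
    rewrite (bigD1 (Ordinal q12)) //= [X in _ + X + _ + _]big1 => [|r rq].
      rewrite valE eqxx tensor_formE !(basis_coord Ab) // !eqxx.
      by rewrite mulr1 !scale1r !addr0.
    rewrite valE eqxx tensor_formE !(basis_coord Ab) //.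
    by rewrite (negPf (_ : r != q :> nat)) // mul0r !scale0r.
  apply: big1 => s _; rewrite valE eqxx tensor_formE !(basis_coord Ab) //.
  by rewrite (negPf (_ : r != p :> nat)) // mulr0 !scale0r.
apply: big1 => r _; apply: big1 => s _.
by rewrite valE eq_sym (negPf (_ : j != i :> nat)) // linear0 !scale0r.
Qed.

End LinearExtension.
End ProjectiveBimodule.
End Bimodules.

(** * The bimodule resolution *)

(* diff3 comes from the potential                                              *)
(*   alpha^3 / 3 - alpha sigma gamma + sigma beta gamma - lambda beta^3 / 3,   *)
(* whose cyclic derivatives are, up to sign, the four relations.               *)
Definition diff1 (j : nat) : fsum key := match j with
  | 0 =>
      [:: (one_coef, (1, 0, 0)%N); ([:: -1], (0, 0, 1)%N)]
  | 1 =>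
      [:: (one_coef, (2, 1, 6)%N); ([:: -1], (0, 0, 2)%N)]
  | 2 =>
      [:: (one_coef, (8, 0, 0)%N); ([:: -1], (6, 1, 8)%N)]
  | 3 =>
      [:: (one_coef, (7, 1, 6)%N); ([:: -1], (6, 1, 7)%N)]
  | _ => [::]
  end.

(** Each relation goes to the sum over the arrow positions in its monomials, the arrow being
    replaced by its generator and the rest of the monomial kept on either side. *)
Definition diff2 (j : nat) : fsum key := match j with
  | 0 =>
      [:: (one_coef, (1, 0, 0)%N); (one_coef, (0, 0, 1)%N);
      ([:: -1], (2, 2, 0)%N); ([:: -1], (0, 1, 8)%N)]
  | 1 =>
      [:: ([:: 0; 1], (7, 3, 6)%N); ([:: 0; 1], (6, 3, 7)%N);
      ([:: -1], (8, 1, 6)%N); ([:: -1], (6, 2, 2)%N)]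
  | 2 =>
      [:: (one_coef, (8, 0, 0)%N); (one_coef, (6, 2, 1)%N);
      ([:: -1], (7, 2, 0)%N); ([:: -1], (6, 3, 8)%N)]
  | 3 =>
      [:: (one_coef, (1, 1, 6)%N); (one_coef, (0, 0, 2)%N);
      ([:: -1], (2, 3, 6)%N); ([:: -1], (0, 1, 7)%N)]
  | _ => [::]
  end.

Definition diff3 (j : nat) : fsum key := match j with
  | 0 =>
      [:: (one_coef, (1, 0, 0)%N); ([:: -1], (0, 0, 1)%N);
      ([:: -1], (2, 2, 0)%N); (one_coef, (0, 3, 8)%N)]
  | 1 =>
      [:: (one_coef, (6, 2, 2)%N); ([:: -1], (8, 3, 6)%N);
      ([:: -1], (7, 1, 6)%N); (one_coef, (6, 1, 7)%N)]
  | _ => [::]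
  end.

(* Values at b_p g_i of a contracting homotopy which is linear for the right   *)
(* action, multiplied by lambda (1 - lambda) to clear denominators; those of   *)
(* homotopy1 and homotopy2 were found by linear algebra over Q(lambda).        *)
Definition homotopy0 (p i : nat) : fsum key := match p, i with
  | 1, 0 =>
      [:: ([:: 0; 1; -1], (0, 0, 0)%N)]
  | 2, 1 =>
      [:: ([:: 0; 1; -1], (0, 1, 6)%N)]
  | 3, 0 =>
      [:: ([:: 0; 1; -1], (0, 0, 1)%N); ([:: 0; 1; -1], (1, 0, 0)%N)]
  | 4, 1 =>
      [:: ([:: 0; 1; -1], (0, 0, 2)%N); ([:: 0; 1; -1], (1, 1, 6)%N)]
  | 5, 0 =>
      [:: ([:: 0; 1; -1], (0, 0, 3)%N); ([:: 0; 1; -1], (1, 0, 1)%N);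
      ([:: 0; 1; -1], (3, 0, 0)%N)]
  | 7, 1 =>
      [:: ([:: 0; 1; -1], (6, 3, 6)%N)]
  | 8, 0 =>
      [:: ([:: 0; 1; -1], (6, 2, 0)%N)]
  | 9, 1 =>
      [:: ([:: 0; 1; -1], (6, 3, 7)%N); ([:: 0; 1; -1], (7, 3, 6)%N)]
  | 10, 0 =>
      [:: ([:: 0; 1; -1], (6, 3, 8)%N); ([:: 0; 1; -1], (7, 2, 0)%N)]
  | 11, 1 =>
      [:: ([:: 0; 1; -1], (6, 3, 9)%N); ([:: 0; 1; -1], (7, 3, 7)%N);
      ([:: 0; 1; -1], (9, 3, 6)%N)]
  | _, _ => [::]
  end.

Definition homotopy1 (p i : nat) : fsum key := match p, i with
  | 5, 0 =>
      [:: ([:: 0; 1; -1], (0, 0, 3)%N); ([:: 0; 1], (3, 0, 0)%N);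
      ([:: 0; -1], (2, 1, 8)%N); ([:: 0; 0; -1], (2, 2, 1)%N);
      ([:: 0; 0; -1], (4, 2, 0)%N)]
  | 8, 0 =>
      [:: ([:: 0; 1; -1], (6, 2, 0)%N)]
  | 10, 0 =>
      [:: ([:: 0; 1], (8, 0, 0)%N); ([:: 0; 0; -1], (7, 2, 0)%N);
      ([:: 0; -1], (6, 2, 1)%N); ([:: 0; -1], (6, 1, 8)%N)]
  | 3, 1 =>
      [:: ([:: 0; 1], (0, 0, 2)%N); ([:: 0; 0; -1], (0, 3, 7)%N);
      ([:: 0; 0; -1], (1, 3, 6)%N); ([:: 0; -1], (2, 1, 6)%N)]
  | 5, 1 =>
      [:: ([:: 0; 0; 0; -1], (0, 3, 9)%N); ([:: 0; -1; 1], (4, 1, 6)%N);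
      ([:: 0; 0; 1], (0, 0, 4)%N); ([:: 0; 0; -1], (1, 3, 7)%N);
      ([:: 0; 0; -1], (2, 1, 7)%N); ([:: 0; 1; -1], (1, 0, 2)%N)]
  | 8, 1 =>
      [:: ([:: 0; -1; 1], (6, 1, 6)%N)]
  | 10, 1 =>
      [:: ([:: 0; -1; 1], (7, 1, 6)%N)]
  | 2, 2 =>
      [:: ([:: 0; -1; 1], (0, 0, 0)%N)]
  | 4, 2 =>
      [:: ([:: 0; -1; 1], (1, 0, 0)%N)]
  | 9, 2 =>
      [:: ([:: 0; 1], (8, 0, 0)%N); ([:: 0; -1], (7, 2, 0)%N);
      ([:: 0; -1], (6, 2, 1)%N); ([:: 0; -1], (6, 1, 8)%N)]
  | 11, 2 =>
      [:: ([:: 0; -1], (9, 2, 0)%N); ([:: 0; -1], (7, 2, 1)%N);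
      ([:: 0; -1], (7, 1, 8)%N); ([:: 0; 1], (10, 0, 0)%N)]
  | 2, 3 =>
      [:: ([:: 0; -1; 1], (0, 3, 6)%N)]
  | 4, 3 =>
      [:: ([:: 0; 1], (0, 0, 2)%N); ([:: 0; 0; -1], (0, 3, 7)%N);
      ([:: 0; -1], (1, 3, 6)%N); ([:: 0; -1], (2, 1, 6)%N)]
  | 11, 3 =>
      [:: ([:: 1; -1], (9, 1, 6)%N); ([:: 0; -1], (6, 1, 9)%N);
      (one_coef, (8, 0, 2)%N); ([:: -1], (7, 2, 2)%N); ([:: -1], (6, 2, 4)%N)]
  | _, _ => [::]
  end.

Definition homotopy2 (p i : nat) : fsum key := match p, i with
  | 3, 0 =>
      [:: ([:: 0; 0; -1], (0, 0, 1)%N); ([:: 0; 0; -1], (1, 0, 0)%N)]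
  | 5, 0 =>
      [:: ([:: 0; 1; -2], (0, 0, 3)%N); ([:: 0; 0; -1], (1, 0, 1)%N);
      ([:: 0; 1; -1], (2, 1, 8)%N); ([:: 0; 1; -1], (3, 0, 0)%N)]
  | 10, 0 =>
      [:: ([:: 0; 1], (8, 0, 0)%N); ([:: 0; 1], (6, 1, 8)%N)]
  | 11, 1 =>
      [:: ([:: 0; 1], (8, 0, 2)%N); ([:: 0; -1; 1], (9, 1, 6)%N);
      ([:: 0; 0; 1], (6, 1, 9)%N)]
  | 2, 2 =>
      [:: ([:: 0; -1; 1], (0, 0, 0)%N)]
  | 4, 2 =>
      [:: ([:: 0; 0; -1], (0, 0, 1)%N); ([:: 0; -1], (1, 0, 0)%N)]
  | 9, 2 =>
      [:: ([:: 0; 1], (8, 0, 0)%N); ([:: 0; 1], (6, 1, 8)%N)]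
  | 11, 2 =>
      [:: ([:: -1], (6, 1, 10)%N); ([:: -1; 1], (7, 1, 8)%N);
      ([:: -1; 1], (10, 0, 0)%N); ([:: -1], (8, 0, 1)%N)]
  | 3, 3 =>
      [:: ([:: 0; -1; 1], (0, 0, 2)%N); ([:: 0; -1; 1], (2, 1, 6)%N)]
  | 5, 3 =>
      [:: ([:: 0; 0; -1], (0, 0, 4)%N); ([:: 0; -1], (1, 0, 2)%N);
      ([:: 0; -1; 1], (4, 1, 6)%N)]
  | 8, 3 =>
      [:: ([:: 0; -1; 1], (6, 1, 6)%N)]
  | 10, 3 =>
      [:: ([:: 0; -1; 1], (7, 1, 6)%N)]
  | _, _ => [::]
  end.


Definition vertex_gens : gens := [:: (0, 0); (1, 1)]%N.
Definition arrow_gens : gens := [:: (0, 0); (0, 1); (1, 0); (1, 1)]%N.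
Definition relation_gens : gens := [:: (0, 0); (1, 1); (1, 0); (0, 1)]%N.

Definition homotopy_scale : coef := [:: 0; 1; -1].

Definition diff_key (D : nat -> fsum key) (k : key) : fsum key :=
  fbind (D k.1.2) (key_mul k.1.1 k.2).

(** Right linear extension from b_p g_i to b_p g_i b_q. The left factor given to [key_mul] is the
    vertex where b_p starts; the listed values start there too, so it acts as the identity. *)
Definition homotopy_key (S : nat -> nat -> fsum key) (k : key) : fsum key :=
  fbind (S k.1.1 k.1.2) (key_mul (vertex_basis (basis_source k.1.1)) k.2).

Definition in_range (l : fsum key) :=
  all (fun x => (x.2.1.1 < 12) && (x.2.2 < 12))%N l.

Definition all_matched (gs : gens) (l : fsum key) :=
  all (fun x => matched gs x.2) l.

(** The identity lambda (1 - lambda) k = D (S k) + T k for each matched key k, where T stands for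
    the homotopy one degree lower applied after the outgoing differential. *)
Definition homotopy_check gs gs' (D : nat -> fsum key) (S T : key -> fsum key) :=
  all (fun k => all_matched gs' (S k) &&
    feq [:: (homotopy_scale, k)] (fbind (S k) (diff_key D) ++ T k))
  (matched_keys gs).

Lemma eq_feval_scalars (K : fieldType) (lambda : K) (S S' : nzRingType)
    (iota : {rmorphism K -> S}) (iota' : {rmorphism K -> S'}) (V : lmodType S)
    (V' : lmodType S') (F : V -> V') T (f : T -> V) l :
    (forall x y, F (x + y) = F x + F y) ->
    (forall k x, F (iota k *: x) = iota' k *: F x) ->
  F (feval lambda iota f l) = feval lambda iota' (F \o f) l.
Proof.
move=> FD FZ; elim: l => [|[k t] l IHl]; last by rewrite !feval_cons FD FZ IHl.
rewrite !feval_nil -(scale0r (0 : V)) -(rmorph0 iota) FZ rmorph0.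
exact: scale0r.
Qed.

(** * Exactness from a scaled contracting homotopy *)

Section Homotopy.
Variables (K : fieldType) (R : algType K) (V V' W : lmodType R).
Variables (d : {linear V' -> V}) (f : {linear V -> W}) (a : K).
Variables (s : V -> V') (t : W -> V).
Hypotheses (sD : forall x y, s (x + y) = s x + s y)
  (sZ : forall k x, s (k%:A *: x) = k%:A *: s x).
Hypotheses (tD : forall x y, t (x + y) = t x + t y)
  (tZ : forall k x, t (k%:A *: x) = k%:A *: t x).

Let t0 : t 0 = 0.
Proof. by rewrite -(scale0r (0 : W)) -(scale0r (1 : R)) tZ !scale0r. Qed.

Let s0 : s 0 = 0.
Proof. by rewrite -(scale0r (0 : V)) -(scale0r (1 : R)) sZ !scale0r. Qed.

Lemma homotopy_closed (P := fun x => a%:A *: x = d (s x) + t (f x)) :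
  [/\ P 0, forall x y, P x -> P y -> P (x + y) &
      forall k x, P x -> P (k%:A *: x)].
Proof.
split=> [|x y Px Py|k x Px]; rewrite /P.
- by rewrite s0 !linear0 t0 scaler0 addr0.
- by rewrite scalerDr Px Py sD !linearD tD addrACA.
- rewrite sZ !linearZ_LR tZ /= -scalerDr -Px !scalerA.
  by rewrite !mulr_algl !scalerA mulrC.
Qed.

Lemma homotopy_preimage x : a != 0 -> a%:A *: x = d (s x) + t (f x) ->
  f x = 0 -> exists y, d y = x.
Proof.
move=> a0 + fx; rewrite fx t0 addr0 => ax; exists (a^-1%:A *: s x).
by rewrite linearZ_LR /= -ax scalerA mulr_algl scalerA mulVf // !scale1r.
Qed.

End Homotopy.

Section Differential.
Variables (K : fieldType) (lambda : K) (A : algType K).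
Variables (b : nat -> A) (c : nat -> {linear A -> K^o}).
Hypothesis Ab : based_algebra lambda b c.

Local Notation R := (env A).
Local Notation fevR := (feval lambda (in_alg R)).

Section TwoBimodules.
Variables (gs gs' : gens).
Hypotheses (gs_ok : gens_ok gs) (gs'_ok : gens_ok gs').
Local Notation gn := (gen Ab gs_ok).
Local Notation gn' := (gen Ab gs'_ok).

Lemma feval_key_hom (V : lmodType R) (f : {linear bimod b gs -> V}) l :
  f (fevR (key_elt b gn) l) = fevR (key_elt b (f \o gn)) l.
Proof.
apply: etrans (feval_linear _ _ _ _ _) _; apply: eq_in_feval => x _.
exact: linearZ_LR.
Qed.

Variable D : nat -> fsum key.
Hypothesis D_range : forall j, in_range (D j).

Definition differential : {linear bimod b gs' -> bimod b gs} :=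
  bimod_hom b gs' (fun j => fevR (key_elt b gn) (D j)).

Lemma differential_key k : matched gs' k ->
  differential (key_elt b gn' k) = fevR (key_elt b gn) (diff_key D k).
Proof.
move=> mk; apply: etrans (bimod_hom_key Ab gs'_ok _ mk) _.
case/and5P: mk => p12 q12 _ _ _.
exact: (feval_key_eltM Ab _ p12 q12 (D_range _)).
Qed.

Lemma feval_differential l : all_matched gs' l ->
  differential (fevR (key_elt b gn') l) =
  fevR (key_elt b gn) (fbind l (diff_key D)).
Proof.
move=> /allP ml; apply: etrans (feval_linear _ _ _ _ _) _.
rewrite feval_bind; apply: eq_in_feval => x /ml; apply: differential_key.
Qed.

Lemma differential_comp0 (V : lmodType R) (f : {linear bimod b gs -> V}) :
    (forall j, (j < size gs')%N -> f (fevR (key_elt b gn) (D j)) = 0) ->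
  forall x, f (differential x) = 0.
Proof.
move=> fD x; rewrite /differential /bimod_hom /= /peirce_hom linear_sum.
by rewrite big1 // => i _; rewrite linearZ_LR /= fD ?scaler0.
Qed.

(** The homotopy identity is checked on keys and spreads by [bimod_ind]. On the kernel of [f] it
    reduces to a x = d (s x) with a = lambda (1 - lambda), which is invertible. *)
Lemma homotopy_exact (W : lmodType R) (f : {linear bimod b gs -> W})
    (t : W -> bimod b gs) (S T : key -> fsum key) :
    lambda != 0 -> lambda != 1 ->
    (forall x y, t (x + y) = t x + t y) ->
    (forall k x, t (k%:A *: x) = k%:A *: t x) ->
    (forall k, matched gs k ->
      t (f (key_elt b gn k)) = fevR (key_elt b gn) (T k)) ->
    homotopy_check gs gs' D S T ->
  forall x, f x = 0 -> exists y, differential y = x.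
Proof.
move=> l0 l1 tD tZ tT check.
pose a := ceval lambda homotopy_scale.
have a0 : a != 0.
  have -> : a = lambda * (1 - lambda) by rewrite /a /=; ring.
  by rewrite mulf_neq0 // subr_eq0 eq_sym.
pose s := key_extend (b := b) c (gs := gs) (fun k => fevR (key_elt b gn') (S k)).
have sD := key_extendD (b := b) c (fun k => fevR (key_elt b gn') (S k)) (gs := gs).
have sZ := key_extendZ (b := b) c (fun k => fevR (key_elt b gn') (S k)) (gs := gs).
have [P0 PD PZ] := homotopy_closed differential f a sD sZ tD tZ.
move=> x fx; apply: (homotopy_preimage (d := differential) (s := s) tZ a0 _ fx).
apply: (@bimod_ind _ _ _ _ _ Ab _ gs_ok _ P0 PD PZ) => k mk.
have /andP[mS /(feval_eq lambda (in_alg R) (key_elt b gn))] :=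
  matched_keysP check mk.
rewrite feval_cons feval_nil addr0 feval_cat => e.
apply: etrans e _; congr (_ + _); last exact: esym (tT _ mk).
apply: etrans (esym (feval_differential mS)) _.
by apply: congr1; apply: esym (key_extendE Ab gs_ok _ mk).
Qed.

End TwoBimodules.

End Differential.

(** The bottom of the homotopy, b_p |-> e (x) b_p with e the vertex where b_p starts, multiplied by
    the common scale. *)
Definition unit_key (p : nat) : fsum key :=
  [:: (homotopy_scale, (vertex_basis (basis_source p), basis_source p, p))].

Fact vertex_gens_ok : gens_ok vertex_gens. Proof. by []. Qed.
Fact arrow_gens_ok : gens_ok arrow_gens. Proof. by []. Qed.
Fact relation_gens_ok : gens_ok relation_gens. Proof. by []. Qed.

Fact diff1_range j : in_range (diff1 j).
Proof. by do 4 (case: j => [//|j]). Qed.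

Fact diff2_range j : in_range (diff2 j).
Proof. by do 4 (case: j => [//|j]). Qed.

Fact diff3_range j : in_range (diff3 j).
Proof. by do 2 (case: j => [//|j]). Qed.

Lemma mul_basis_lt p q : (p < 12)%N -> (q < 12)%N ->
  all (fun y => y.2 < 12)%N (mul_basis p q).
Proof.
move=> p12 q12.
have /allP/(_ p) : all (fun p => all (fun q => all (fun y => y.2 < 12)%N (mul_basis p q))
  (iota 0 12)) (iota 0 12) by vm_compute.
by rewrite mem_iota => /(_ p12)/allP/(_ q); rewrite mem_iota => /(_ q12).
Qed.

(** * Exactness of the explicit complex *)

Section Resolution.
Variables (K : fieldType) (lambda : K) (A : algType K).
Variables (b : nat -> A) (c : nat -> {linear A -> K^o}).
Hypothesis Ab : based_algebra lambda b c.
Hypotheses (lambda_neq0 : lambda != 0) (lambda_neq1 : lambda != 1).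

Local Notation R := (env A).
Local Notation fevA := (feval lambda (idfun : {rmorphism K -> K}) b).
Local Notation fevR := (feval lambda (in_alg R)).
Local Notation gen0 := (gen Ab vertex_gens_ok).
Local Notation gen1 := (gen Ab arrow_gens_ok).
Local Notation gen2 := (gen Ab relation_gens_ok).

Lemma regbimod_scale k (x : regbimod A) : k%:A *: x = (k *: (x : A)) :> A.
Proof.
have -> : k%:A = tensor 1 (k *: 1) :> R by rewrite tensorZr tensor11.
by rewrite tensor_scale mulr1 -scalerAl mul1r.
Qed.

Lemma key_elt_reg (n : nat -> regbimod A) k :
  key_elt b n k = (b k.1.1 : A) * (n k.1.2 : A) * b k.2.
Proof. exact: tensor_scale. Qed.

Definition augmentation : {linear bimod b vertex_gens -> regbimod A} :=
  bimod_hom b vertex_gens (fun i => b (vertex_basis i) : regbimod A).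

Lemma augmentation_key k : matched vertex_gens k ->
  augmentation (key_elt b gen0 k) = fevA (mul_basis k.1.1 k.2).
Proof.
move=> mk; apply: etrans (bimod_hom_key Ab vertex_gens_ok _ mk) _.
rewrite key_elt_reg; case: k mk => -[p [|[|i]]] q /and5P[p12 q12 // _ /eqP/= tp _].
  by rewrite (basisM_vertex Ab) // tp eqxx (basis_mul Ab).
by rewrite (basisM_vertex Ab) // tp eqxx (basis_mul Ab).
Qed.

Lemma feval_augmentation l : all_matched vertex_gens l ->
  augmentation (fevR (key_elt b gen0) l) =
  fevA (fbind l (fun k => mul_basis k.1.1 k.2)).
Proof.
move=> /allP ml; apply: etrans (feval_linear _ _ _ _ _) _; rewrite feval_bind.
rewrite (@eq_in_feval _ _ _ _ _ _ _
  (fun k => fevA (mul_basis k.1.1 k.2) : regbimod A)); last first.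
  by move=> x /ml; apply: augmentation_key.
elim: l {ml} => [|[k t] l IHl]; first by rewrite !feval_nil.
by rewrite !feval_cons IHl; congr (_ + _); apply: regbimod_scale.
Qed.

Definition unit_section (x : regbimod A) : bimod b vertex_gens :=
  \sum_(p < 12) (c p (x : A))%:A *: fevR (key_elt b gen0) (unit_key p).

Lemma unit_sectionD x y : unit_section (x + y) = unit_section x + unit_section y.
Proof.
apply: etrans _ (big_split _ _ _ _ _); apply: eq_bigr => p _.
apply: etrans (congr1 (fun k => k%:A *: _) (linearD (c p) (x : A) y)) _.
by rewrite scalerDl scalerDl.
Qed.

Lemma unit_sectionZ k x : unit_section (k%:A *: x) = k%:A *: unit_section x.
Proof.
apply: etrans _ (esym (scaler_sumr _ _ _ _)); apply: eq_bigr => p _.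
set w := fevR _ _.
apply: etrans (congr1 (fun a : A => (c p a)%:A *: w) (regbimod_scale k x)) _.
apply: etrans (congr1 (fun m : K => m%:A *: w) (linearZ_LR (c p) k (x : A))) _.
exact: scale_algM.
Qed.

Lemma unit_section_basis p : (p < 12)%N ->
  unit_section (b p) = fevR (key_elt b gen0) (unit_key p).
Proof.
move=> p12; rewrite /unit_section (bigD1 (Ordinal p12)) //= big1 => [|q pq].
  by rewrite (basis_coord Ab) // eqxx scale1r scale1r addr0.
rewrite (basis_coord Ab) // (negPf (_ : q != p :> nat)) //.
by rewrite scale0r scale0r.
Qed.

Lemma unit_section_feval l : all (fun y => y.2 < 12)%N l ->
  unit_section (fevA l) = fevR (key_elt b gen0) (fbind l unit_key).
Proof.
move=> /allP l12; rewrite feval_bind.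
rewrite (@eq_feval_scalars K lambda K R (idfun : {rmorphism K -> K}) (in_alg R) A
  (bimod b vertex_gens) unit_section).
- by apply: eq_in_feval => y /l12; apply: unit_section_basis.
- exact: unit_sectionD.
- by move=> k x; rewrite -unit_sectionZ regbimod_scale.
Qed.

Definition d1 := differential Ab arrow_gens vertex_gens_ok diff1.
Definition d2 := differential Ab relation_gens arrow_gens_ok diff2.
Definition d3 := differential Ab vertex_gens relation_gens_ok diff3.

Lemma augmentation_surj (a : regbimod A) : exists x, augmentation x = a.
Proof.
exists (tensor 1 (a : A) *: (gen0 0 + gen0 1%N)).
have e0 i : (i < 2)%N -> augmentation (gen0 i) = b (vertex_basis i).
  move=> i2; apply: etrans (bimod_hom_gen _ _ _ _) _ => //.
  rewrite /gen_idem tensor_scale.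
  by case: i i2 => [|[|//]] _ /=; rewrite !(basisM_vertex Ab).
rewrite linearZ_LR linearD !e0 // -(basis_one Ab).
by rewrite tensor_scale !mulr1.
Qed.

(** The role of [t] in [homotopy_exact] is played by the homotopy one degree down, the K-linear
    extension of [S0]; on keys its composite with the outgoing differential is a formal sum that can
    be computed. *)
Lemma differential_exact gs0 gs gs' (ok0 : gens_ok gs0) (ok : gens_ok gs)
    (ok' : gens_ok gs') D0 D S0 S :
    (forall j, in_range (D0 j)) -> (forall j, in_range (D j)) ->
    all (fun k => all_matched gs0 (diff_key D0 k)) (matched_keys gs) ->
    homotopy_check gs gs' D S (fun k => fbind (diff_key D0 k) S0) ->
  forall x, differential Ab gs ok0 D0 x = 0 ->
    exists y, differential Ab gs' ok D y = x.
Proof.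
move=> D0r Dr D0m check x x0.
apply: (homotopy_exact (f := differential Ab gs ok0 D0) ok' Dr lambda_neq0 lambda_neq1
  (key_extendD (b := b) c (fun k => fevR (key_elt b (gen Ab ok)) (S0 k)) (gs := gs0))
  (key_extendZ (b := b) c (fun k => fevR (key_elt b (gen Ab ok)) (S0 k)) (gs := gs0))
  _ check x0).
move=> k mk; rewrite (differential_key Ab ok0 ok D0r) //.
have /allP m0 := matched_keysP D0m mk.
rewrite feval_bind (@eq_feval_scalars _ _ _ _ _ (in_alg R) _ _
  (key_extend c (gs := gs0) (fun k => fevR (key_elt b (gen Ab ok)) (S0 k)))).
- apply: eq_in_feval => y /m0; exact: key_extendE.
- exact: key_extendD.
- exact: key_extendZ.
Qed.

Lemma exact_augmentation x : augmentation x = 0 <-> exists y, d1 y = x.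
Proof.
split=> [x0|[y <-]].
  apply: (homotopy_exact arrow_gens_ok diff1_range lambda_neq0 lambda_neq1
    unit_sectionD unit_sectionZ _ (S := homotopy_key homotopy0)
    (T := fun k => fbind (mul_basis k.1.1 k.2) unit_key) _ x0).
    move=> k mk; rewrite augmentation_key // unit_section_feval //.
    by case/and5P: mk => p12 q12 _ _ _; apply: mul_basis_lt.
  by vm_compute.
apply: differential_comp0 => j j4; rewrite feval_augmentation.
  suff: fevA (fbind (diff1 j) (fun k => mul_basis k.1.1 k.2)) = 0 by [].
  by case: j j4 => [|[|[|[|//]]]] _; apply: feval_zero; vm_compute.
by case: j j4 => [|[|[|[|//]]]] _; vm_compute.
Qed.

Lemma exact_d1 x : d1 x = 0 <-> exists y, d2 y = x.
Proof.
split=> [|[y <-]].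
  apply: (@differential_exact _ _ _ vertex_gens_ok arrow_gens_ok relation_gens_ok
    diff1 diff2 (homotopy_key homotopy0) (homotopy_key homotopy1)
    diff1_range diff2_range).
    by vm_compute.
  by vm_compute.
apply: differential_comp0 => j j4; rewrite (feval_differential Ab vertex_gens_ok arrow_gens_ok diff1_range).
  by case: j j4 => [|[|[|[|//]]]] _; apply: feval_zero; vm_compute.
by case: j j4 => [|[|[|[|//]]]] _; vm_compute.
Qed.

Lemma exact_d2 x : d2 x = 0 <-> exists y, d3 y = x.
Proof.
split=> [|[y <-]].
  apply: (@differential_exact _ _ _ arrow_gens_ok relation_gens_ok vertex_gens_ok
    diff2 diff3 (homotopy_key homotopy1) (homotopy_key homotopy2)
    diff2_range diff3_range).
    by vm_compute.
  by vm_compute.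
apply: differential_comp0 => j j2; rewrite (feval_differential Ab arrow_gens_ok relation_gens_ok diff2_range).
  by case: j j2 => [|[|//]] _; apply: feval_zero; vm_compute.
by case: j j2 => [|[|//]] _; vm_compute.
Qed.

Definition L3_resolution : projective_resolution (regbimod A) :=
  extend_resolution (bimod_projective Ab vertex_gens_ok)
    (bimod_projective Ab arrow_gens_ok) (bimod_projective Ab relation_gens_ok)
    augmentation_surj exact_augmentation exact_d1.

End Resolution.

(** * Cochains *)

(** The pairs for which b_p is parallel to the i-th generator. They index a basis of the bimodule
    maps to A, because Hom(A e_s (x) e_t A, A) = e_s A e_t. *)
Definition valid (gs : gens) (i p : nat) : bool :=
  [&& i < size gs, p < 12, basis_source p == gen_source gs i &
      basis_target p == gen_target gs i]%N.

Definition coef_at (q : nat) (l : fsum nat) : coef :=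
  foldr (fun x => coef_add x.1) [::] [seq x <- l | x.2 == q].

(** A sparse row of the matrix of Hom(D, A): the coefficient of b_q in the image of generator j, as
    a combination of the unknowns u i s. Zero coefficients are dropped to keep the rows short. *)
Definition diff_row (D : nat -> fsum key) (j q : nat) : fsum (nat * nat) :=
  [seq x <- flatten
    [seq [seq (coef_mul x.1 (coef_at q
                (fbind (mul_basis x.2.1.1 s) (mul_basis^~ x.2.2))), (x.2.1.2, s))
         | s <- iota 0 12] | x <- D j] | ~~ all (eq_op^~ 0) x.1].

Lemma sum_scale_sub (K : fieldType) (V : lmodType K) n m (u : nat -> K)
    (gamma : nat -> K) (beta : nat -> nat -> K) (e : nat -> V) :
  \sum_(p < n) (u p - \sum_(j < m) gamma j * beta j p) *: e p =
  \sum_(p < n) u p *: e p -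
    \sum_(j < m) gamma j *: (\sum_(p < n) beta j p *: e p).
Proof.
under [X in _ = _ - X]eq_bigr do rewrite scaler_sumr.
rewrite exchange_big -sumrB; apply: eq_bigr => p _ /=.
rewrite scalerBl scaler_suml; congr (_ - _).
by apply: eq_bigr => j _; rewrite scalerA.
Qed.

Lemma sum_scale_algC_sub (K : fieldType) (R : algType K) (V : lmodType R) n m
    (t : 'I_n -> R) (gamma : nat -> K) (v : nat -> V) (w : nat -> nat -> V) :
  \sum_(i < n) t i *: (v i - \sum_(j < m) (gamma j)%:A *: w j i) =
  \sum_(i < n) t i *: v i -
    \sum_(j < m) (gamma j)%:A *: (\sum_(i < n) t i *: w j i).
Proof.
under [X in _ = _ - X]eq_bigr do rewrite scaler_sumr.
rewrite exchange_big -sumrB; apply: eq_bigr => i _ /=.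
rewrite scalerBr scaler_sumr; congr (_ - _).
by apply: eq_bigr => j _; apply: scale_algC.
Qed.

Section Cochains.
Variables (K : fieldType) (lambda : K) (A : algType K).
Variables (b : nat -> A) (c : nat -> {linear A -> K^o}).
Hypothesis Ab : based_algebra lambda b c.

Local Notation R := (env A).
Local Notation fevA := (feval lambda (idfun : {rmorphism K -> K}) b).
Local Notation fevR := (feval lambda (in_alg R)).

Definition coboundary_map (D : nat -> fsum key) (u : nat -> nat -> K) (j q : nat) : K :=
  \sum_(x <- diff_row D j q) ceval lambda x.1 * u x.2.1 x.2.2.

Lemma coord_sum (F : nat -> K) p : (p < 12)%N ->
  c p (\sum_(q < 12) F q *: b q) = F p.
Proof.
move=> p12; rewrite linear_sum (bigD1 (Ordinal p12)) //= big1 => [|q pq].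
  by rewrite linearZ_LR /= (basis_coord Ab) // eqxx addr0; apply: mulr1.
rewrite linearZ_LR /= (basis_coord Ab) // eq_sym (negPf (_ : q != p :> nat)) //.
exact: mulr0.
Qed.

Lemma coord_feval p l : (p < 12)%N -> all (fun y => y.2 < 12)%N l ->
  c p (fevA l) = ceval lambda (coef_at p l).
Proof.
move=> p12; elim: l => [|[d q] l IHl] /=; first by rewrite feval_nil linear0.
case/andP=> q12 /IHl{}IHl; rewrite feval_cons linearP IHl /= (basis_coord Ab) //.
rewrite /coef_at /=; case: (eqVneq q p) => [->|pq].
  by rewrite /= cevalD; congr (_ + _); apply: mulr1.
by rewrite -[RHS]add0r; congr (_ + _); apply: mulr0.
Qed.

Section OneBimodule.
Variable gs : gens.
Hypothesis gs_ok : gens_ok gs.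
Local Notation gn := (gen Ab gs_ok).

Lemma gen_idem_basis i p : (i < size gs)%N -> (p < 12)%N ->
  b (vertex_basis (gen_source gs i)) * b p * b (vertex_basis (gen_target gs i)) =
  if valid gs i p then b p else 0.
Proof.
move=> igs p12; rewrite (vertexM_basis Ab) ?(gen_source_lt2 gs_ok) // /valid igs p12.
case: eqP => _ /=; last by rewrite mul0r.
by rewrite (basisM_vertex Ab) // (gen_target_lt2 gs_ok).
Qed.

Lemma gen_idem_sum i (F : nat -> K) : (i < size gs)%N ->
  gen_idem b gs i *: ((\sum_(p < 12) F p *: b p : A) : regbimod A) =
  \sum_(p < 12) (if valid gs i p then F p else 0) *: b p :> A.
Proof.
move=> igs; apply: etrans (tensor_scale _ _ _) _.
rewrite mulr_sumr mulr_suml; apply: eq_bigr => p _.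
rewrite -scalerAr -scalerAl gen_idem_basis //.
by case: ifP => _; rewrite ?scaler0 ?scale0r.
Qed.

Definition cochain (u : nat -> nat -> K) : {linear bimod b gs -> regbimod A} :=
  bimod_hom b gs (V := regbimod A) (fun i => (\sum_(p < 12) u i p *: b p : A)).

Definition cochain_coord (f : bimod b gs -> regbimod A) (i p : nat) : K :=
  c p (f (gn i) : A).

Lemma cochain_coord_valid (f : {linear bimod b gs -> regbimod A}) i p :
  (i < size gs)%N -> (p < 12)%N ->
  cochain_coord f i p = if valid gs i p then cochain_coord f i p else 0.
Proof.
move=> igs p12; rewrite /cochain_coord.
have e : f (gn i) = gen_idem b gs i *: f (gn i).
  exact: etrans (congr1 f (esym (gen_idem_gen Ab gs_ok i))) (linearZ_LR f _ _).
have {}e := etrans e (etrans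
  (congr1 (fun y : regbimod A => gen_idem b gs i *: y) (basis_span Ab (f (gn i))))
  (gen_idem_sum (fun p => c p (f (gn i) : A)) igs)).
exact: etrans (congr1 (c p) e)
  (coord_sum (fun p => if valid gs i p then c p (f (gn i) : A) else 0) p12).
Qed.

Lemma cochainK u i p : valid gs i p -> cochain_coord (cochain u) i p = u i p.
Proof.
move=> v; case/and4P: (v) => igs p12 _ _.
have e := etrans (bimod_hom_gen Ab gs_ok (V := regbimod A)
  (fun i => (\sum_(p < 12) u i p *: b p : A)) igs) (gen_idem_sum (u i) igs).
apply: etrans (congr1 (c p) e) _.
apply: etrans (coord_sum (fun p => if valid gs i p then u i p else 0) p12) _.
by rewrite v.
Qed.

Lemma cochain_eta (f : {linear bimod b gs -> regbimod A}) x :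
  f x = cochain (cochain_coord f) x.
Proof.
rewrite (bimod_hom_eta Ab gs_ok); apply: eq_bigr => i _.
exact: (congr1 (fun y : regbimod A => val x 0 i *: y) (basis_span Ab _)).
Qed.

Lemma eq_cochain u v x : (forall i p, valid gs i p -> u i p = v i p) ->
  cochain u x = cochain v x.
Proof.
move=> uv; rewrite (cochain_eta (cochain u)) (cochain_eta (cochain v)).
apply: eq_bigr => i _; apply: (congr1 (fun y : regbimod A => val x 0 i *: y)).
apply: eq_bigr => p _; apply: (congr1 (fun k : K => k *: b p)).
rewrite (cochain_coord_valid (cochain u)) // (cochain_coord_valid (cochain v)) //.
by case: ifP => // vip; rewrite !cochainK // uv.
Qed.

Lemma cochain_sub u (beta : nat -> nat -> nat -> K) (gamma : nat -> K) m x :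
  cochain (fun i p => u i p - \sum_(j < m) gamma j * beta j i p) x =
  cochain u x - \sum_(j < m) (gamma j)%:A *: cochain (beta j) x.
Proof.
have nE i : (\sum_(p < 12) (u i p - \sum_(j < m) gamma j * beta j i p) *: b p : A) =
    ((\sum_(p < 12) u i p *: b p : A) : regbimod A) - \sum_(j < m)
      (gamma j)%:A *: ((\sum_(p < 12) beta j i p *: b p : A) : regbimod A).
  apply: etrans (@sum_scale_sub K A 12 m (u i) gamma (fun j => beta j i) b) _.
  apply: (congr1 (fun y : A => _ - y)); apply: eq_bigr => j _.
  exact: esym (regbimod_scale _ _).
apply: etrans (eq_bigr _ (fun i _ => congr1 (fun y : regbimod A => val x 0 i *: y) (nE i))) _.
refine (@sum_scale_algC_sub K R (regbimod A) _ m (fun i => val x 0 i) gamma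
  (fun i => (\sum_(p < 12) u i p *: b p : A) : regbimod A)
  (fun j i => (\sum_(p < 12) beta j i p *: b p : A) : regbimod A)).
Qed.

End OneBimodule.
Lemma coord_gen_idem gs (gs_ok : gens_ok gs) j q (X : regbimod A) :
  valid gs j q -> c q (gen_idem b gs j *: X : A) = c q (X : A).
Proof.
move=> v; case/and4P: (v) => jgs q12 _ _.
have e := etrans
  (congr1 (fun y : regbimod A => gen_idem b gs j *: y) (basis_span Ab X))
  (gen_idem_sum gs_ok (fun p => c p (X : A)) jgs).
apply: etrans (congr1 (c q) e) _.
apply: etrans (coord_sum (fun p => if valid gs j p then c p (X : A) else 0) q12) _.
by rewrite v.
Qed.

Lemma coord_fevR T (F : T -> regbimod A) l q :
  c q (fevR F l : A) = \sum_(x <- l) ceval lambda x.1 * c q (F x.2 : A).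
Proof.
elim: l => [|[k t] l IHl]; first by rewrite feval_nil big_nil; apply: linear0.
rewrite feval_cons big_cons -IHl.
apply: etrans (linearD (c q) _ _) _; congr (_ + _).
apply: etrans (congr1 (c q) (regbimod_scale _ _)) _.
exact: linearZ_LR.
Qed.

Lemma mul_basis2_lt p s r : (p < 12)%N -> (s < 12)%N -> (r < 12)%N ->
  all (fun y => y.2 < 12)%N (fbind (mul_basis p s) (mul_basis^~ r)).
Proof.
move=> p12 s12 r12; apply/allP => y /flattenP[_ /mapP[x xl ->]] /mapP[z zl ->] /=.
have x12 := allP (mul_basis_lt p12 s12) _ xl.
exact: (allP (mul_basis_lt x12 r12) _ zl).
Qed.

Lemma coord_sandwich p r q (X : A) : (p < 12)%N -> (r < 12)%N -> (q < 12)%N ->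
  c q (b p * X * b r) = \sum_(s <- iota 0 12)
    ceval lambda (coef_at q (fbind (mul_basis p s) (mul_basis^~ r))) * c s X.
Proof.
move=> p12 r12 q12; rewrite [in LHS](basis_span Ab X) mulr_sumr mulr_suml linear_sum.
rewrite -[iota 0 12]/(index_iota 0 12) big_mkord; apply: eq_bigr => s _.
rewrite -scalerAr -scalerAl linearZ_LR mulrC; congr (_ * _).
rewrite (basis_mul Ab) // -(coord_feval q12) ?mul_basis2_lt //; congr (c q _).
rewrite feval_bind /feval mulr_suml; apply: eq_big_seq => y yl.
rewrite -scalerAl (basis_mul Ab) //.
exact: (allP (mul_basis_lt p12 (ltn_ord s)) _ yl).
Qed.

Lemma coboundary_mapE D u j q : coboundary_map D u j q =
  \sum_(x <- D j) ceval lambda x.1 * \sum_(s <- iota 0 12)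
    ceval lambda (coef_at q (fbind (mul_basis x.2.1.1 s) (mul_basis^~ x.2.2))) *
    u x.2.1.2 s.
Proof.
rewrite /coboundary_map big_filter big_mkcond big_flatten big_map.
apply: eq_bigr => x _; rewrite big_map mulr_sumr; apply: eq_bigr => s _ /=.
case: ifPn => [_|/negPn/ceval0]; first by rewrite cevalM mulrA.
by rewrite mulrA -cevalM => ->; rewrite mul0r.
Qed.

Section TwoBimodules.
Variables (gs gs' : gens).
Hypotheses (gs_ok : gens_ok gs) (gs'_ok : gens_ok gs').
Variable D : nat -> fsum key.
Hypothesis D_range : forall j, in_range (D j).
Variable f : {linear bimod b gs -> regbimod A}.

Lemma cochain_coord_differential j q : valid gs' j q ->
  cochain_coord gs'_ok (f \o differential Ab gs' gs_ok D) j q =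
  coboundary_map D (cochain_coord gs_ok f) j q.
Proof.
move=> v; case/and4P: (v) => jgs q12 _ _; rewrite /cochain_coord.
have e : f (differential Ab gs' gs_ok D (gen Ab gs'_ok j)) =
    gen_idem b gs' j *: fevR (key_elt b (f \o gen Ab gs_ok)) (D j).
  apply: etrans (congr1 f (bimod_hom_gen Ab gs'_ok _ jgs)) _.
  apply: etrans (linearZ_LR f _ _) _; congr (_ *: _).
  exact: feval_key_hom.
apply: etrans (congr1 (c q) e) _.
rewrite coord_gen_idem // coord_fevR coboundary_mapE; apply: eq_big_seq => x xD.
have /andP[p12 r12] := allP (D_range j) _ xD.
congr (_ * _); apply: etrans (congr1 (c q) (key_elt_reg _ _ _)) _.
exact: coord_sandwich.
Qed.

Lemma differential_cochain_eq (h : {linear bimod b gs' -> regbimod A}) :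
  (forall x, h x = f (differential Ab gs' gs_ok D x)) <->
  (forall j q, valid gs' j q -> cochain_coord gs'_ok h j q =
    coboundary_map D (cochain_coord gs_ok f) j q).
Proof.
split=> [hf j q v|hf x].
  rewrite -cochain_coord_differential // /cochain_coord.
  exact: (congr1 (c q) (hf _)).
rewrite (cochain_eta gs'_ok).
apply: etrans _ (esym (cochain_eta gs'_ok (f \o differential Ab gs' gs_ok D) x)).
by apply: (eq_cochain gs'_ok) => j q v; rewrite hf // cochain_coord_differential.
Qed.

Lemma differential_cochain_eq0 :
  (forall x, f (differential Ab gs' gs_ok D x) = 0) <->
  (forall j q, valid gs' j q -> coboundary_map D (cochain_coord gs_ok f) j q = 0).
Proof.
have z j q : cochain_coord gs'_ok (\0 : {linear bimod b gs' -> regbimod A}) j q = 0.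
  exact: linear0.
split=> [f0 j q v|f0 x].
  by rewrite -(proj1 (differential_cochain_eq \0)) ?z // => x; rewrite f0.
rewrite -(proj2 (differential_cochain_eq \0)) // => j q v.
by rewrite f0 // z.
Qed.

End TwoBimodules.

Section ExtFromCochains.
Variables (gs : gens) (gs_ok : gens_ok gs).
Variable Z : {linear bimod b gs -> regbimod A} -> Prop.
Variable B : (bimod b gs -> regbimod A) -> Prop.
Hypothesis B_ext : forall f g, f =1 g -> B f -> B g.

(** The forms [ell] read off the coefficients of a class, so a single equivalence gives both
    existence and uniqueness. [Z] and [B] stand for cocycles and coboundaries, whatever the
    degree. *)
Lemma ext_of_cochains m (beta : nat -> nat -> nat -> K)
    (ell : (nat -> nat -> K) -> nat -> K) :
    (forall j, (j < m)%N -> Z (cochain gs (beta j))) ->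
    (forall f, Z f -> forall gamma : nat -> K,
      B (cochain gs (fun i p =>
        cochain_coord gs_ok f i p - \sum_(j < m) gamma j * beta j i p)) <->
      (forall j, (j < m)%N -> gamma j = ell (cochain_coord gs_ok f) j)) ->
  exists e : 'I_m -> {linear bimod b gs -> regbimod A}, (forall i, Z (e i)) /\
    forall f : {linear bimod b gs -> regbimod A}, Z f ->
      exists! a : {ffun 'I_m -> K},
        B (fun x => f x - \sum_i (a i)%:A *: e i x).
Proof.
move=> Zbeta Bbeta; exists (fun i => cochain gs (beta i)); split=> [i|f Zf].
  exact: Zbeta.
have combE (a : {ffun 'I_m -> K}) (gamma : nat -> K) : (forall i : 'I_m, a i = gamma i) ->
    (fun x => f x - \sum_i (a i)%:A *: cochain gs (beta i) x) =1
    cochain gs (fun i p =>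
      cochain_coord gs_ok f i p - \sum_(j < m) gamma j * beta j i p).
  move=> ag x.
  have e := cochain_sub (gs := gs) (cochain_coord gs_ok f) beta gamma m x.
  apply: etrans _ (esym e); rewrite -(cochain_eta gs_ok).
  apply: (congr1 (fun y : regbimod A => f x - y)); apply: eq_bigr => i _.
  exact: (congr1 (fun k : K => k%:A *: cochain gs (beta i) x) (ag i)).
exists [ffun i => ell (cochain_coord gs_ok f) (i : 'I_m)]; split.
  have h := combE [ffun i => ell (cochain_coord gs_ok f) (i : 'I_m)]
    (ell (cochain_coord gs_ok f)) (fun i => ffunE _ _).
  by apply: (B_ext (fsym h)); apply/Bbeta.
(* The coefficients are extended by zero past [m]; the sums see only indices below [m]. *)
move=> a aB; pose gamma j := oapp a 0 (insub j : option 'I_m).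
have ag i : a i = gamma i by rewrite /gamma valK.
have {aB} := B_ext (combE a gamma ag) aB.
move=> /(Bbeta _ Zf) gl; apply/ffunP => i.
by rewrite ffunE ag gl.
Qed.

End ExtFromCochains.
End Cochains.

Definition valid_pairs (gs : gens) : seq (nat * nat) :=
  [seq ip <- [seq (i, p) | i <- iota 0 (size gs), p <- iota 0 12] |
    valid gs ip.1 ip.2].

Lemma valid_ind (gs : gens) (P : nat -> nat -> Prop) s : valid_pairs gs = s ->
    foldr (fun ip Q => P ip.1 ip.2 /\ Q) True s ->
  forall i p, valid gs i p -> P i p.
Proof.
move=> <- Pall i p v; have : (i, p) \in valid_pairs gs.
  rewrite mem_filter v andTb; case/and4P: v => igs p12 _ _.
  by apply/allpairsP; exists (i, p); rewrite !mem_iota.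
elim: (valid_pairs gs) Pall => //= x l IHl [Px Pl].
by rewrite inE => /orP[/eqP ex|/IHl]; [move: Px; rewrite -ex | apply].
Qed.

Fact vertex_valid_pairs : valid_pairs vertex_gens =
  [:: (0, 0); (0, 1); (0, 3); (0, 5); (1, 6); (1, 7); (1, 9); (1, 11)]%N.
Proof. by vm_compute. Qed.

Fact arrow_valid_pairs : valid_pairs arrow_gens =
  [:: (0, 0); (0, 1); (0, 3); (0, 5); (1, 2); (1, 4);
      (2, 8); (2, 10); (3, 6); (3, 7); (3, 9); (3, 11)]%N.
Proof. by vm_compute. Qed.

Fact relation_valid_pairs : valid_pairs relation_gens =
  [:: (0, 0); (0, 1); (0, 3); (0, 5); (1, 6); (1, 7); (1, 9); (1, 11);
      (2, 8); (2, 10); (3, 2); (3, 4)]%N.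
Proof. by vm_compute. Qed.

(** * The Hom complex as explicit matrices *)

Section ExplicitCoboundaries.
Variables (K : fieldType) (lambda : K).
Implicit Types u : nat -> nat -> K.

(* u i p is the coefficient of b_p in the value of a cochain at the i-th       *)
(* generator.                                                                  *)
Definition delta1 u (j q : nat) : K := match j, q with
  | 1, 2 => u 1%N 6%N - u 0%N 0%N
  | 1, 4 => u 1%N 7%N - u 0%N 1%N
  | 2, 8 => u 0%N 0%N - u 1%N 6%N
  | 2, 10 => u 0%N 1%N - u 1%N 7%N
  | _, _ => 0
  end.

(** The factors 2 come from alpha u + u alpha and beta u + u beta. When 2 = 0, the entries (0, 1)
    and (1, 7) vanish and (1, 9), (1, 11) become lambda times (0, 3), (0, 5); this is the drop of
    the rank from 6 to 4. *)
Definition delta2 u (j q : nat) : K := match j, q with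
  | 0, 1 => 2%:R * u 0%N 0%N
  | 0, 3 => 2%:R * u 0%N 1%N - u 1%N 2%N - u 2%N 8%N
  | 0, 5 => 2%:R * u 0%N 3%N - u 1%N 4%N - u 2%N 10%N
  | 1, 7 => lambda * (2%:R * u 3%N 6%N)
  | 1, 9 => lambda * (2%:R * u 3%N 7%N - u 1%N 2%N - u 2%N 8%N)
  | 1, 11 => lambda * (2%:R * u 3%N 9%N - u 1%N 4%N - u 2%N 10%N)
  | 2, 8 | 3, 2 => u 0%N 0%N - u 3%N 6%N
  | 2, 10 | 3, 4 => u 0%N 1%N - u 3%N 7%N
  | _, _ => 0
  end.

Definition delta3 u (j q : nat) : K := match j, q with
  | 0, 3 => u 3%N 2%N - u 2%N 8%N
  | 0, 5 => u 3%N 4%N - u 2%N 10%N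
  | 1, 9 => lambda * (u 2%N 8%N - u 3%N 2%N)
  | 1, 11 => lambda * (u 2%N 10%N - u 3%N 4%N)
  | _, _ => 0
  end.

(** The row is evaluated first, so that [ring] meets only a short explicit sum. *)
Ltac expand_row := rewrite /coboundary_map /=;
  match goal with |- context [diff_row ?D ?j ?q] =>
    let r := eval vm_compute in (diff_row D j q) in
    rewrite (_ : diff_row D j q = r); [idtac | vm_cast_no_check (@erefl _ r)]
  end;
  rewrite ?big_cons big_nil /=; ring.

Lemma coboundary_map1 u j q : valid arrow_gens j q ->
  coboundary_map lambda diff1 u j q = delta1 u j q.
Proof.
move: j q; apply: (valid_ind arrow_valid_pairs).
by do ![split; first by expand_row].
Qed.

Lemma coboundary_map2 u j q : valid relation_gens j q ->
  coboundary_map lambda diff2 u j q = delta2 u j q.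
Proof.
move: j q; apply: (valid_ind relation_valid_pairs).
by do ![split; first by expand_row].
Qed.

Lemma coboundary_map3 u j q : valid vertex_gens j q ->
  coboundary_map lambda diff3 u j q = delta3 u j q.
Proof.
move: j q; apply: (valid_ind vertex_valid_pairs).
by do ![split; first by expand_row].
Qed.

End ExplicitCoboundaries.

(** * Hochschild cohomology as linear algebra over K *)

Section ExtCriteria.
Variables (K : fieldType) (lambda : K) (A : algType K).
Variables (b : nat -> A) (c : nat -> {linear A -> K^o}).
Hypothesis Ab : based_algebra lambda b c.
Hypotheses (lambda_neq0 : lambda != 0) (lambda_neq1 : lambda != 1).

Local Notation P := (L3_resolution Ab lambda_neq0 lambda_neq1).
Local Notation N := (regbimod A).
Local Notation delta2 := (delta2 lambda).
Local Notation delta3 := (delta3 lambda).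
Implicit Types u y : nat -> nat -> K.

Lemma delta1_ext u v : (forall i p, valid vertex_gens i p -> u i p = v i p) ->
  forall i p, valid arrow_gens i p -> delta1 u i p = delta1 v i p.
Proof.
move=> uv; apply: (valid_ind arrow_valid_pairs).
by do ![split=> //=; rewrite ?uv //].
Qed.

Lemma delta2_ext u v : (forall i p, valid arrow_gens i p -> u i p = v i p) ->
  forall i p, valid relation_gens i p -> delta2 u i p = delta2 v i p.
Proof.
move=> uv; apply: (valid_ind relation_valid_pairs).
by do ![split=> //=; rewrite ?uv //].
Qed.

Lemma delta3_ext u v : (forall i p, valid relation_gens i p -> u i p = v i p) ->
  forall i p, valid vertex_gens i p -> delta3 u i p = delta3 v i p.
Proof.
move=> uv; apply: (valid_ind vertex_valid_pairs).
by do ![split=> //=; rewrite ?uv //].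
Qed.

Lemma cocycle0P (f : {linear bimod b vertex_gens -> N}) :
  cocycle (P := P) (n := 0) f <-> forall i p, valid arrow_gens i p ->
    delta1 (cochain_coord Ab vertex_gens_ok f) i p = 0.
Proof.
apply: (iff_trans (differential_cochain_eq0 Ab vertex_gens_ok arrow_gens_ok
  diff1_range f)).
by split=> h i p v; have := h i p v; rewrite coboundary_map1.
Qed.

Lemma cocycle1P (f : {linear bimod b arrow_gens -> N}) :
  cocycle (P := P) (n := 1) f <-> forall i p, valid relation_gens i p ->
    delta2 (cochain_coord Ab arrow_gens_ok f) i p = 0.
Proof.
apply: (iff_trans (differential_cochain_eq0 Ab arrow_gens_ok relation_gens_ok
  diff2_range f)).
by split=> h i p v; have := h i p v; rewrite coboundary_map2.
Qed.

Lemma cocycle2P (f : {linear bimod b relation_gens -> N}) :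
  cocycle (P := P) (n := 2) f <-> forall i p, valid vertex_gens i p ->
    delta3 (cochain_coord Ab relation_gens_ok f) i p = 0.
Proof.
(* In degree 3 the resolution has the free cover of the kernel of [d2], not the explicit third term.
   Both have that kernel as image, so they impose the same cocycle condition. *)
have d3P : cocycle (P := P) (n := 2) f <-> forall x, f (d3 Ab x) = 0.
  split=> cf x.
    have /(@res_exactS _ _ P 1)[y <-] : d2 Ab (d3 Ab x) = 0.
      by apply/(exact_d2 Ab lambda_neq0 lambda_neq1); exists x.
    exact: cf.
  have /(exact_d2 Ab lambda_neq0 lambda_neq1)[y yx] : d2 Ab (res_diff P 2 x) = 0.
    exact (res_diffK (P := P) (n := 1) x).
  exact: etrans (congr1 f (esym yx)) (cf y).
apply: (iff_trans d3P).
apply: (iff_trans (differential_cochain_eq0 Ab relation_gens_ok vertex_gens_ok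
  diff3_range f)).
by split=> h i p v; have := h i p v; rewrite coboundary_map3.
Qed.

Lemma coboundary0P u :
  coboundary (P := P) (n := 0) (cochain b vertex_gens u) <->
  forall i p, valid vertex_gens i p -> u i p = 0.
Proof.
split=> [u0 i p v|u0 x].
  rewrite -(cochainK Ab vertex_gens_ok u v).
  exact: etrans (congr1 (c p) (u0 _)) (linear0 (c p)).
pose z : {linear bimod b vertex_gens -> N} := \0.
apply: etrans _ (esym (cochain_eta Ab vertex_gens_ok z x)).
apply: (eq_cochain Ab vertex_gens_ok) => i p v.
by rewrite u0 //; apply: esym; apply: (linear0 (c p)).
Qed.

Lemma coboundary1P u :
  coboundary (P := P) (n := 1) (cochain b arrow_gens u) <->
  exists y, forall i p, valid arrow_gens i p -> u i p = delta1 y i p.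
Proof.
split=> [[g gP]|[y yP]].
  exists (cochain_coord Ab vertex_gens_ok g) => i p v.
  have /(_ i p v) := proj1 (differential_cochain_eq Ab vertex_gens_ok
    arrow_gens_ok diff1_range g (cochain b arrow_gens u)) gP.
  by rewrite cochainK // coboundary_map1.
exists (cochain b vertex_gens y).
apply: (proj2 (differential_cochain_eq Ab vertex_gens_ok
  arrow_gens_ok diff1_range (cochain b vertex_gens y) (cochain b arrow_gens u))).
move=> i p v; rewrite cochainK // coboundary_map1 // yP //.
by apply: delta1_ext v => j q v; rewrite cochainK.
Qed.

Lemma coboundary2P u :
  coboundary (P := P) (n := 2) (cochain b relation_gens u) <->
  exists y, forall i p, valid relation_gens i p -> u i p = delta2 y i p.
Proof.
split=> [[g gP]|[y yP]].
  exists (cochain_coord Ab arrow_gens_ok g) => i p v.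
  have /(_ i p v) := proj1 (differential_cochain_eq Ab arrow_gens_ok
    relation_gens_ok diff2_range g (cochain b relation_gens u)) gP.
  by rewrite cochainK // coboundary_map2.
exists (cochain b arrow_gens y).
apply: (proj2 (differential_cochain_eq Ab arrow_gens_ok relation_gens_ok
  diff2_range (cochain b arrow_gens y) (cochain b relation_gens u))).
move=> i p v; rewrite cochainK // coboundary_map2 // yP //.
by apply: delta2_ext v => j q v; rewrite cochainK.
Qed.

Variables (m : nat) (beta : nat -> nat -> nat -> K).
Variable ell : (nat -> nat -> K) -> nat -> K.

Lemma HH0_criterion :
    (forall j, (j < m)%N -> forall i p, valid arrow_gens i p ->
      delta1 (beta j) i p = 0) ->
    (forall u, (forall i p, valid arrow_gens i p -> delta1 u i p = 0) ->
      forall gamma : nat -> K,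
      (forall i p, valid vertex_gens i p ->
        u i p - \sum_(j < m) gamma j * beta j i p = 0) <->
      (forall j, (j < m)%N -> gamma j = ell u j)) ->
  HH_dim A 0 m.
Proof.
move=> betaZ betaB; apply: (@Ext_dim_atP _ _ _ _ P).
apply: (@ext_of_cochains _ _ _ _ _ Ab _ vertex_gens_ok (@cocycle _ _ _ _ P 0)
  (@coboundary _ _ _ _ P 0) (@coboundary_ext _ _ _ _ P 0) m beta ell).
- move=> j jm; apply/cocycle0P => i p v; rewrite -(betaZ j jm i p v).
  by apply: delta1_ext v => i' p' v; rewrite cochainK.
move=> f /cocycle0P /betaB uB gamma.
by apply: iff_trans (coboundary0P _) (uB gamma).
Qed.

Lemma HH1_criterion :
    (forall j, (j < m)%N -> forall i p, valid relation_gens i p ->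
      delta2 (beta j) i p = 0) ->
    (forall u, (forall i p, valid relation_gens i p -> delta2 u i p = 0) ->
      forall gamma : nat -> K,
      (exists y, forall i p, valid arrow_gens i p ->
        u i p - \sum_(j < m) gamma j * beta j i p = delta1 y i p) <->
      (forall j, (j < m)%N -> gamma j = ell u j)) ->
  HH_dim A 1 m.
Proof.
move=> betaZ betaB; apply: (@Ext_dim_atP _ _ _ _ P).
apply: (@ext_of_cochains _ _ _ _ _ Ab _ arrow_gens_ok (@cocycle _ _ _ _ P 1)
  (@coboundary _ _ _ _ P 1) (@coboundary_ext _ _ _ _ P 1) m beta ell).
- move=> j jm; apply/cocycle1P => i p v; rewrite -(betaZ j jm i p v).
  by apply: delta2_ext v => i' p' v; rewrite cochainK.
move=> f /cocycle1P /betaB uB gamma.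
by apply: iff_trans (coboundary1P _) (uB gamma).
Qed.

Lemma HH2_criterion :
    (forall j, (j < m)%N -> forall i p, valid vertex_gens i p ->
      delta3 (beta j) i p = 0) ->
    (forall u, (forall i p, valid vertex_gens i p -> delta3 u i p = 0) ->
      forall gamma : nat -> K,
      (exists y, forall i p, valid relation_gens i p ->
        u i p - \sum_(j < m) gamma j * beta j i p = delta2 y i p) <->
      (forall j, (j < m)%N -> gamma j = ell u j)) ->
  HH_dim A 2 m.
Proof.
move=> betaZ betaB; apply: (@Ext_dim_atP _ _ _ _ P).
apply: (@ext_of_cochains _ _ _ _ _ Ab _ relation_gens_ok (@cocycle _ _ _ _ P 2)
  (@coboundary _ _ _ _ P 2) (@coboundary_ext _ _ _ _ P 2) m beta ell).
- move=> j jm; apply/cocycle2P => i p v; rewrite -(betaZ j jm i p v).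
  by apply: delta3_ext v => i' p' v; rewrite cochainK.
move=> f /cocycle2P /betaB uB gamma.
by apply: iff_trans (coboundary2P _) (uB gamma).
Qed.

End ExtCriteria.

(** * Dimensions *)

Lemma subr_swap (V : zmodType) (x y z : V) : x - y = z -> y = x - z.
Proof. by move=> <-; rewrite opprB addrC subrK. Qed.

Section Dimensions.
Variables (K : fieldType) (lambda : K) (A : algType K).
Variables (b : nat -> A) (c : nat -> {linear A -> K^o}).
Hypothesis Ab : based_algebra lambda b c.
Hypotheses (lambda_neq0 : lambda != 0) (lambda_neq1 : lambda != 1).

Ltac expand_sum := rewrite ?big_ord_recr ?big_ord0 /=
  ?(mulr0, mulr1, addr0, add0r, subr0).

Ltac check_basis pairs := 
  let j := fresh "j" in let jm := fresh "jm" in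
  move=> j jm; apply: (valid_ind pairs);
  move: jm; do 6 try (case: j => [_|j] //); do ![split=> //]; rewrite /=; ring.

(** The center has basis 1, alpha + beta, alpha^2, alpha^3, beta^2, beta^3. *)
Lemma HH0_dim : HH_dim A 0 6.
Proof.
apply: (HH0_criterion Ab lambda_neq0 lambda_neq1
  (beta := fun j i p => match j, i, p with
    | 0, 0, 0 | 0, 1, 6 | 1, 0, 1 | 1, 1, 7
    | 2, 0, 3 | 3, 0, 5 | 4, 1, 9 | 5, 1, 11 => 1
    | _, _, _ => 0
    end)
  (ell := fun u j => match j with
    | 0 => u 0%N 0%N | 1 => u 0%N 1%N | 2 => u 0%N 3%N | 3 => u 0%N 5%N
    | 4 => u 1%N 9%N | _ => u 1%N 11%N
    end)).
  by check_basis arrow_valid_pairs.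
move=> u uZ gamma.
have e0 : u 1%N 6%N = u 0%N 0%N by apply/eqP; rewrite -subr_eq0; apply/eqP; apply: (uZ 1%N 2%N).
have e1 : u 1%N 7%N = u 0%N 1%N by apply/eqP; rewrite -subr_eq0; apply/eqP; apply: (uZ 1%N 4%N).
split=> [h [|[|[|[|[|[|//]]]]]] _ | h].
- by have := h 0%N 0%N isT; expand_sum => /subr_swap->; rewrite subr0.
- by have := h 0%N 1%N isT; expand_sum => /subr_swap->; rewrite subr0.
- by have := h 0%N 3%N isT; expand_sum => /subr_swap->; rewrite subr0.
- by have := h 0%N 5%N isT; expand_sum => /subr_swap->; rewrite subr0.
- by have := h 1%N 9%N isT; expand_sum => /subr_swap->; rewrite subr0.
- by have := h 1%N 11%N isT; expand_sum => /subr_swap->; rewrite subr0.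
apply: (valid_ind vertex_valid_pairs).
by do ![split=> //]; expand_sum; rewrite h ?e0 ?e1 ?subrr.
Qed.

(** The classes are represented by four derivations: (alpha, beta, gamma) to (alpha, beta, 2 gamma),
    which is the Euler derivation up to an inner one; (alpha, beta, gamma) to (alpha^2, beta^2, 2
    beta gamma); alpha to alpha^3; beta to beta^3. Arrows not mentioned go to 0. *)
Lemma HH1_dim_char_neq2 : 2%:R != 0 :> K -> HH_dim A 1 4.
Proof.
move=> two_neq0; apply: (HH1_criterion Ab lambda_neq0 lambda_neq1
  (beta := fun j i p => match j, i, p with
    | 0, 0, 1 | 0, 3, 7 | 1, 0, 3 | 1, 3, 9 | 2, 0, 5 | 3, 3, 11 => 1
    | 0, 2, 8 | 1, 2, 10 => 2%:R
    | _, _, _ => 0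
    end)
  (ell := fun u j => match j with
    | 0 => u 0%N 1%N | 1 => u 0%N 3%N | 2 => u 0%N 5%N | _ => u 3%N 11%N
    end)).
  by check_basis relation_valid_pairs.
move=> u uZ gamma.
have e0 : u 0%N 0%N = 0.
  by apply: (mulfI two_neq0); rewrite mulr0; apply: (uZ 0%N 1%N).
have e1 : u 3%N 6%N = 0.
  by have := uZ 2%N 8%N isT => /= /subr_swap->; rewrite e0 subr0.
have e2 : u 3%N 7%N = u 0%N 1%N.
  by have := uZ 2%N 10%N isT => /= /subr_swap->; rewrite subr0.
have e3 : u 2%N 8%N = 2%:R * u 0%N 1%N - u 1%N 2%N.
  by have := uZ 0%N 3%N isT => /= /subr_swap->; rewrite subr0.
have e4 : u 2%N 10%N = 2%:R * u 0%N 3%N - u 1%N 4%N.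
  by have := uZ 0%N 5%N isT => /= /subr_swap->; rewrite subr0.
have e5 : u 3%N 9%N = u 0%N 3%N.
  apply: (mulfI (mulf_neq0 lambda_neq0 two_neq0)).
  by apply/eqP; rewrite -subr_eq0 -[X in _ == X](uZ 1%N 11%N isT) /= e4; apply/eqP; ring.
split=> [[y h] [|[|[|[|//]]]] _ | h].
- by have := h 0%N 1%N isT; expand_sum => /subr_swap->; rewrite subr0.
- by have := h 0%N 3%N isT; expand_sum => /subr_swap->; rewrite subr0.
- by have := h 0%N 5%N isT; expand_sum => /subr_swap->; rewrite subr0.
- by have := h 3%N 11%N isT; expand_sum => /subr_swap->; rewrite subr0.
(* The inner derivation that absorbs the values on sigma; the cocycle equations then account for
   those on gamma. *)
exists (fun i p => match i, p with
  | 1, 6 => u 1%N 2%N | 1, 7 => u 1%N 4%N | _, _ => 0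
  end).
apply: (valid_ind arrow_valid_pairs).
by do ![split=> //]; expand_sum; rewrite ?h ?e0 ?e1 ?e2 ?e3 ?e4 ?e5 //; ring.
Qed.

(** When 2 = 0 the squares of alpha and beta are insensitive to perturbations commuting with alpha
    and beta. So alpha, beta to e_1, e_2 is a derivation, and the one with values alpha^2, beta^2
    splits into two. *)
Lemma HH1_dim_char2 : 2%:R = 0 :> K -> HH_dim A 1 6.
Proof.
move=> two0; apply: (HH1_criterion Ab lambda_neq0 lambda_neq1
  (beta := fun j i p => match j, i, p with
    | 0, 0, 0 | 0, 3, 6 | 1, 0, 1 | 1, 3, 7
    | 2, 0, 3 | 3, 3, 9 | 4, 0, 5 | 5, 3, 11 => 1
    | _, _, _ => 0
    end)
  (ell := fun u j => match j with
    | 0 => u 0%N 0%N | 1 => u 0%N 1%N | 2 => u 0%N 3%N | 3 => u 3%N 9%N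
    | 4 => u 0%N 5%N | _ => u 3%N 11%N
    end)).
  move=> j jm; apply: (valid_ind relation_valid_pairs).
  move: jm; do 6 try (case: j => [_|j] //); do ![split=> //]; rewrite /= ?two0; ring.
move=> u uZ gamma.
have e1 : u 3%N 6%N = u 0%N 0%N.
  by have := uZ 2%N 8%N isT => /= /subr_swap->; rewrite subr0.
have e2 : u 3%N 7%N = u 0%N 1%N.
  by have := uZ 2%N 10%N isT => /= /subr_swap->; rewrite subr0.
have e3 : u 2%N 8%N = - u 1%N 2%N.
  by have := uZ 0%N 3%N isT => /= /subr_swap->; rewrite two0 mul0r sub0r subr0.
have e4 : u 2%N 10%N = - u 1%N 4%N.
  by have := uZ 0%N 5%N isT => /= /subr_swap->; rewrite two0 mul0r sub0r subr0.
split=> [[y h] [|[|[|[|[|[|//]]]]]] _ | h].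
- by have := h 0%N 0%N isT; expand_sum => /subr_swap->; rewrite subr0.
- by have := h 0%N 1%N isT; expand_sum => /subr_swap->; rewrite subr0.
- by have := h 0%N 3%N isT; expand_sum => /subr_swap->; rewrite subr0.
- by have := h 3%N 9%N isT; expand_sum => /subr_swap->; rewrite subr0.
- by have := h 0%N 5%N isT; expand_sum => /subr_swap->; rewrite subr0.
- by have := h 3%N 11%N isT; expand_sum => /subr_swap->; rewrite subr0.
exists (fun i p => match i, p with
  | 1, 6 => u 1%N 2%N | 1, 7 => u 1%N 4%N | _, _ => 0
  end).
apply: (valid_ind arrow_valid_pairs).
by do ![split=> //]; expand_sum; rewrite ?h ?e1 ?e2 ?e3 ?e4 //; ring.
Qed.

(** The representatives send the first relation to e_1, alpha or alpha^2, or the second to e_2. The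
    last two forms are the combinations of coefficients that vanish on the image of [delta2], where
    the contributions of the unknowns cancel. *)
Lemma HH2_dim_char_neq2 : 2%:R != 0 :> K -> HH_dim A 2 4.
Proof.
move=> two_neq0; apply: (HH2_criterion Ab lambda_neq0 lambda_neq1
  (beta := fun j i p => match j, i, p with
    | 0, 0, 0 | 1, 1, 6 | 2, 0, 1 | 3, 0, 3 => 1
    | _, _, _ => 0
    end)
  (ell := fun u j => match j with
    | 0 => u 0%N 0%N | 1 => u 1%N 6%N
    | 2 => u 0%N 1%N - 2%:R * u 2%N 8%N - lambda^-1 * u 1%N 7%N
    | _ => u 0%N 3%N - 2%:R * u 2%N 10%N - lambda^-1 * u 1%N 9%N
    end)).
  by check_basis vertex_valid_pairs.
move=> u uZ gamma.
have e1 : u 3%N 2%N = u 2%N 8%N.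
  by apply/eqP; rewrite -subr_eq0; apply/eqP; apply: (uZ 0%N 3%N).
have e2 : u 3%N 4%N = u 2%N 10%N.
  by apply/eqP; rewrite -subr_eq0; apply/eqP; apply: (uZ 0%N 5%N).
split=> [[y h] [|[|[|[|//]]]] _ | h].
- by have := h 0%N 0%N isT; expand_sum => /subr_swap->; rewrite subr0.
- by have := h 1%N 6%N isT; expand_sum => /subr_swap->; rewrite subr0.
- have := h 0%N 1%N isT; expand_sum => /subr_swap->.
  have := h 1%N 7%N isT; expand_sum => ->; have := h 2%N 8%N isT; expand_sum => ->.
  by rewrite mulKf //; ring.
- have := h 0%N 3%N isT; expand_sum => /subr_swap->.
  have := h 1%N 9%N isT; expand_sum => ->; have := h 2%N 10%N isT; expand_sum => ->.
  by rewrite mulKf //; ring.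
exists (fun i p => match i, p with
  | 0, 0 => u 2%N 8%N + lambda^-1 * u 1%N 7%N / 2%:R
  | 3, 6 => lambda^-1 * u 1%N 7%N / 2%:R
  | 0, 1 => u 2%N 10%N
  | 1, 2 => - (lambda^-1 * u 1%N 9%N)
  | 0, 3 => u 0%N 5%N / 2%:R
  | 3, 9 => lambda^-1 * u 1%N 11%N / 2%:R
  | _, _ => 0
  end).
apply: (valid_ind relation_valid_pairs).
by do ![split=> //]; expand_sum; rewrite ?h ?e1 ?e2 //;
  first [ring | by field; rewrite ?two_neq0 ?lambda_neq0].
Qed.

(** Without the terms 2 u, the coefficients of alpha in the first relation and beta in the second
    become independent invariants, and the alpha^3 coefficient survives modulo the beta^3 one. *)
Lemma HH2_dim_char2 : 2%:R = 0 :> K -> HH_dim A 2 6.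
Proof.
move=> two0; apply: (HH2_criterion Ab lambda_neq0 lambda_neq1
  (beta := fun j i p => match j, i, p with
    | 0, 0, 0 | 1, 1, 6 | 2, 0, 1 | 3, 1, 7 | 4, 0, 3 | 5, 0, 5 => 1
    | _, _, _ => 0
    end)
  (ell := fun u j => match j with
    | 0 => u 0%N 0%N | 1 => u 1%N 6%N | 2 => u 0%N 1%N | 3 => u 1%N 7%N
    | 4 => u 0%N 3%N - lambda^-1 * u 1%N 9%N
    | _ => u 0%N 5%N - lambda^-1 * u 1%N 11%N
    end)).
  by check_basis vertex_valid_pairs.
move=> u uZ gamma.
have e1 : u 3%N 2%N = u 2%N 8%N.
  by apply/eqP; rewrite -subr_eq0; apply/eqP; apply: (uZ 0%N 3%N).
have e2 : u 3%N 4%N = u 2%N 10%N.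
  by apply/eqP; rewrite -subr_eq0; apply/eqP; apply: (uZ 0%N 5%N).
split=> [[y h] [|[|[|[|[|[|//]]]]]] _ | h].
- by have := h 0%N 0%N isT; expand_sum => /subr_swap->; rewrite subr0.
- by have := h 1%N 6%N isT; expand_sum => /subr_swap->; rewrite subr0.
- by have := h 0%N 1%N isT; expand_sum => /subr_swap->; rewrite two0 mul0r subr0.
- by have := h 1%N 7%N isT; expand_sum => /subr_swap->; rewrite two0 mul0r mulr0 subr0.
- have := h 0%N 3%N isT; expand_sum => /subr_swap->.
  have := h 1%N 9%N isT; expand_sum => ->.
  by rewrite mulKf // two0 !mul0r.
- have := h 0%N 5%N isT; expand_sum => /subr_swap->.
  have := h 1%N 11%N isT; expand_sum => ->.
  by rewrite mulKf // two0 !mul0r.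
(* With [y 3 6] and [y 3 7] set to 0, the entries (2, 8) and (2, 10) give [y 0 0] and [y 0 1], while
   (1, 9) and (1, 11) give [y 1 2] and [y 1 4]. *)
exists (fun i p => match i, p with
  | 0, 0 => u 2%N 8%N
  | 0, 1 => u 2%N 10%N
  | 1, 2 => - (lambda^-1 * u 1%N 9%N)
  | 1, 4 => - (lambda^-1 * u 1%N 11%N)
  | _, _ => 0
  end).
apply: (valid_ind relation_valid_pairs).
by do ![split=> //]; expand_sum; rewrite ?h ?e1 ?e2 ?two0 //;
  first [ring | by field; rewrite ?two_neq0 ?lambda_neq0].
Qed.

End Dimensions.

Theorem proposition5p1 (K : closedFieldType) (lambda : K)
    (lambda_neq0 : lambda != 0) (lambda_neq1 : lambda != 1) :
  let A := Lambda3' lambda in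
  [/\ HH_dim A 0 6,
      (2%N \notin [pchar K] -> HH_dim A 1 4) /\
      (2%N \in [pchar K] -> HH_dim A 1 6)
    & (2%N \notin [pchar K] -> HH_dim A 2 4) /\
      (2%N \in [pchar K] -> HH_dim A 2 6)].
Proof.
move=> A; have Ab := L3_based lambda_neq0 lambda_neq1.
have two_neq0 : 2%N \notin [pchar K] -> 2%:R != 0 :> K by rewrite inE.
have two_eq0 : 2%N \in [pchar K] -> 2%:R = 0 :> K by move=> /andP[_ /eqP].
split; first exact: (HH0_dim Ab).
- split=> [/two_neq0|/two_eq0] two.
    exact: (HH1_dim_char_neq2 Ab).
  exact: (HH1_dim_char2 Ab).
- split=> [/two_neq0|/two_eq0] two.
    exact: (HH2_dim_char_neq2 Ab).
  exact: (HH2_dim_char2 Ab).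
Qed.
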